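(* Let $T>0$, $m>5$, let the plane-parallel data $\mathbf u_0=(a(z),b(x,z),0)\in H^m(\mathcal C)$ and $\mathbf f=(f_1(t,z),f_2(t,x,z),0)\in C^\infty([0,T]\times\mathcal C)$, where $\mathcal C=[0,L]\times[0,L]\times[0,1]$ (periodic in $x,y$), be independent of the viscosities and assume that for $i=0,1$ and all $x$ the compatibility conditions $$a(i)=b(x,i)=0,\qquad \nu_3\,\partial_{zz}a(i)+f_1(0,i)=0,$$ $$a(i)\,\partial_x b(x,i)=\nu_1\,\partial_{xx}b(x,i)+\nu_3\,\partial_{zz}b(x,i)+f_2(0,x,i)$$ hold for the viscosities under consideration. Assume that the viscosity coefficients satisfy $\nu_1\le\nu_3$, or $\nu_3\le\nu_1\le\nu_3^{1/(2\alpha)}$ for some fixed $\tfrac12<\alpha<1$. Let $\bm\omega^\nu=\nabla\times\mathbf u^\nu$ and $\bm\omega^0=\nabla\times\mathbf u^0$ be the vorticities of the viscous and inviscid solutions defined in the context. Then $$\bm\omega^\nu\rightharpoonup\bm\omega^0+(\mathbf u^0\times\mathbf n)\,\mu\qquad\text{as }\nu_1,\nu_3\to0$$ weakly-$*$ in $L^\infty(0,T;\mathcal M(\bar{\mathcal C}))$, where $\mathbf n$ is the unit outer normal to the boundary and $\mu$ is the unit-density surface measure on the boundary walls $\{z=0\}\cup\{z=1\}$.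
   Context: Plane-parallel channel flow with anisotropic viscosity. $\mathcal C=[0,L]\times[0,L]\times[0,1]$ with coordinates $(x,y,z)$; all functions are $L$-periodic in $x$ and $y$, and the boundary consists of the two walls $z=0$ and $z=1$. Viscous problem: $\mathbf u^\nu=(u_1^\nu(t,z),u_2^\nu(t,x,z),0)$, with $\nu=(\nu_1,\nu_3)$, is the classical solution of $$\partial_t u_1^\nu-\nu_3\partial_{zz}u_1^\nu=f_1,\qquad \partial_t u_2^\nu+u_1^\nu\partial_x u_2^\nu-\nu_1\partial_{xx}u_2^\nu-\nu_3\partial_{zz}u_2^\nu=f_2\quad\text{on }\mathcal C\times(0,T),$$ with $u_1^\nu=u_2^\nu=0$ at $z=0,1$ and $\mathbf u^\nu|_{t=0}=\mathbf u_0$. Inviscid (Euler) problem: $\mathbf u^0=(u_1^0(t,z),u_2^0(t,x,z),0)$ is the classical solution of $\partial_t u_1^0=f_1$, $\partial_t u_2^0+u_1^0\partial_x u_2^0=f_2$, $\mathbf u^0|_{t=0}=\mathbf u_0$. For such a field, $\nabla\times\mathbf u=(-\partial_z u_2,\partial_z u_1,\partial_x u_2)$. $\mathcal M(\bar{\mathcal C})$ is the space of (vector-valued) finite Radon measures on $\bar{\mathcal C}$; weak-$*$ convergence in $L^\infty(0,T;\mathcal M(\bar{\mathcal C}))$ means convergence of the pairings with test functions in $L^1(0,T;C(\bar{\mathcal C}))$, and functions on $\mathcal C$ are identified with the measures having them as densities with respect to Lebesgue measure. *)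

(* Defs.v *)
From HB Require Import structures.
From mathcomp Require Import all_boot all_order all_algebra.
From mathcomp Require Import all_classical all_reals all_analysis.

Set Implicit Arguments.
Unset Strict Implicit.
Unset Printing Implicit Defensive.

Import Order.TTheory GRing.Theory Num.Theory.
Import numFieldNormedType.Exports.

Local Open Scope classical_set_scope.
Local Open Scope ring_scope.

(* Points ((x, y), z) of R^3 and points (t, ((x, y), z)) of space-time.
   Functions that are L-periodic in x and y are functions on the whole of R in
   these two variables; the cell [0, L] x [0, L] is used for integration. *)
Notation pt R := (R * R * R)%type.
Notation st R := (R * (R * R * R))%type.
(* the same points, with the sigma-algebra on which lebesgue_measure lives *)
Notation mpt R := (measurableTypeR R * measurableTypeR R * measurableTypeR R)%type.

Section Geometry.
Context {R : realType}.

Definition cell (L : R) : set (pt R) :=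
  [set p | [/\ 0 < p.1.1 < L, 0 < p.1.2 < L & 0 < p.2 < 1]].

Definition cell_bar (L : R) : set (pt R) :=
  [set p | [/\ 0 <= p.1.1 <= L, 0 <= p.1.2 <= L & 0 <= p.2 <= 1]].

Definition walls (L : R) : set (pt R) :=
  cell_bar L `&` [set p | p.2 = 0 \/ p.2 = 1].

(* (0,T) x R^2 x (0,1) and [0,T] x R^2 x [0,1] *)
Definition cyl (T : R) : set (st R) :=
  [set q | 0 < q.1 < T /\ 0 < q.2.2 < 1].

Definition cyl_bar (T : R) : set (st R) :=
  [set q | 0 <= q.1 <= T /\ 0 <= q.2.2 <= 1].

Definition row3 (x y z : R) : 'rV[R]_3 := \row_(j < 3) [:: x; y; z]`_j.

Definition crossv (v w : 'rV[R]_3) : 'rV[R]_3 :=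
  row3 (v 0 1 * w 0 2 - v 0 2 * w 0 1)
       (v 0 2 * w 0 0 - v 0 0 * w 0 2)
       (v 0 0 * w 0 1 - v 0 1 * w 0 0).

(* unit outer normal to the walls; only used at points with z = 0 or z = 1 *)
Definition outer_normal (p : pt R) : 'rV[R]_3 :=
  if p.2 == 0 then row3 0 0 (-1) else row3 0 0 1.

(* the field (u1(t,z), u2(t,x,z), 0) *)
Definition plane_parallel (u1 : R -> R -> R) (u2 : R -> R -> R -> R)
    (t : R) (p : pt R) : 'rV[R]_3 :=
  row3 (u1 t p.2) (u2 t p.1.1 p.2) 0.

Definition periodic2 (L : R) (f : pt R -> R) :=
  forall x y z : R, f (x + L, y, z) = f (x, y, z) /\
                    f (x, y + L, z) = f (x, y, z).

End Geometry.

Section Derivatives.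
Context {R : realType}.

Definition dir3 (i : 'I_3) : pt R := ((i == 0)%:R, (i == 1)%:R, (i == 2)%:R).

(* [None] is the time direction *)
Definition dir4 (i : option 'I_3) : st R :=
  if i is Some j then (0, dir3 j) else (1, 0).

Definition iterD (V : normedModType R) (I : Type) (e : I -> V) (s : seq I)
    (F : V -> R) : V -> R :=
  foldr (fun i G p => 'D_(e i) G p) F s.

(* F is continuous on K, and the iterated partial derivatives of F along the
   words s with W s exist on U and extend continuously to K.  Here U is open, K
   is its closure, and W is closed under taking suffixes of words. *)
Definition cont_derivs (V : normedModType R) (I : Type) (e : I -> V)
    (W : pred (seq I)) (U K : set V) (F : V -> R) : Prop :=
  {within K, continuous F} /\
  forall s, W s ->
    (forall i s', s = i :: s' ->
       forall p, U p -> derivable (iterD e s' F) p (e i)) /\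
    exists2 G : V -> R, {within K, continuous G} &
      forall p, U p -> G p = iterD e s F p.

(* a time derivative counts twice: C^{1,2} is par_order s <= 2 *)
Definition par_order (s : seq (option 'I_3)) : nat :=
  \sum_(i <- s) (if i is None then 2 else 1)%N.

Definition smooth_cyl (T : R) (F : st R -> R) :=
  cont_derivs dir4 predT (cyl T) (cyl_bar T) F.

Definition C12_cyl (T : R) (F : st R -> R) :=
  cont_derivs dir4 [pred s | (par_order s <= 2)%N] (cyl T) (cyl_bar T) F.

Definition C1_cyl (T : R) (F : st R -> R) :=
  cont_derivs dir4 [pred s | (size s <= 1)%N] (cyl T) (cyl_bar T) F.

Definition curl (u : pt R -> 'rV[R]_3) (p : pt R) : 'rV[R]_3 :=
  let d i j := 'D_(dir3 i) (fun q => u q 0 j) p in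
  row3 (d 1 2 - d 2 1) (d 2 0 - d 0 2) (d 0 1 - d 1 0).

End Derivatives.

Section Sobolev.
Context {R : realType}.

Definition leb3 : {measure set (mpt R) -> \bar R} :=
  ((@lebesgue_measure R \x @lebesgue_measure R) \x @lebesgue_measure R)%E.

(* smooth, periodic in x and y, supported away from the walls *)
Definition test_fun (L : R) (psi : pt R -> R) : Prop :=
  [/\ cont_derivs dir3 predT setT setT psi, periodic2 L psi &
      exists2 d : R, 0 < d &
        forall p, ~ (d <= p.2 <= 1 - d) -> psi p = 0].

(* g is L-periodic in x and y, and its weak derivatives up to order m on the
   periodic channel are in L^2; G s is the weak derivative along the word s. *)
Definition Hm (L : R) (m : nat) (g : pt R -> R) : Prop :=
  periodic2 L g /\
  exists2 G : seq 'I_3 -> pt R -> R, G [::] = g &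
    forall s, (size s <= m)%N ->
      [/\ measurable_fun (cell L) (G s),
          (\int[leb3]_(p in cell L) ((G s p) ^+ 2)%:E < +oo)%E &
          forall psi, test_fun L psi ->
            \int[leb3]_(p in cell L) (g p * iterD dir3 s psi p) =
            (-1) ^+ size s * \int[leb3]_(p in cell L) (G s p * psi p)].

End Sobolev.

Section Equations.
Context {R : realType}.

(* i = false, true stands for the wall z = 0, 1 *)
Definition wall_pt (i : bool) : R := i%:R.

(* limit of g at the wall, taken from inside the channel *)
Definition wall_trace (g : R -> R) (i : bool) : R :=
  if i then lim (g z @[z --> 1^'-]) else lim (g z @[z --> 0^'+]).

Definition lift1 (u1 : R -> R -> R) (q : st R) : R := u1 q.1 q.2.2.
Definition lift2 (u2 : R -> R -> R -> R) (q : st R) : R := u2 q.1 q.2.1.1 q.2.2.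

Definition Dt (F : st R -> R) : st R -> R := fun q => 'D_(dir4 None) F q.
Definition Dx (F : st R -> R) : st R -> R := fun q => 'D_(dir4 (Some 0)) F q.
Definition Dz (F : st R -> R) : st R -> R := fun q => 'D_(dir4 (Some 2)) F q.

Record viscous_solution (T L : R) (a : R -> R) (b : R -> R -> R)
    (f1 : R -> R -> R) (f2 : R -> R -> R -> R) (nu1 nu3 : R)
    (u1 : R -> R -> R) (u2 : R -> R -> R -> R) : Prop := ViscousSolution {
  visc_periodic : forall t x z, u2 t (x + L) z = u2 t x z ;
  visc_reg1 : C12_cyl T (lift1 u1) ;
  visc_reg2 : C12_cyl T (lift2 u2) ;
  visc_eq1 : forall q, cyl T q ->
    Dt (lift1 u1) q - nu3 * Dz (Dz (lift1 u1)) q = lift1 f1 q ;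
  visc_eq2 : forall q, cyl T q ->
    Dt (lift2 u2) q + lift1 u1 q * Dx (lift2 u2) q
      - nu1 * Dx (Dx (lift2 u2)) q - nu3 * Dz (Dz (lift2 u2)) q = lift2 f2 q ;
  visc_bc : forall t x (i : bool), 0 <= t <= T ->
    u1 t (wall_pt i) = 0 /\ u2 t x (wall_pt i) = 0 ;
  visc_ic : forall x z, 0 <= z <= 1 -> u1 0 z = a z /\ u2 0 x z = b x z }.

Record euler_solution (T L : R) (a : R -> R) (b : R -> R -> R)
    (f1 : R -> R -> R) (f2 : R -> R -> R -> R)
    (u1 : R -> R -> R) (u2 : R -> R -> R -> R) : Prop := EulerSolution {
  euler_periodic : forall t x z, u2 t (x + L) z = u2 t x z ;
  euler_reg1 : C1_cyl T (lift1 u1) ;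
  euler_reg2 : C1_cyl T (lift2 u2) ;
  euler_eq1 : forall q, cyl T q -> Dt (lift1 u1) q = lift1 f1 q ;
  euler_eq2 : forall q, cyl T q ->
    Dt (lift2 u2) q + lift1 u1 q * Dx (lift2 u2) q = lift2 f2 q ;
  euler_ic : forall x z, 0 <= z <= 1 -> u1 0 z = a z /\ u2 0 x z = b x z }.

Definition compatible (a : R -> R) (b : R -> R -> R)
    (f1 : R -> R -> R) (f2 : R -> R -> R -> R) (nu1 nu3 : R) : Prop :=
  forall (i : bool) (x : R), let zi := wall_pt i in
  [/\ a zi = 0, b x zi = 0,
      nu3 * wall_trace (derive1n 2 a) i + f1 0 zi = 0 &
      a zi * derive1 (fun x' => b x' zi) x =
        nu1 * derive1n 2 (fun x' => b x' zi) x
        + nu3 * wall_trace (derive1n 2 (b x)) i + f2 0 x zi].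

End Equations.

(* On the compact set cell_bar L every finite (signed) Borel measure is Radon,
   so M(cell_bar L) consists of the charges carried by cell_bar L. *)
Section RadonMeasures.
Context {R : realType}.

Definition vcharge := 'I_3 -> {charge set (mpt R) -> \bar R}.

(* surface measure of the planes z = 0 and z = 1 *)
Definition surface_measure : {measure set (mpt R) -> \bar R} :=
  measure_add
    ((@lebesgue_measure R \x @lebesgue_measure R) \x @dirac _ (measurableTypeR R) (0%R : R) R)%E
    ((@lebesgue_measure R \x @lebesgue_measure R) \x @dirac _ (measurableTypeR R) (1%R : R) R)%E.

(* the charge 1_D f mu, where f 1_D must be mu-integrable (0 otherwise) *)
Definition density_charge (mu : {measure set (mpt R) -> \bar R})
    (D : set (pt R)) (f : pt R -> R) : {charge set (mpt R) -> \bar R} :=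
  match pselect (mu.-integrable setT (fun p => ((f \_ D) p)%:E)) with
  | left intf => induced_charge intf
  | right _ => czero
  end.

Definition density_vcharge (mu : {measure set (mpt R) -> \bar R})
    (D : set (pt R)) (f : pt R -> 'rV[R]_3) : vcharge :=
  fun i => density_charge mu D (fun p => f p 0 i).

Definition add_vcharge (l1 l2 : vcharge) : vcharge := fun i => cadd (l1 i) (l2 i).

Definition hahn_pos (nu : {charge set (mpt R) -> \bar R}) : set (pt R) :=
  projT1 (cid (Hahn_decomposition nu)).

Definition hahn_neg (nu : {charge set (mpt R) -> \bar R}) : set (pt R) :=
  projT1 (cid (projT2 (cid (Hahn_decomposition nu)))).

Definition hahnP (nu : {charge set (mpt R) -> \bar R}) :
    hahn_decomposition nu (hahn_pos nu) (hahn_neg nu) :=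
  projT2 (cid (projT2 (cid (Hahn_decomposition nu)))).

Definition charge_int (D : set (pt R)) (nu : {charge set (mpt R) -> \bar R})
    (phi : pt R -> R) : R :=
  \int[jordan_pos (hahnP nu)]_(p in D) phi p
  - \int[jordan_neg (hahnP nu)]_(p in D) phi p.

Definition Linf_M (T L : R) (lam : R -> vcharge) : Prop :=
  forall i : 'I_3,
  [/\ forall t A, 0 < t < T -> measurable A -> A `&` cell_bar L = set0 ->
        lam t i A = 0%E,
      forall g : pt R -> R, {within cell_bar L, continuous g} ->
        measurable_fun `]0, T[ (fun t => charge_int (cell_bar L) (lam t i) g) &
      exists M : R, {ae @lebesgue_measure R, forall t, 0 < t < T ->
        (charge_variation (hahnP (lam t i)) setT <= M%:E)%E}].

Definition supnorm (D : set (pt R)) (g : pt R -> R) : \bar R :=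
  ereal_sup [set `|g p|%:E | p in D].

(* simple functions from (0,T) to C(cell_bar L) *)
Definition simple_C (L : R) (s : R -> pt R -> R) : Prop :=
  exists (n : nat) (E : 'I_n -> set R) (g : 'I_n -> pt R -> R),
    [/\ forall k, measurable (E k),
        forall k, {within cell_bar L, continuous (g k)} &
        s = fun t p => \sum_(k < n) \1_(E k) t * g k p].

(* the Bochner space L^1(0,T;C(cell_bar L)) *)
Definition L1_C (T L : R) (phi : R -> pt R -> R) : Prop :=
  [/\ forall t, 0 < t < T -> {within cell_bar L, continuous (phi t)},
      exists2 s : nat -> R -> pt R -> R, (forall n, simple_C L (s n)) &
        {ae @lebesgue_measure R, forall t, 0 < t < T ->
          supnorm (cell_bar L) (s n t \- phi t) @[n --> \oo] --> 0%E} &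
      (\int[@lebesgue_measure R]_(t in `]0%R, T[) supnorm (cell_bar L) (phi t)
        < +oo)%E].

Definition pairing (T L : R) (lam : R -> vcharge)
    (phi : 'I_3 -> R -> pt R -> R) : R :=
  \int[@lebesgue_measure R]_(t in `]0, T[)
    \sum_(i < 3) charge_int (cell_bar L) (lam t i) (phi i t).

(* weak-* convergence in L^oo(0,T;M(cell_bar L)) along the filter F *)
Definition weak_star_cvg (T L : R) (I : Type) (F : set_system I)
    (lamF : I -> R -> vcharge) (lam : R -> vcharge) : Prop :=
  [/\ \forall j \near F, Linf_M T L (lamF j),
      Linf_M T L lam &
      forall phi : 'I_3 -> R -> pt R -> R, (forall i, L1_C T L (phi i)) ->
        pairing T L (lamF j) phi @[j --> F] --> pairing T L lam phi].

(* the curl of u, as the measure with this density on the channel *)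
Definition vorticity (L : R) (u : R -> pt R -> 'rV[R]_3) (t : R) : vcharge :=
  density_vcharge leb3 (cell L) (curl (u t)).

(* (u x n) mu *)
Definition vortex_sheet (L : R) (u : R -> pt R -> 'rV[R]_3) (t : R) : vcharge :=
  density_vcharge surface_measure (walls L)
    (fun p => crossv (u t p) (outer_normal p)).

End RadonMeasures.

(* Main.v *)
(* The bounds uniform in the viscosities all come from the maximum principle. With
   s = sqrt nu3, comparison with 1 - exp(- z / s) shows that u^nu = O(z / s) at the walls;
   the difference quotients of u^nu in z are then dominated by
   1 + (exp(- z / s) + exp((z - 1) / s)) / s, which has bounded integral, so that d_z u^nu is
   bounded in L^1. Those in x satisfy an equation of the same kind and are bounded. A
   quadratic barrier centred on a characteristic of the Euler flow gives u^nu -> u^0, and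
   d_x u^nu -> d_x u^0, pointwise inside the channel.
   Since u^nu vanishes at the walls, integrating phi d_z u^nu by parts in z leaves
   - d_z phi u^nu, which tends to - d_z phi u^0; undoing the integration by parts produces
   phi d_z u^0 and the wall terms of the vortex sheet. The pairing with a test function in
   L^1(0,T;C) then converges by dominated convergence in time. *)
Require Import Defs.
From HB Require Import structures.
From mathcomp Require Import all_boot all_order all_algebra.
From mathcomp Require Import all_classical all_reals all_analysis.
From mathcomp Require Import measurable_realfun ring lra.

Set Implicit Arguments.
Unset Strict Implicit.
Unset Printing Implicit Defensive.

Import Order.TTheory GRing.Theory Num.Theory.
Import numFieldNormedType.Exports.

Local Open Scope classical_set_scope.
Local Open Scope ring_scope.

(** * The maximum principle *)

Section Calculus.
Context {R : realType}.
Implicit Types (f h : R -> R) (x d : R).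

(** The flow is triangular: [u1] solves a heat equation, and [u2] a linear equation whose drift [u1]
    does not depend on [x]. Differences of a solution therefore solve scalar equations of the same
    kind, and barriers suffice. Finite differences replace derivatives because a C^{1,2} solution is
    not smooth enough for its equation to be differentiated. The obstacle is the difference in [z]
    of the drift: it creates the source [(u1(z + h) - u1(z)) d_x u2], which can be as large as the
    layer itself, of order [h / s] at the walls. It can be absorbed because [s^2 d_zz], with
    [s^2 = nu3], fixes [exp(- z / s)] and [exp(z / s)]: multiplied by [exp(2 t)] they are
    supersolutions whose right-hand side is as large as themselves, so that the profile controls
    sources of its own shape. Hence the estimates in [z] come for [u1] before [u2]. These
    exponential barriers do not depend on [x], so that neither the drift nor [nu1] acts on them, and
    all constants depend only on the force, the Euler flow and the common initial data. *)

Lemma is_derive_cvg h x d : is_derive x 1 h d ->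
  (e^-1 * (h (x + e) - h x)) @[e --> 0^'] --> d.
Proof.
move=> [dh <-]; rewrite /derive.
have := dh; rewrite /derivable => /cvg_ex[l hl].
have -> : lim (e^-1 *: (h (e *: 1 + x) - h x) @[e --> 0^']) = l by exact: cvg_lim hl.
by apply: cvg_trans hl; apply: near_eq_cvg; near=> e; rewrite /= [e%:A]mulr1 (addrC e).
Unshelve. all: by end_near. Qed.

Lemma derive_pos_left h x d : is_derive x 1 h d -> 0 < d ->
  \forall e \near 0^'-, h (x + e) < h x.
Proof.
move=> /is_derive_cvg hd d0.
have : \forall e \near 0^', 0 < e^-1 * (h (x + e) - h x) by exact: (cvgr_gt d).
move=> /nbhs_ballP[r r0 hr]; apply/nbhs_ballP; exists r => // e re e0.
have := hr e re (ltr0_neq0 e0).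
by rewrite nmulr_rgt0 ?invr_lt0// subr_lt0.
Qed.

Lemma derive_neg_right h x d : is_derive x 1 h d -> d < 0 ->
  \forall e \near 0^'+, h (x + e) < h x.
Proof.
move=> /is_derive_cvg hd d0.
have : \forall e \near 0^', e^-1 * (h (x + e) - h x) < 0 by exact: (cvgr_lt d).
move=> /nbhs_ballP[r r0 hr]; apply/nbhs_ballP; exists r => // e re e0.
have := hr e re (lt0r_neq0 e0).
by rewrite pmulr_rlt0 ?invr_gt0// subr_lt0.
Qed.

(** The first derivative is asked for near [x] and not only at [x], so that the mean value theorem
    can be used in [deriv2_min]. *)
Definition deriv2 h x d1 d2 := exists2 h' : R -> R,
  (\forall y \near x, is_derive y (1 : R) h (h' y)) & h' x = d1 /\ is_derive x (1 : R) h' d2.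

Lemma deriv2_is_derive h x d1 d2 : deriv2 h x d1 d2 -> is_derive x (1:R) h d1.
Proof. by move=> [h' /nbhs_singleton hh' [<- _]]. Qed.

(** Were [d2] negative, [h'] would be negative just to the right of [x], and the mean value theorem
    would produce a smaller value of [h] there. *)
Lemma deriv2_min h x d1 d2 : (\forall y \near x, h x <= h y) ->
  deriv2 h x d1 d2 -> d1 = 0 /\ 0 <= d2.
Proof.
move=> hmin [h' hh' [h'x d2h]].
have dx := nbhs_singleton hh'.
have d10 : h' x = 0.
  apply/eqP; rewrite eq_le; apply/andP; split; rewrite leNgt; apply/negP => H.
    have := derive_pos_left dx H.
    move/nbhs_ballP: hmin => [r /= r0 hr] /nbhs_ballP[s /= s0 hs].
    pose e := - (Num.min r s / 2).
    have m0 : 0 < Num.min r s by rewrite lt_min r0.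
    have mr : Num.min r s <= r by rewrite ge_min lexx.
    have ms : Num.min r s <= s by rewrite ge_min lexx orbT.
    have e0 : `|e| = Num.min r s / 2 by rewrite normrN gtr0_norm//; lra.
    have := hs e; rewrite /ball/= sub0r normrN e0 => /(_ _ _)/wrap[]; [lra|rewrite /e; lra|].
    apply/negP; rewrite -leNgt; apply: hr.
    by rewrite /ball/= opprD addNKr normrN e0; lra.
  have := derive_neg_right dx H.
  move/nbhs_ballP: hmin => [r /= r0 hr] /nbhs_ballP[s /= s0 hs].
  pose e := (Num.min r s / 2).
  have m0 : 0 < Num.min r s by rewrite lt_min r0.
  have mr : Num.min r s <= r by rewrite ge_min lexx.
  have ms : Num.min r s <= s by rewrite ge_min lexx orbT.
  have e0 : `|e| = Num.min r s / 2 by rewrite gtr0_norm//; rewrite /e; lra.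
  have := hs e; rewrite /ball/= sub0r normrN e0 => /(_ _ _)/wrap[]; [lra|rewrite /e; lra|].
  apply/negP; rewrite -leNgt; apply: hr.
  by rewrite /ball/= opprD addNKr normrN e0; lra.
split; first by rewrite -h'x.
rewrite leNgt; apply/negP => d20.
have := derive_neg_right d2h d20; rewrite d10 => /nbhs_ballP[r /= r0 hr].
move/nbhs_ballP: hh' => [s /= s0 hs].
move/nbhs_ballP: hmin => [u /= u0 hu].
pose m := Num.min r (Num.min s u) / 2.
have m0 : 0 < Num.min r (Num.min s u) by rewrite !lt_min r0 s0.
have mr : Num.min r (Num.min s u) <= r by rewrite ge_min lexx.
have ms : Num.min r (Num.min s u) <= s by rewrite !ge_min lexx orbT.
have mu : Num.min r (Num.min s u) <= u by rewrite !ge_min lexx !orbT.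
have [mp mlr mls mlu] : [/\ 0 < m, m < r, m < s & m < u] by rewrite /m; split; lra.
move: m mp mlr mls mlu {m0 mr ms mu} => m mp mlr mls mlu.
have dh y : x - s < y < x + s -> is_derive y (1:R) h (h' y).
  by move=> /andP[H1 H2]; apply: hs; rewrite /ball/= distrC ltr_norml; apply/andP; split; lra.
have [|y|c|] := @MVT R h h' x (x + m).
- lra.
- by rewrite in_itv/= => /andP[? ?]; apply: dh; apply/andP; split; lra.
- apply: derivable_within_continuous => y; rewrite in_itv/= => /andP[? ?].
  by have [] : is_derive y (1:R) h (h' y) by apply: dh; apply/andP; split; lra.
- move=> c; rewrite in_itv/= => /andP[xc cm] E.
  have /hr : ball 0 r (c - x).
    by rewrite /ball/= sub0r normrN gtr0_norm ?subr_gt0//; lra.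
  move=> /(_ _)/wrap[]; first by rewrite /= subr_gt0.
  rewrite addrC subrK => h'c.
  have /hu : ball x u (x + m).
    by rewrite /ball/= opprD addNKr normrN gtr0_norm//; lra.
  rewrite -subr_ge0 E leNgt => /negP; apply.
  by rewrite (addrC x) addrK pmulr_llt0.
Qed.

End Calculus.

(** * Derivation rules and the parabolic operator *)

Section Derivation.
Context {R : realType}.
Implicit Types (f g h : R -> R) (x a d e t : R).

Lemma isd_cst x a : is_derive x (1:R) (fun _ : R => a) 0.
Proof. exact: is_derive_cst. Qed.

Lemma isd_id x : is_derive x (1:R) (fun y : R => y) 1.
Proof. exact: is_derive_id. Qed.

Lemma isd_eq f x d e : is_derive x (1:R) f d -> d = e -> is_derive x (1:R) f e.
Proof. by move=> ? <-. Qed.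

Lemma isdD f g x d e : is_derive x (1:R) f d -> is_derive x (1:R) g e ->
  is_derive x (1:R) (fun y => f y + g y) (d + e).
Proof. by move=> hf hg; exact: is_deriveD. Qed.

Lemma isdN f x d : is_derive x (1:R) f d -> is_derive x (1:R) (fun y => - f y) (- d).
Proof. by move=> hf; exact: is_deriveN. Qed.

Lemma isdM f g x d e : is_derive x (1:R) f d -> is_derive x (1:R) g e ->
  is_derive x (1:R) (fun y => f y * g y) (d * g x + f x * e).
Proof.
move=> hf hg; have H := is_deriveM hf hg; apply: (isd_eq H).
by rewrite /GRing.scale/= addrC (mulrC d).
Qed.

Lemma isdZ a f x d : is_derive x (1:R) f d -> is_derive x (1:R) (fun y => a * f y) (a * d).
Proof. by move=> hf; exact: is_deriveZ. Qed.

Lemma isd_comp f g x d e : is_derive x (1:R) g d -> is_derive (g x) (1:R) f e ->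
  is_derive x (1:R) (fun y => f (g y)) (d * e).
Proof. by move=> hg hf; rewrite mulrC; exact: (is_derive1_comp hf hg). Qed.

Lemma isd_shift f a x d : is_derive (x + a) (1:R) f d ->
  is_derive x (1:R) (fun y => f (y + a)) d.
Proof.
move=> hf.
have H := @isd_comp f (fun y => y + a) x _ _ (isdD (isd_id x) (isd_cst x a)) hf.
by apply: (isd_eq H); rewrite addr0 mul1r.
Qed.

Lemma isd_exp f x d : is_derive x (1:R) f d ->
  is_derive x (1:R) (fun y => expR (f y)) (d * expR (f x)).
Proof. by move=> hf; apply: (@isd_comp expR f). Qed.

Lemma deriv2_lin a b h1 h2 x p1 q1 p2 q2 : deriv2 h1 x p1 q1 -> deriv2 h2 x p2 q2 ->
  deriv2 (fun y => a * h1 y + b * h2 y) x (a * p1 + b * p2) (a * q1 + b * q2).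
Proof.
move=> [h1' d1 [<- e1]] [h2' d2 [<- e2]].
exists (fun y => a * h1' y + b * h2' y).
  by near=> y; apply: isdD; apply: isdZ; near: y.
by split => //; apply: isdD; exact: isdZ.
Unshelve. all: by end_near. Qed.

Lemma deriv2_shift h a x p q : deriv2 h (x + a) p q ->
  deriv2 (fun y => h (y + a)) x p q.
Proof.
move=> [h' /nbhs_ballP[r /= r0 hr] [<- e]]; exists (fun y => h' (y + a)).
  apply/nbhs_ballP; exists r => // y; rewrite /ball/= => xy.
  by apply: isd_shift; apply: hr; rewrite /ball/= opprD addrACA subrr addr0.
by split => //; exact: isd_shift.
Qed.

Lemma deriv2_glob h h' x p q : (forall y, is_derive y (1:R) h (h' y)) -> h' x = p ->
  is_derive x (1:R) h' q -> deriv2 h x p q.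
Proof. by move=> dh <- dh'; exists h'; [exact: filterE|]. Qed.

Lemma deriv2_cst a x : deriv2 (fun _ => a) x 0 0.
Proof.
exact: (@deriv2_glob _ (fun _ => 0) x 0 0 (fun y => isd_cst y a) erefl (isd_cst x 0)).
Qed.

(* A relation, so that it also asserts that the derivatives exist. *)
Definition parop (n1 n3 c : R) (g : R -> R -> R -> R) (t x z r : R) :=
  exists gt gx gxx gz gzz,
  [/\ is_derive t (1:R) (fun s => g s x z) gt,
      deriv2 (fun y => g t y z) x gx gxx,
      deriv2 (fun y => g t x y) z gz gzz &
      r = gt + c * gx - n1 * gxx - n3 * gzz].

Lemma parop_lin n1 n3 c a b (g1 g2 : R -> R -> R -> R) t x z r1 r2 :
  parop n1 n3 c g1 t x z r1 -> parop n1 n3 c g2 t x z r2 ->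
  parop n1 n3 c (fun t x z => a * g1 t x z + b * g2 t x z) t x z (a * r1 + b * r2).
Proof.
move=> [t1 [x1 [xx1 [z1 [zz1 [? ? ? ->]]]]]] [t2 [x2 [xx2 [z2 [zz2 [? ? ? ->]]]]]].
exists (a * t1 + b * t2), (a * x1 + b * x2), (a * xx1 + b * xx2),
  (a * z1 + b * z2), (a * zz1 + b * zz2); split; last ring.
- by apply: isdD; exact: isdZ.
- exact: (@deriv2_lin _ _ (fun y => g1 t y z) (fun y => g2 t y z)).
- exact: (@deriv2_lin _ _ (fun y => g1 t x y) (fun y => g2 t x y)).
Qed.

Lemma parop_shift n1 n3 c a b (g : R -> R -> R -> R) t x z r :
  parop n1 n3 c g t (x + a) (z + b) r ->
  parop n1 n3 c (fun t x z => g t (x + a) (z + b)) t x z r.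
Proof.
move=> [gt [gx [gxx [gz [gzz [? ? ? ->]]]]]].
exists gt, gx, gxx, gz, gzz; split => //.
- exact: (@deriv2_shift (fun y => g t y (z + b))).
- exact: (@deriv2_shift (fun y => g t (x + a) y)).
Qed.

(** The minimum in time may be attained at the last instant of the interval, where only the sign of
    the derivative is available. *)
Lemma is_derive_min_le0 h t d : 0 < t -> is_derive t (1:R) h d ->
  (forall s, 0 <= s <= t -> h t <= h s) -> d <= 0.
Proof.
move=> t0 dh hmin; rewrite leNgt; apply/negP => d0.
have /nbhs_ballP[r /= r0 hr] := derive_pos_left dh d0.
pose m := Num.min r t / 2.
have [m0 mr mt] : [/\ 0 < m, m < r & m < t].
  have m0 : 0 < Num.min r t by rewrite lt_min r0.
  have mr : Num.min r t <= r by rewrite ge_min lexx.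
  have ms : Num.min r t <= t by rewrite ge_min lexx orbT.
  by rewrite /m; split; lra.
move: m m0 mr mt => m m0 mr mt.
have := hr (- m); rewrite /ball/= opprK add0r gtr0_norm// => /(_ mr)/(_ _)/wrap[].
  by rewrite oppr_lt0.
by apply/negP; rewrite -leNgt; apply: hmin; apply/andP; split; lra.
Qed.

End Derivation.

Section MaximumPrinciple.
Context {R : realType}.

Lemma near_itv (P : R -> Prop) (a b x : R) : a < x < b ->
  (forall y, a < y < b -> P y) -> \forall y \near x, P y.
Proof.
move=> /andP[ax xb] H.
have : \forall y \near x, y \in `]a, b[%R by apply: near_in_itvoo; rewrite in_itv/= ax.
by apply: filterS => y; rewrite in_itv/= => /H.
Qed.

Lemma penalty_parop (n1 n3 c K t x z : R) :
  parop n1 n3 c (fun t x _ => expR (K * t) * (1 + x * x)) t x z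
    (expR (K * t) * (K * (1 + x * x) + 2 * c * x - 2 * n1)).
Proof.
exists (K * expR (K * t) * (1 + x * x)), (expR (K * t) * (2 * x)),
  (expR (K * t) * 2), 0, 0.
split; last ring.
- by apply: (isd_eq (isdM (isd_exp (isdZ K (isd_id t))) (isd_cst t (1 + x * x)))); ring.
- apply: (@deriv2_glob _ _ (fun y => expR (K * t) * (2 * y))) => //.
    move=> y; apply: isdZ.
    by apply: (isd_eq (isdD (isd_cst y 1) (isdM (isd_id y) (isd_id y)))); ring.
  by apply: (isd_eq (isdZ _ (isdZ 2 (isd_id x)))); ring.
- exact: deriv2_cst.
Qed.

(* The domain is unbounded in x: a negative value of g would persist after adding the
   strict supersolution e exp(K' t) (1 + x^2), which moves the minimum to a bounded x. *)
Lemma max_principle (T l n1 n3 K B : R) (c g : R -> R -> R -> R) :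
  0 < l -> 0 <= n1 -> 0 <= n3 -> 0 <= K ->
  (forall t x z, 0 < t < T -> 0 < z < l -> `|c t x z| <= K) ->
  {within [set q : R * R * R | 0 <= q.1.1 < T /\ 0 <= q.2 <= l],
    continuous (fun q => g q.1.1 q.1.2 q.2)} ->
  (forall t x z, 0 <= t < T -> 0 <= z <= l -> - B <= g t x z) ->
  (forall x z, 0 <= z <= l -> 0 <= g 0 x z) ->
  (forall t x, 0 <= t < T -> 0 <= g t x 0 /\ 0 <= g t x l) ->
  (forall t x z, 0 < t < T -> 0 < z < l ->
     exists2 r, 0 <= r & parop n1 n3 (c t x z) g t x z r) ->
  forall t x z, 0 <= t < T -> 0 <= z <= l -> 0 <= g t x z.
Proof.
move=> l0 n10 n30 K0 hc cg hB h0 hw hop t0 x0 z0 /andP[t00 t0T] z01.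
rewrite leNgt; apply/negP => g0.
have T0 : 0 < T by exact: le_lt_trans t00 t0T.
(* Up to a positive factor the penalty contributes [K' (1 + x^2) + 2 c x - 2 n1]. Here [K] absorbs
   the drift through [2 |x| <= 1 + x^2], [2 n1] absorbs the diffusion, and [1] makes the inequality
   strict. *)
pose K' := K + 2 * n1 + 1.
pose P t x := expR (K' * t) * (1 + x * x).
have P1 t x : 0 <= t -> 1 + x * x <= P t x.
  move=> tt; rewrite /P ler_peMl ?addr_ge0// -?expr2 ?sqr_ge0//.
  by rewrite -expR0 ler_expR mulr_ge0// /K'; lra.
(* With this [e] the penalised value at the given point is half of the original one, hence still
   negative. *)
pose e := - g t0 x0 z0 / (2 * P t0 x0).
have Pp0 : 1 <= P t0 x0 by apply: le_trans (P1 _ _ t00); rewrite lerDl -expr2 sqr_ge0.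
have e0 : 0 < e by rewrite /e divr_gt0 ?oppr_gt0//; lra.
have ePp0 : e * P t0 x0 = - g t0 x0 z0 / 2.
  by rewrite /e; field; rewrite gt_eqF//; lra.
pose G t x z := 1 * g t x z + e * P t x.
have Gp0 : G t0 x0 z0 < 0 by rewrite /G ePp0 mul1r; lra.
(* Beyond [|x| = X] the penalty exceeds [B], because [X^2 >= X >= |B| / e], and a negative minimum
   is confined to [|x| < X]. *)
pose X := 1 + `|x0| + `|B| / e.
have Be : 0 <= `|B| / e by rewrite divr_ge0// ltW.
have Xx0 : `|x0| < X by rewrite /X; lra.
have eX : B < e * (1 + X * X).
  apply: le_lt_trans (ler_norm B) _.
  have X1 : 1 <= X by rewrite /X -addrA lerDl addr_ge0.
  have -> : `|B| = e * (`|B| / e) by rewrite mulrCA divff ?mulr1// gt_eqF.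
  rewrite ltr_pM2l//; have : `|B| / e <= X by rewrite /X lerDr.
  have : X * 1 <= X * X by apply: ler_wpM2l => //; lra.
  lra.
pose A : set (R * R * R) := (`[0, t0] `*` `[- X, X]) `*` `[0, l].
have cA : compact A by apply: compact_setX; [apply: compact_setX|]; exact: segment_compact.
have A0 : A (t0, x0, z0).
  rewrite /A/= !in_itv/= lexx t00 z01; do !split => //.
  by move: Xx0; rewrite ltr_norml => /andP[? ?]; rewrite !ltW.
have cG : {within A, continuous (fun q => G q.1.1 q.1.2 q.2)}.
  move=> q; apply: cvgD.
    apply: cvgM; first exact: cvg_cst.
    apply: (continuous_subspaceW _ cg) => -[[t x] z]/=; rewrite /A/= !in_itv/=.
    by move=> [[/andP[-> tt0] _] ->]; split => //=; apply: le_lt_trans t0T.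
  apply: (@continuous_subspaceT _ _ A (fun q : R*R*R => e * P q.1.1 q.1.2)) => {}q.
  apply: cvgM; first exact: cvg_cst.
  have c11 : {for q, continuous (fun q : R*R*R => q.1.1)}.
    by apply: (@cvg_comp _ _ _ fst fst); exact: cvg_fst.
  have c12 : {for q, continuous (fun q : R*R*R => q.1.2)}.
    by apply: (@cvg_comp _ _ _ fst snd); [exact: cvg_fst|exact: cvg_snd].
  apply: cvgM.
    apply: (@cvg_comp _ _ _ (fun q : R*R*R => K' * q.1.1) expR); last exact: continuous_expR.
    by apply: cvgM; [exact: cvg_cst|exact: c11].
  by apply: cvgD; [exact: cvg_cst|apply: cvgM; exact: c12].
have [[[t x] z] /set_mem] := compact_EVT_min (ex_intro _ _ A0) cA cG.
rewrite /A/= !in_itv/= => -[[/andP[tge0 tlet0] /andP[Xx xX]] /andP[zge0 zlel]] Gmin.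
have {Gmin}Gmin s y w : 0 <= s <= t0 -> -X <= y <= X -> 0 <= w <= l -> G t x z <= G s y w.
  by move=> ? ? ?; apply: (Gmin (s, y, w)); rewrite inE /A/= !in_itv/=.
have Gneg : G t x z < 0.
  apply: le_lt_trans Gp0; apply: Gmin => //; first by rewrite t00 lexx.
  by move: Xx0; rewrite ltr_norml => /andP[? ?]; rewrite !ltW.
have tT : t < T by exact: le_lt_trans t0T.
have P0 s y : 0 <= s -> 0 < P s y.
  by move=> s0; apply: lt_le_trans (P1 s y s0); rewrite ltr_pwDl// -expr2 sqr_ge0.
have Ggt s y w : 0 <= s -> g s y w < G s y w.
  by move=> s0; rewrite /G mul1r ltrDl mulr_gt0// P0.
have t_gt0 : 0 < t.
  rewrite lt_neqAle tge0 andbT; apply/eqP => tE; subst t.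
  by have := h0 x z; rewrite zge0 zlel => /(_ isT); have := Ggt 0 x z (lexx _); lra.
have [hw0 hwl] := hw t x (introT andP (conj tge0 tT)).
have z_gt0 : 0 < z.
  rewrite lt_neqAle zge0 andbT; apply/eqP => E; subst z.
  by have := Ggt t x 0 tge0; lra.
have z_ltl : z < l.
  rewrite lt_neqAle zlel andbT; apply/eqP => E; subst z.
  by have := Ggt t x l tge0; lra.
have xX' : `|x| < X.
  rewrite ltNge; apply/negP => XX.
  have XX2 : X * X <= x * x.
    have -> : x * x = `|x| * `|x| by rewrite -normrM ger0_norm// -expr2 sqr_ge0.
    by apply: ler_pM => //; rewrite /X; have := normr_ge0 x0; lra.
  have : e * (1 + X * X) <= e * P t x.
    by rewrite ler_pM2l//; apply: le_trans (P1 _ _ tge0); rewrite lerD2l.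
  have := hB t x z; rewrite tge0 tT zge0 zlel => /(_ isT isT).
  by move: Gneg; rewrite /G mul1r; lra.
have [r r0 pr] := hop t x z (introT andP (conj t_gt0 tT)) (introT andP (conj z_gt0 z_ltl)).
have := parop_lin 1 e pr (penalty_parop n1 n3 (c t x z) K' t x z).
move=> [gt [gx [gxx [gz [gzz [dt dx dz E]]]]]].
have gt0 : gt <= 0.
  apply: is_derive_min_le0 t_gt0 dt _ => s /andP[s0 st].
  apply: Gmin; last by rewrite zge0.
    by rewrite s0 (le_trans st).
  by rewrite Xx.
have [gx0 gxx0] : gx = 0 /\ 0 <= gxx.
  apply: deriv2_min dx.
  apply: (@near_itv _ (- X) X); first by move: xX'; rewrite ltr_norml.
  move=> y /andP[y1 y2]; apply: Gmin; rewrite ?tge0 ?zge0//.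
  by rewrite !ltW.
have [gz0 gzz0] : gz = 0 /\ 0 <= gzz.
  apply: deriv2_min dz.
  apply: (@near_itv _ 0 l); first by rewrite z_gt0.
  move=> y /andP[y1 y2]; apply: Gmin; rewrite ?tge0 ?Xx//.
  by rewrite !ltW.
have cK : `|c t x z| <= K by apply: hc; rewrite ?t_gt0 ?z_gt0.
move: E; rewrite gx0 mulr0 addr0.
have : 0 <= n1 * gxx by exact: mulr_ge0.
have : 0 <= n3 * gzz by exact: mulr_ge0.
suff : 0 < e * (expR (K' * t) * (K' * (1 + x * x) + 2 * c t x z * x - 2 * n1)) by lra.
apply: mulr_gt0 => //; apply: mulr_gt0; first exact: expR_gt0.
have : - (K * (1 + x * x)) <= 2 * c t x z * x.
  have : `|2 * c t x z * x| <= K * (1 + x * x).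
    rewrite -mulrA mulrCA normrM; apply: ler_pM => //.
    by rewrite ler_norml; have := sqr_ge0 (1 + x); have := sqr_ge0 (1 - x); rewrite !expr2 => *; apply/andP; split; nra.
  by rewrite ler_norml => /andP[].
have : 0 <= x * x by rewrite -expr2 sqr_ge0.
have : 0 <= n1 * (x * x) by rewrite mulr_ge0// -expr2 sqr_ge0.
by rewrite /K'; nra.
Qed.

End MaximumPrinciple.

(** * Functions on the channel *)

Section LineDerivatives.
Context {R : realType}.
Implicit Types (u : R -> R -> R -> R) (F G : st R -> R) (T L : R).

Definition stpt (t x z : R) : st R := (t, ((x, 0), z)).

Lemma dirtE (s t x y z : R) :
  s *: @dir4 R None + (t, ((x, y), z)) = (s + t, ((x, y), z)).
Proof.
rewrite /dir4; congr (_, _); first by rewrite /= [s *: _]mulr1.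
by congr (_, _, _); rewrite /= [_ *: _]mulr0 add0r.
Qed.

Lemma dirxE (s t x y z : R) :
  s *: dir4 (Some 0) + (t, ((x, y), z)) = (t, ((s + x, y), z)).
Proof.
rewrite /dir4 /dir3; congr (_, _); first by rewrite /= [s *: _]mulr0 add0r.
by congr (_, _, _); rewrite /= ?[_ *: _]mulr0 ?[_ *: _]mulr1 ?add0r.
Qed.

Lemma dirzE (s t x y z : R) :
  s *: dir4 (Some 2) + (t, ((x, y), z)) = (t, ((x, y), s + z)).
Proof.
rewrite /dir4 /dir3; congr (_, _); first by rewrite /= [s *: _]mulr0 add0r.
by congr (_, _, _); rewrite /= ?[_ *: _]mulr0 ?[_ *: _]mulr1 ?add0r.
Qed.

Lemma line_is_derive (V : normedModType R) (F : V -> R) (p v : V) (h : R -> R) (x : R) :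
  derivable F p v -> (forall s, h (s + x) = F (s *: v + p)) ->
  is_derive x (1 : R) h ('D_v F p).
Proof.
move=> dF hF.
have E : (fun s : R => s^-1 *: (h (s *: 1 + x) - h x)) =
         (fun s : R => s^-1 *: (F (s *: v + p) - F p)).
  apply/funext => s; rewrite -(add0r x) hF scale0r add0r add0r.
  by rewrite [s%:A]mulr1 hF.
by apply: DeriveDef; rewrite /derivable /derive E.
Qed.

(** No differentiability is assumed: both sides are the [lim] of one and the same difference
    quotient. This carries periodicity, independence of [y] and restriction to slices over to
    derivatives. *)
Lemma derive_line_eq (V V' : normedModType R) (F : V -> R) (F' : V' -> R) (p v : V) (p' v' : V') :
  (forall s : R, F (s *: v + p) = F' (s *: v' + p')) -> 'D_v F p = 'D_v' F' p'.
Proof.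
move=> H; rewrite /derive.
suff -> : (fun s : R => s^-1 *: (F (s *: v + p) - F p)) =
         (fun s : R => s^-1 *: (F' (s *: v' + p') - F' p')) by [].
apply/funext => s; rewrite H; have := H 0.
by rewrite !scale0r !add0r => ->.
Qed.

Definition indep_y F := forall t x y z, F (t, ((x, y), z)) = F (stpt t x z).
Definition periodic_x L F := forall t x y z, F (t, ((x + L, y), z)) = F (t, ((x, y), z)).

Lemma indep_y_derive F v : indep_y F -> indep_y ('D_v F).
Proof.
move=> yF t x y z; apply: derive_line_eq => s.
by case: v => [v1 [[v2 v3] v4]]; rewrite !yF; rewrite /stpt/= !yF.
Qed.

Lemma periodic_x_derive L F v : periodic_x L F -> periodic_x L ('D_v F).
Proof.
move=> LF t x y z; apply: derive_line_eq => s.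
case: v => [v1 [[v2 v3] v4]].
have -> : s *: (v1, (v2, v3, v4)) + (t, (x + L, y, z)) =
  (s *: v1 + t, ((s *: v2 + x + L, s *: v3 + y), s *: v4 + z)).
  by rewrite -addrA.
by rewrite LF.
Qed.

Lemma lift2_indep_y u : indep_y (lift2 u). Proof. by []. Qed.

Lemma lift2_periodic_x L u : (forall t x z, u t (x + L) z = u t x z) ->
  periodic_x L (lift2 u).
Proof. by move=> H t x y z; exact: H. Qed.

Lemma periodic_int L (h : R -> R) : (forall x, h (x + L) = h x) ->
  forall (k : int) x, h (x + k%:~R * L) = h x.
Proof.
move=> H.
have Hn (n : nat) x : h (x + n%:R * L) = h x.
  elim: n x => [|n IH] x; first by rewrite mul0r addr0.
  by rewrite -addn1 natrD mulrDl mul1r addrA H IH.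
case=> n x; first exact: Hn.
by rewrite NegzE mulrNz mulNr -[LHS](Hn n.+1) subrK.
Qed.

Lemma mod_period L x : 0 < L -> exists k : int, 0 <= x + k%:~R * L <= L.
Proof.
move=> L0; exists (- Num.floor (x / L)); rewrite mulrNz mulNr.
have /andP[h1 h2] := floor_itv (x / L).
rewrite -(ler_pM2r L0) divfK ?gt_eqF// in h1.
rewrite -(ltr_pM2r L0) divfK ?gt_eqF// intrD mulrDl mul1r in h2.
by apply/andP; split; lra.
Qed.

Lemma cyl_bar_bounded T L G : 0 < L -> {within cyl_bar T, continuous G} ->
  exists2 C, 0 <= C & forall t x z, 0 <= t <= T -> 0 <= x <= L -> 0 <= z <= 1 ->
    `|G (stpt t x z)| <= C.
Proof.
move=> L0 cG.
pose A : set (st R) := `[0, T] `*` ((`[0, L] `*` [set 0 : R]) `*` `[0, 1]).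
have cA : compact A.
  apply: compact_setX; first exact: segment_compact.
  apply: compact_setX; last exact: segment_compact.
  by apply: compact_setX; [exact: segment_compact|exact: compact_set1].
have cGA : {within A, continuous G}.
  apply: continuous_subspaceW cG => -[t [[x y] z]] /=.
  by rewrite /A/= !in_itv/= => -[? [_ ?]]; split.
have /compact_bounded[M [_ hM]] := continuous_compact cGA cA.
exists (Num.max 0 (M + 1)); first by rewrite le_max lexx.
move=> t x z ht hx hz; rewrite le_max; apply/orP; right.
apply: (hM (M + 1)); first by rewrite ltrDl.
by exists (stpt t x z) => //; rewrite /A/= !in_itv/=.
Qed.

(** Periodicity is known for [F] and not for its extension [G], so a point is first moved into the
    period cell with [F], and only there is [F] replaced by [G]. *)
Lemma cyl_bounded T L F G : 0 < L -> {within cyl_bar T, continuous G} ->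
  periodic_x L F -> (forall p, cyl T p -> G p = F p) ->
  exists2 C, 0 <= C & forall t x z, 0 < t < T -> 0 < z < 1 -> `|F (stpt t x z)| <= C.
Proof.
move=> L0 cG LF GF; have [C C0 hC] := cyl_bar_bounded L0 cG.
exists C => // t x z ht hz.
have [k hk] := mod_period x L0.
have -> : F (stpt t x z) = F (stpt t (x + k%:~R * L) z).
  by rewrite (@periodic_int L (fun x => F (stpt t x z)))// => y; exact: LF.
rewrite -GF; last by split.
by apply: hC => //; apply/andP; case/andP: ht; case/andP: hz => *; split; exact: ltW.
Qed.

Lemma cyl_bar_bounded_per T L F : 0 < L -> {within cyl_bar T, continuous F} ->
  periodic_x L F ->
  exists2 C, 0 <= C & forall t x z, 0 <= t <= T -> 0 <= z <= 1 -> `|F (stpt t x z)| <= C.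
Proof.
move=> L0 cG LF; have [C C0 hC] := cyl_bar_bounded L0 cG.
exists C => // t x z ht hz.
have [k hk] := mod_period x L0.
have -> : F (stpt t x z) = F (stpt t (x + k%:~R * L) z).
  by rewrite (@periodic_int L (fun x => F (stpt t x z)))// => y; exact: LF.
exact: hC.
Qed.

(** The segment towards [(T / 2, x, 1 / 2)] lies in the open cylinder for [0 < s < 1]. Inequalities
    that come from derivatives, which exist only there, are carried along it to the closed
    cylinder. *)
Lemma cvg_inner_path T F t x z : 0 < T -> {within cyl_bar T, continuous F} ->
  0 <= t <= T -> 0 <= z <= 1 ->
  F (stpt (t + s * (T / 2 - t)) x (z + s * (1 / 2 - z))) @[s --> 0^'+] --> F (stpt t x z).
Proof.
move=> T0 cF /andP[t0 tT] /andP[z0 z1].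
have cp : stpt (t + s * (T / 2 - t)) x (z + s * (1 / 2 - z)) @[s --> 0^'+] -->
    within (cyl_bar T) (nbhs (stpt t x z)).
  have c0 : stpt (t + s * (T / 2 - t)) x (z + s * (1 / 2 - z)) @[s --> 0^'+] --> stpt t x z.
    have caff (a b : R) : a + s * b @[s --> 0^'+] --> a.
      have h : a + s * b @[s --> (0 : R)] --> a + 0 * b.
        apply: cvgD; first exact: cvg_cst.
        by apply: cvgM; [exact: cvg_id|exact: cvg_cst].
      by rewrite mul0r addr0 in h; exact: cvg_at_right_filter.
    exact: (cvg_pair (caff t (T / 2 - t)) (cvg_pair (cvg_cst (x, 0 : R)) (caff z (1 / 2 - z)))).
  move=> P wP; rewrite /nbhs/=; near=> s.
  have s0 : 0 < s by [].
  have s1 : s < 1 by near: s; exact: nbhs_right_lt.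
  have : cyl_bar T (stpt (t + s * (T / 2 - t)) x (z + s * (1 / 2 - z))).
    by split => /=; apply/andP; split; nra.
  by near: s; exact: c0 wP.
have /subspace_continuousP/(_ (stpt t x z))/(_ _)/wrap[] := cF.
  by split; rewrite ?t0 ?z0.
by move=> /(cvg_comp _ _ cp).
Unshelve. all: by end_near. Qed.

End LineDerivatives.

(** * Lipschitz bounds up to the boundary of the cylinder *)

Section Regularity.
Context {R : realType}.
Implicit Types (u : R -> R -> R -> R) (F G : st R -> R) (T L : R).

Lemma lip_oo (h h' : R -> R) (a b C : R) :
  (forall y, a < y < b -> is_derive y (1:R) h (h' y)) ->
  (forall y, a < y < b -> `|h' y| <= C) ->
  forall x y, a < x < b -> a < y < b -> `|h y - h x| <= C * `|y - x|.
Proof.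
move=> dh hC.
suff H x y : a < x < b -> a < y < b -> x <= y -> `|h y - h x| <= C * `|y - x|.
  move=> x y hx hy; have [xy|/ltW yx] := leP x y; first exact: H.
  by rewrite distrC (distrC y); exact: H.
move=> /andP[ax xb] /andP[ay yb] xy.
have dh' c : c \in `[x, y] -> a < c < b.
  by rewrite in_itv/= => /andP[? ?]; apply/andP; split; [exact: lt_le_trans ax _|exact: le_lt_trans yb].
have [|c|c cxy ->] := @MVT_segment R h h' x y xy.
- by move=> c /subset_itv_oo_cc /dh'/dh.
- by apply: derivable_within_continuous => z /dh'/dh[].
- by rewrite normrM ler_wpM2r// hC// dh'.
Qed.

Lemma lip_line (h h' : R -> R) (C : R) :
  (forall y, is_derive y (1:R) h (h' y)) -> (forall y, `|h' y| <= C) ->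
  forall x y, `|h y - h x| <= C * `|y - x|.
Proof.
move=> dh hC x y.
have nx := ler_norm x; have ny := ler_norm y.
have nx' := ler_norm (- x); have ny' := ler_norm (- y).
rewrite normrN in nx'; rewrite normrN in ny'.
have nx0 := normr_ge0 x; have ny0 := normr_ge0 y.
apply: (@lip_oo h h' (- `|x| - `|y| - 1) (`|x| + `|y| + 1)) => //;
 by apply/andP; split; lra.
Qed.

Lemma cont_derivs_weaken (W W' : pred (seq (option 'I_3))) (U K : set (st R)) F :
  (forall s, W' s -> W s) -> cont_derivs dir4 W U K F -> cont_derivs dir4 W' U K F.
Proof. by move=> WW' [cF H]; split => // s /WW' /H. Qed.

Lemma C12_C1 T F : C12_cyl T F -> C1_cyl T F.
Proof.
apply: cont_derivs_weaken => -[|i [|]]//= _; rewrite /par_order ?big_nil//.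
by rewrite big_cons big_nil; case: i.
Qed.

Lemma smooth_C1 T F : smooth_cyl T F -> C1_cyl T F.
Proof. exact: cont_derivs_weaken. Qed.

Lemma C1_cont T F : C1_cyl T F -> {within cyl_bar T, continuous F}.
Proof. by case. Qed.

Lemma C1_derivable T F i p : C1_cyl T F -> cyl T p -> derivable F p (dir4 i).
Proof. by move=> [_ /(_ [:: i] isT)[/(_ i [::] erefl p) + _]] => /[apply]. Qed.

Lemma C1_ext T F i : C1_cyl T F ->
  exists2 G, {within cyl_bar T, continuous G} & forall p, cyl T p -> G p = 'D_(dir4 i) F p.
Proof. by move=> [_ /(_ [:: i] isT)[_]]. Qed.

Lemma cylP T t x z : 0 < t < T -> 0 < z < 1 -> cyl T (stpt t x z).
Proof. by split. Qed.

Lemma is_derive_dt F t x z : derivable F (stpt t x z) (dir4 None) ->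
  is_derive t (1:R) (fun s => F (stpt s x z)) (Dt F (stpt t x z)).
Proof. by move=> dF; apply: line_is_derive dF _ => s; rewrite /stpt dirtE. Qed.

Lemma is_derive_dx F t x z : derivable F (stpt t x z) (dir4 (Some 0)) ->
  is_derive x (1:R) (fun y => F (stpt t y z)) (Dx F (stpt t x z)).
Proof. by move=> dF; apply: line_is_derive dF _ => s; rewrite /stpt dirxE. Qed.

Lemma is_derive_dz F t x z : derivable F (stpt t x z) (dir4 (Some 2)) ->
  is_derive z (1:R) (fun y => F (stpt t x y)) (Dz F (stpt t x z)).
Proof. by move=> dF; apply: line_is_derive dF _ => s; rewrite /stpt dirzE. Qed.

Lemma C12_parop T u n1 n3 c t x z : C12_cyl T (lift2 u) -> 0 < t < T -> 0 < z < 1 ->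
  let q := stpt t x z in
  parop n1 n3 c u t x z (Dt (lift2 u) q + c * Dx (lift2 u) q
      - n1 * Dx (Dx (lift2 u)) q - n3 * Dz (Dz (lift2 u)) q).
Proof.
move=> Cu ht hz q; have C1u := C12_C1 Cu.
exists (Dt (lift2 u) q), (Dx (lift2 u) q), (Dx (Dx (lift2 u)) q),
  (Dz (lift2 u) q), (Dz (Dz (lift2 u)) q); split => //.
- exact: (@is_derive_dt (lift2 u) t x z (C1_derivable C1u (cylP x ht hz))).
- exists (fun y => Dx (lift2 u) (stpt t y z)).
    apply: filterE => y.
    exact: (@is_derive_dx (lift2 u) t y z (C1_derivable C1u (cylP y ht hz))).
  split; [by []|]; apply: (@is_derive_dx (Dx (lift2 u)) t x z).
  case: Cu => _ /(_ [:: Some 0; Some 0])[].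
    by rewrite /= /par_order !big_cons big_nil.
  by move=> /(_ (Some 0) [:: Some 0] erefl _ (cylP x ht hz)).
- exists (fun y => Dz (lift2 u) (stpt t x y)).
    apply: (near_itv hz) => y hy.
    exact: (@is_derive_dz (lift2 u) t x y (C1_derivable C1u (cylP x ht hy))).
  split; [by []|]; apply: (@is_derive_dz (Dz (lift2 u)) t x z).
  case: Cu => _ /(_ [:: Some 2; Some 2])[].
    by rewrite /= /par_order !big_cons big_nil.
  by move=> /(_ (Some 2) [:: Some 2] erefl _ (cylP x ht hz)).
Qed.

(** A function that is constant in [x] is insensitive to [c] and [n1], which may therefore be chosen
    freely when [u1] is treated as a solution. *)
Lemma C12_parop1 T (u : R -> R -> R) n1 n3 c t x z :
  C12_cyl T (lift1 u) -> 0 < t < T -> 0 < z < 1 ->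
  let q := stpt t x z in
  parop n1 n3 c (fun t _ z => u t z) t x z
    (Dt (lift1 u) q - n3 * Dz (Dz (lift1 u)) q).
Proof.
move=> Cu ht hz q.
have [gt [gx [gxx [gz [gzz [dt _ dz _]]]]]] :=
  @C12_parop T (fun t _ z => u t z) 0 0 0 t x z Cu ht hz.
exists (Dt (lift1 u) q), 0, 0, (Dz (lift1 u) q), (Dz (Dz (lift1 u)) q); split.
- exact: (@is_derive_dt (lift1 u) t x z (C1_derivable (C12_C1 Cu) (cylP x ht hz))).
- exact: deriv2_cst.
- exists (fun y => Dz (lift1 u) (stpt t x y)).
    apply: (near_itv hz) => y hy.
    exact: (@is_derive_dz (lift1 u) t x y (C1_derivable (C12_C1 Cu) (cylP x ht hy))).
  split; [by []|]; apply: (@is_derive_dz (Dz (lift1 u)) t x z).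
  case: Cu => _ /(_ [:: Some 2; Some 2])[].
    by rewrite /= /par_order !big_cons big_nil.
  by move=> /(_ (Some 2) [:: Some 2] erefl _ (cylP x ht hz)).
- by rewrite !mulr0 addr0 subr0.
Qed.

Lemma inner_path T t s : 0 < T -> 0 <= t <= T -> 0 < s < 1 -> 0 < t + s * (T / 2 - t) < T.
Proof. by move=> T0 /andP[t0 tT] /andP[s0 s1]; apply/andP; split; nra. Qed.

(** The derivatives are bounded inside because they extend continuously and are periodic in [x]; the
    resulting increments pass to the closed cylinder along the paths of [cvg_inner_path]. *)
Lemma C1_lip T L u : 0 < T -> 0 < L -> C1_cyl T (lift2 u) ->
  (forall t x z, u t (x + L) z = u t x z) ->
  exists2 M, 0 <= M & forall t x x' z z', 0 <= t <= T -> 0 <= z <= 1 -> 0 <= z' <= 1 ->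
    `|u t x z| <= M /\ `|u t x' z' - u t x z| <= M * (`|x' - x| + `|z' - z|).
Proof.
move=> T0 L0 Cu Lu.
have LF := lift2_periodic_x Lu.
have [M1 M10 h1] := cyl_bar_bounded_per L0 (C1_cont Cu) LF.
have [Gx cGx GxE] := C1_ext (Some 0) Cu.
have [Gz cGz GzE] := C1_ext (Some 2) Cu.
have [Mx Mx0 hx] := cyl_bounded L0 cGx (periodic_x_derive (dir4 (Some 0)) LF) GxE.
have [Mz Mz0 hz] := cyl_bounded L0 cGz (periodic_x_derive (dir4 (Some 2)) LF) GzE.
exists (M1 + Mx + Mz); first by rewrite !addr_ge0.
move=> t x x' z z' ht zz zz'; split.
  by apply: (le_trans (h1 t x z ht zz)); lra.
have lx s y y' w : 0 < s < T -> 0 < w < 1 -> `|u s y' w - u s y w| <= Mx * `|y' - y|.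
  move=> hs hw.
  apply: (@lip_line (fun y => u s y w) (fun y => Dx (lift2 u) (stpt s y w))) => {}y.
    exact: (@is_derive_dx (lift2 u) s y w (C1_derivable Cu (cylP y hs hw))).
  exact: hx.
have lz s y w w' : 0 < s < T -> 0 < w < 1 -> 0 < w' < 1 ->
    `|u s y w' - u s y w| <= Mz * `|w' - w|.
  move=> hs hw hw'.
  apply: (@lip_oo (fun w => u s y w) (fun w => Dz (lift2 u) (stpt s y w)) 0 1 Mz _ _ w w' hw hw') => {w hw w' hw'}w hw.
    exact: (@is_derive_dz (lift2 u) s y w (C1_derivable Cu (cylP y hs hw))).
  exact: hz.
pose t_ (s : R) := t + s * (T / 2 - t).
pose z_ (s : R) := z + s * (1 / 2 - z).
pose z'_ (s : R) := z' + s * (1 / 2 - z').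
have c1 : `|u (t_ s) x' (z'_ s) - u (t_ s) x (z_ s)| @[s --> 0^'+] --> `|u t x' z' - u t x z|.
  exact: (cvg_norm (cvgB (@cvg_inner_path _ T _ t x' z' T0 (C1_cont Cu) ht zz')
    (@cvg_inner_path _ T _ t x z T0 (C1_cont Cu) ht zz))).
have c2 : Mx * `|x' - x| + Mz * `|z'_ s - z_ s| @[s --> 0^'+] --> Mx * `|x' - x| + Mz * `|z' - z|.
  apply: cvgD; first exact: cvg_cst.
  apply: cvgM; first exact: cvg_cst.
  have h : z'_ s - z_ s @[s --> (0 : R)] --> z'_ 0 - z_ 0.
    by apply: cvgB; (apply: cvgD; first exact: cvg_cst); (apply: cvgM; first exact: cvg_id); exact: cvg_cst.
  rewrite /z'_ /z_ !mul0r !addr0 in h.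
  by apply: cvg_norm; exact: cvg_at_right_filter.
apply: (@le_trans _ _ (Mx * `|x' - x| + Mz * `|z' - z|)).
  apply: (ler_cvg_to c1 c2); near=> s.
  have hs : 0 < s < 1 by apply/andP; split; [|near: s; exact: nbhs_right_lt].
  have hts : 0 < t_ s < T by exact: inner_path.
  have hzs : 0 < z_ s < 1 by exact: inner_path.
  have hz's : 0 < z'_ s < 1 by exact: inner_path.
  apply: le_trans (lerD (lx (t_ s) x x' (z_ s) hts hzs) (lz (t_ s) x' (z_ s) (z'_ s) hts hzs hz's)).
  by rewrite [leRHS]addrC; apply: le_trans (ler_normD _ _); rewrite addrA subrK.
by rewrite mulrDr; apply: lerD; apply: ler_wpM2r => //; lra.
Unshelve. all: by end_near. Qed.

(** The mean value theorem is used once for each increment: [y] maps to [u(y + k) - u(y)] with slope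
    at most [M * k]. The set [W] of words is left open because the lemma serves both the smooth
    force and a C^{1,2} viscous solution. *)
Lemma lift2_second_diff T L u (W : pred (seq (option 'I_3))) : 0 < T -> 0 < L ->
  W [:: Some 0] -> W [:: Some 0; Some 0] ->
  cont_derivs dir4 W (cyl T) (cyl_bar T) (lift2 u) ->
  (forall t x z, u t (x + L) z = u t x z) ->
  exists2 M, 0 <= M & forall t x z h k, 0 <= t <= T -> 0 <= z <= 1 -> 0 <= h -> 0 <= k ->
    `|u t (x + h + k) z - u t (x + h) z - (u t (x + k) z - u t x z)| <= M * h * k.
Proof.
move=> T0 L0 W1 W2 Cu Lu.
have LF := lift2_periodic_x Lu.
case: (Cu) => cF Cd.
have [d1 _] := Cd _ W1.
have [d2 [G cG GE]] := Cd _ W2.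
have LFxx : periodic_x L (Dx (Dx (lift2 u))).
  exact: (periodic_x_derive (dir4 (Some 0)) (periodic_x_derive (dir4 (Some 0)) LF)).
have GE' p (hp : cyl T p) : G p = Dx (Dx (lift2 u)) p by rewrite (GE p hp) /iterD /= /Dx.
have [M M0 hM] := @cyl_bounded _ T L (Dx (Dx (lift2 u))) G L0 cG LFxx GE'.
exists M => // t x z h k ht hz h0 k0.
have dux s y w : 0 < s < T -> 0 < w < 1 ->
    is_derive y (1:R) (fun y => u s y w) (Dx (lift2 u) (stpt s y w)).
  move=> hs hw; apply: (@is_derive_dx (lift2 u)).
  exact: (d1 (Some 0) [::] erefl _ (cylP y hs hw)).
have lux s y y' w : 0 < s < T -> 0 < w < 1 ->
   `|Dx (lift2 u) (stpt s y' w) - Dx (lift2 u) (stpt s y w)| <= M * `|y' - y|.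
  move=> hs hw.
  apply: (@lip_line (fun y => Dx (lift2 u) (stpt s y w))
    (fun y => Dx (Dx (lift2 u)) (stpt s y w))) => {}y.
    apply: (@is_derive_dx (Dx (lift2 u))).
    exact: (d2 (Some 0) [:: Some 0] erefl _ (cylP y hs hw)).
  exact: hM.
pose t_ (s : R) := t + s * (T / 2 - t).
pose z_ (s : R) := z + s * (1 / 2 - z).
have c1 : `|u (t_ s) (x + h + k) (z_ s) - u (t_ s) (x + h) (z_ s) -
     (u (t_ s) (x + k) (z_ s) - u (t_ s) x (z_ s))| @[s --> 0^'+] -->
     `|u t (x + h + k) z - u t (x + h) z - (u t (x + k) z - u t x z)|.
  have cp y := @cvg_inner_path _ T _ t y z T0 cF ht hz.
  exact: (cvg_norm (cvgB (cvgB (cp (x + h + k)) (cp (x + h))) (cvgB (cp (x + k)) (cp x)))).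
apply: (cvgr_to_le c1); near=> s.
have hs : 0 < s < 1 by apply/andP; split; [|near: s; exact: nbhs_right_lt].
have hts : 0 < t_ s < T by exact: inner_path.
have hzs : 0 < z_ s < 1 by exact: inner_path.
pose p y := u (t_ s) (y + k) (z_ s) - u (t_ s) y (z_ s).
have -> : u (t_ s) (x + h + k) (z_ s) - u (t_ s) (x + h) (z_ s) -
     (u (t_ s) (x + k) (z_ s) - u (t_ s) x (z_ s)) = p (x + h) - p x by [].
have := @lip_line p (fun y => Dx (lift2 u) (stpt (t_ s) (y + k) (z_ s)) -
    Dx (lift2 u) (stpt (t_ s) y (z_ s))) (M * k).
move=> /(_ _ _ x (x + h))/wrap[].
- move=> y; apply: isdD; last by apply: isdN; exact: dux.
  apply: (@isd_shift _ (fun y => u (t_ s) y (z_ s))).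
  exact: dux.
- move=> y; apply: (le_trans (lux _ _ _ _ hts hzs)).
  by rewrite (addrC y) addrK ger0_norm.
- have -> : x + h - x = h by rewrite addrAC subrr add0r.
  by move=> Q; rewrite mulrAC -{2}(ger0_norm h0).
Unshelve. all: by end_near. Qed.

End Regularity.

(** * Barriers and a priori estimates *)

Section Barriers.
Context {R : realType}.
Implicit Types (w p : R -> R -> R -> R).

Definition slab (T l : R) : set (R * R * R) :=
  [set q | 0 <= q.1.1 < T /\ 0 <= q.2 <= l].

Definition slab_cont (T l : R) (w : R -> R -> R -> R) :=
  {within slab T l, continuous (fun q => w q.1.1 q.1.2 q.2)}.

Lemma slab_cont_lin T l a b w1 w2 : slab_cont T l w1 -> slab_cont T l w2 ->
  slab_cont T l (fun t x z => a * w1 t x z + b * w2 t x z).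
Proof.
move=> c1 c2 q; apply: cvgD; apply: cvgM; first exact: cvg_cst.
- exact: c1.
- exact: cvg_cst.
- exact: c2.
Qed.

(** This is the maximum principle for [p + w] and [p - w], which are bounded below by [- B] because
    [p] is nonnegative. *)
Lemma comparison (T l n1 n3 K B : R) (c w p fp : R -> R -> R -> R) :
  0 < l -> 0 <= n1 -> 0 <= n3 -> 0 <= K ->
  (forall t x z, 0 < t < T -> 0 < z < l -> `|c t x z| <= K) ->
  slab_cont T l w -> slab_cont T l p ->
  (forall t x z, 0 <= t < T -> 0 <= z <= l -> `|w t x z| <= B /\ 0 <= p t x z) ->
  (forall t x z, 0 < t < T -> 0 < z < l ->
     exists2 r, `|r| <= fp t x z & parop n1 n3 (c t x z) w t x z r) ->
  (forall t x z, 0 < t < T -> 0 < z < l ->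
     parop n1 n3 (c t x z) p t x z (fp t x z)) ->
  (forall x z, 0 <= z <= l -> `|w 0 x z| <= p 0 x z) ->
  (forall t x, 0 <= t < T -> `|w t x 0| <= p t x 0 /\ `|w t x l| <= p t x l) ->
  forall t x z, 0 <= t < T -> 0 <= z <= l -> `|w t x z| <= p t x z.
Proof.
move=> l0 n10 n30 K0 hc cw cp hB hw hp h0 hwall.
have H (e : R) : `|e| = 1 -> forall t x z, 0 <= t < T -> 0 <= z <= l ->
    0 <= 1 * p t x z + e * w t x z.
  move=> e1.
  have aux a b : `|a| <= b -> 0 <= 1 * b + e * a.
    move=> ab; have : `|e * a| <= b by rewrite normrM e1 mul1r.
    by rewrite ler_norml mul1r => /andP[? _]; lra.
  apply: (max_principle l0 n10 n30 K0 hc (B := B)).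
  - exact: slab_cont_lin.
  - move=> t x z ht hz; have [wB p0] := hB t x z ht hz.
    have := aux _ _ wB; lra.
  - by move=> x z hz; apply: aux; exact: h0.
  - by move=> t x ht; have [? ?] := hwall t x ht; split; exact: aux.
  - move=> t x z ht hz; have [r rf pr] := hw t x z ht hz.
    exists (1 * fp t x z + e * r); first exact: aux.
    by apply: parop_lin; [exact: hp|exact: pr].
move=> t x z ht hz; rewrite ler_norml; apply/andP; split.
- by have := H 1 (normr1 _) t x z ht hz; lra.
- by have := H (-1) (normrN1 _) t x z ht hz; lra.
Qed.

Lemma parop_time n1 n3 c (V : R -> R) d t x z : is_derive t (1:R) V d ->
  parop n1 n3 c (fun t _ _ => V t) t x z d.
Proof.
move=> dV; exists d, 0, 0, 0, 0; split; last ring.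
- exact: dV.
- exact: deriv2_cst.
- exact: deriv2_cst.
Qed.

(** The exponentials in [z] are eigenfunctions of [s^2 d_zz] with eigenvalue [1]. At rate [k = 1]
    they cancel from the equation; at rate [k = 2] they reappear there with coefficient [1] and can
    absorb a source of their shape. *)
Definition bexp (k s A B D t x z : R) : R :=
  expR (k * t) * (A + B * expR (- z / s) + D * expR (z / s)).

Lemma parop_bexp n1 c k s A B D t x z : s != 0 ->
  parop n1 (s * s) c (bexp k s A B D) t x z
    (expR (k * t) * (k * A + (k - 1) * (B * expR (- z / s) + D * expR (z / s)))).
Proof.
move=> s0.
have dm y : is_derive y (1:R) (fun y => expR (- y / s)) (- s^-1 * expR (- y / s)).
  apply: (isd_eq (isd_exp (isdM (isdN (isd_id y)) (isd_cst y s^-1)))).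
  by ring.
have dp y : is_derive y (1:R) (fun y => expR (y / s)) (s^-1 * expR (y / s)).
  apply: (isd_eq (isd_exp (isdM (isd_id y) (isd_cst y s^-1)))).
  by ring.
exists (k * bexp k s A B D t x z), 0, 0,
  (expR (k * t) * (- (s^-1 * B) * expR (- z / s) + s^-1 * D * expR (z / s))),
  (expR (k * t) * (s^-2 * B * expR (- z / s) + s^-2 * D * expR (z / s))); split.
- by apply: (isd_eq (isdM (isd_exp (isdZ k (isd_id t))) (isd_cst t _))); rewrite /bexp; ring.
- exact: deriv2_cst.
- apply: (@deriv2_glob _ _ (fun z => expR (k * t) * (- (s^-1 * B) * expR (- z / s) +
    s^-1 * D * expR (z / s)))).
  + move=> y; apply: isdZ.
    by apply: (isd_eq (isdD (isdD (isd_cst y A) (isdZ B (dm y))) (isdZ D (dp y)))); ring.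
  + by [].
  + apply: isdZ.
    by apply: (isd_eq (isdD (isdZ (- (s^-1 * B)) (dm z)) (isdZ (s^-1 * D) (dp z)))); field.
- by rewrite /bexp; field.
Qed.

Lemma slab_cont_bexp T l k s A B D : slab_cont T l (bexp k s A B D).
Proof.
apply: continuous_subspaceT => q.
have c11 : {for q, continuous (fun q : R*R*R => q.1.1)}.
  by apply: (@cvg_comp _ _ _ fst fst); exact: cvg_fst.
have c2 : {for q, continuous (fun q : R*R*R => q.2)} by exact: cvg_snd.
have ce (h : R * R * R -> R) : {for q, continuous h} -> {for q, continuous (fun q => expR (h q))}.
  by move=> hh; apply: (@cvg_comp _ _ _ h expR); [exact: hh|exact: continuous_expR].
apply: cvgM.
  by apply: (ce (fun q => k * q.1.1)); apply: cvgM; [exact: cvg_cst|exact: c11].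
apply: cvgD; last first.
  apply: cvgM; first exact: cvg_cst.
  by apply: (ce (fun q => q.2 / s)); apply: cvgM; [exact: c2|exact: cvg_cst].
apply: cvgD; first exact: cvg_cst.
apply: cvgM; first exact: cvg_cst.
by apply: (ce (fun q => - q.2 / s)); apply: cvgM; [apply: cvgN; exact: c2|exact: cvg_cst].
Qed.

(** By the arithmetic-geometric mean inequality, a square over [e] plus [e] dominates the distance,
    whereas its second derivative is only [2 / e]. The term [D * t] pays for the viscosity acting on
    it. *)
Definition bquad (k A D e : R) (X : R -> R) (z0 t x z : R) : R :=
  expR (k * t) * A * (((x - X t) * (x - X t) + (z - z0) * (z - z0)) / e + e) + D * t.

(** The motion of the centre contributes [- X'], so that only the deviation [c - X'] of the drift
    from the velocity of the curve is left to estimate. *)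
Lemma parop_bquad n1 n3 c k A D e X X' z0 t x z : e != 0 ->
  is_derive t (1:R) X X' ->
  parop n1 n3 c (bquad k A D e X z0) t x z
    (expR (k * t) * A * (k * (((x - X t) * (x - X t) + (z - z0) * (z - z0)) / e + e)
       + 2 * (c - X') * (x - X t) / e - 2 * (n1 + n3) / e) + D).
Proof.
move=> e0 dX.
have dsq (a b y : R) : is_derive y (1:R) (fun y => ((y - a) * (y - a) + b) / e + e)
    (2 * (y - a) / e).
  have d1 := isdD (isd_id y) (isd_cst y (- a)).
  apply: (isd_eq (isdD (isdM (isdD (isdM d1 d1) (isd_cst y b)) (isd_cst y e^-1)) (isd_cst y e))).
  by ring.
have dln (E a y : R) : is_derive y (1:R) (fun y => E * (2 * (y - a) / e)) (E * 2 / e).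
  have d1 := isdD (isd_id y) (isd_cst y (- a)).
  by apply: (isd_eq (isdZ E (isdM (isdZ 2 d1) (isd_cst y e^-1)))); ring.
exists (expR (k * t) * A * (k * (((x - X t) * (x - X t) + (z - z0) * (z - z0)) / e + e)
       - 2 * X' * (x - X t) / e) + D),
  (expR (k * t) * A * (2 * (x - X t) / e)), (expR (k * t) * A * 2 / e),
  (expR (k * t) * A * (2 * (z - z0) / e)), (expR (k * t) * A * 2 / e); split.
- have d1 := isdD (isd_cst t x) (isdN dX).
  have d2 := isdD (isdM (isdD (isdM d1 d1) (isd_cst t ((z - z0) * (z - z0)))) (isd_cst t e^-1)) (isd_cst t e).
  apply: (isd_eq (isdD (isdM (isdM (isd_exp (isdZ k (isd_id t))) (isd_cst t A)) d2)
    (isdZ D (isd_id t)))).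
  by field.
- apply: (@deriv2_glob _ _ (fun y => expR (k * t) * A * (2 * (y - X t) / e))).
  + move=> y; apply: (isd_eq (isdD (isdZ _ (dsq (X t) ((z - z0) * (z - z0)) y)) (isd_cst y (D * t)))).
    by rewrite addr0.
  + by [].
- apply: (@deriv2_glob _ _ (fun y => expR (k * t) * A * (2 * (y - z0) / e))).
  + move=> y; have := isdD (isdZ (expR (k * t) * A) (dsq z0 ((x - X t) * (x - X t)) y)) (isd_cst y (D * t)).
    rewrite addr0.
    have -> : (fun y => expR (k * t) * A * (((y - z0) * (y - z0) + (x - X t) * (x - X t)) / e + e) + D * t)
        = bquad k A D e X z0 t x.
      by apply/funext => w; rewrite /bquad (addrC ((w - z0) * _)).
    by [].
  + by [].
- by field.
Qed.

Lemma slab_cont_bquad (T l k A D e : R) (X : R -> R) (z0 : R) :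
  (forall t : R, 0 <= t < T -> {for t, continuous X}) ->
  slab_cont T l (bquad k A D e X z0).
Proof.
move=> cX; apply/subspace_continuousP => q [tT _]; apply: cvg_within_filter.
have c11 : {for q, continuous (fun q : R*R*R => q.1.1)}.
  by apply: (@cvg_comp _ _ _ fst fst); exact: cvg_fst.
have c12 : {for q, continuous (fun q : R*R*R => q.1.2)}.
  by apply: (@cvg_comp _ _ _ fst snd); [exact: cvg_fst|exact: cvg_snd].
have c2 : {for q, continuous (fun q : R*R*R => q.2)} by exact: cvg_snd.
have cXq : {for q, continuous (fun q : R*R*R => X q.1.1)}.
  by apply: (@cvg_comp _ _ _ (fun q : R*R*R => q.1.1) X); [exact: c11|exact: cX].
apply: cvgD; last by apply: cvgM; [exact: cvg_cst|exact: c11].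
apply: cvgM.
  apply: cvgM; last exact: cvg_cst.
  apply: (@cvg_comp _ _ _ (fun q : R*R*R => k * q.1.1) expR); last exact: continuous_expR.
  by apply: cvgM; [exact: cvg_cst|exact: c11].
apply: cvgD; last exact: cvg_cst.
apply: cvgM; last exact: cvg_cst.
apply: cvgD; apply: cvgM.
- by apply: cvgB; [exact: c12|exact: cXq].
- by apply: cvgB; [exact: c12|exact: cXq].
- by apply: cvgB; [exact: c2|exact: cvg_cst].
- by apply: cvgB; [exact: c2|exact: cvg_cst].
Qed.

Lemma slab_cont_shift (T l l' a b : R) w : 0 <= b -> l + b <= l' -> slab_cont T l' w ->
  slab_cont T l (fun t x z => w t (x + a) (z + b)).
Proof.
move=> b0 lb cw; apply/subspace_continuousP => q [tT /andP[q0 ql]].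
have cp : (fun q : R*R*R => (q.1.1, q.1.2 + a, q.2 + b)) q' @[q' --> within (slab T l) (nbhs q)]
   --> within (slab T l') (nbhs (q.1.1, q.1.2 + a, q.2 + b)).
  have c0 : (fun q : R*R*R => (q.1.1, q.1.2 + a, q.2 + b)) q' @[q' --> q]
   --> nbhs (q.1.1, q.1.2 + a, q.2 + b).
    have c11 : {for q, continuous (fun q : R*R*R => q.1.1)}.
      by apply: (@cvg_comp _ _ _ fst fst); exact: cvg_fst.
    have c12 : {for q, continuous (fun q : R*R*R => q.1.2 + a)}.
      apply: cvgD; last exact: cvg_cst.
      by apply: (@cvg_comp _ _ _ fst snd); [exact: cvg_fst|exact: cvg_snd].
    have c2 : {for q, continuous (fun q : R*R*R => q.2 + b)}.
      by apply: cvgD; [exact: cvg_snd|exact: cvg_cst].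
    exact: (cvg_pair (cvg_pair c11 c12) c2).
  move=> P wP; have := c0 _ wP; rewrite /nbhs/=; apply: filterS => -[[t x] z]/= H.
  move=> [/= ht /andP[hz hz']]; apply: H; split => //=.
  by apply/andP; split; lra.
have /subspace_continuousP/(_ (q.1.1, q.1.2 + a, q.2 + b))/(_ _)/wrap[] := cw.
  by split => //=; apply/andP; split; lra.
by move=> /(cvg_comp _ _ cp).
Qed.

Lemma lift2_slab_cont (T : R) w : {within cyl_bar T, continuous (lift2 w)} -> slab_cont T 1 w.
Proof.
move=> cw; apply/subspace_continuousP => q [/andP[t0 tT] hz].
have cp : (fun q : R*R*R => stpt q.1.1 q.1.2 q.2) q' @[q' --> within (slab T 1) (nbhs q)]
   --> within (cyl_bar T) (nbhs (stpt q.1.1 q.1.2 q.2)).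
  have c0 : (fun q : R*R*R => stpt q.1.1 q.1.2 q.2) q' @[q' --> q]
   --> nbhs (stpt q.1.1 q.1.2 q.2).
    have c11 : {for q, continuous (fun q : R*R*R => q.1.1)}.
      by apply: (@cvg_comp _ _ _ fst fst); exact: cvg_fst.
    have c12 : {for q, continuous (fun q : R*R*R => q.1.2)}.
      by apply: (@cvg_comp _ _ _ fst snd); [exact: cvg_fst|exact: cvg_snd].
    have c2 : {for q, continuous (fun q : R*R*R => q.2)} by exact: cvg_snd.
    exact: (cvg_pair c11 (cvg_pair (cvg_pair c12 (cvg_cst (0 : R))) c2)).
  move=> P wP; have := c0 _ wP; rewrite /nbhs/=; apply: filterS => -[[t x] z]/= H.
  by move=> [/andP[? /ltW ?] ?]; apply: H; split => //=; apply/andP.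
have /subspace_continuousP/(_ (stpt q.1.1 q.1.2 q.2))/(_ _)/wrap[] := cw.
  by split => //=; rewrite t0 ltW.
by move=> /(cvg_comp _ _ cp).
Qed.

End Barriers.

(** * Solutions with zero wall values: tangential differences and decay at the walls *)

Section Estimates.
Context {R : realType}.

(** The coefficient is independent of [x], so that translation in [x] preserves the equation. The
    constants in [sol_bdd] and [sol_coef] only make the maximum principle applicable and enter none
    of the estimates; they may depend on the viscosities. *)
Record sol (T n1 n3 : R) (c : R -> R -> R) (f w : R -> R -> R -> R) : Prop := Sol {
  sol_cont : slab_cont T 1 w ;
  sol_bdd : exists B, forall t x z, 0 <= t < T -> 0 <= z <= 1 -> `|w t x z| <= B ;
  sol_op : forall t x z, 0 < t < T -> 0 < z < 1 ->
    parop n1 n3 (c t z) w t x z (f t x z) ;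
  sol_wall : forall t x, 0 <= t < T -> w t x 0 = 0 /\ w t x 1 = 0 ;
  sol_coef : exists2 K, 0 <= K & forall t z, 0 < t < T -> 0 < z < 1 -> `|c t z| <= K }.

Lemma expR_le1_mul (k t T y : R) : 0 <= k -> 0 <= t -> t <= T -> 0 <= y ->
  expR (k * t) * y <= expR (k * T) * y.
Proof. by move=> k0 t0 tT y0; rewrite ler_wpM2r// ler_expR ler_wpM2l. Qed.

Lemma expR_mul_ge (k t y : R) : 0 <= k -> 0 <= t -> 0 <= y -> y <= expR (k * t) * y.
Proof. by move=> k0 t0 y0; rewrite ler_peMl// -expR0 ler_expR mulr_ge0. Qed.

Lemma slab_cont_xshift (T h : R) (w : R -> R -> R -> R) : slab_cont T 1 w ->
  slab_cont T 1 (fun t x z => w t (x + h) (z + 0)).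
Proof. by apply: slab_cont_shift; rewrite ?addr0. Qed.

Lemma rate1 (e A X : R) : e * (1 * A + (1 - 1) * X) = e * A.
Proof. by rewrite subrr mul0r addr0 mul1r. Qed.

(** The barrier [exp(t) * m] is constant in space, and its time derivative is at least [m], hence at
    least the source. *)
Lemma zero_wall_bound (T n1 s K B m : R) (c g : R -> R -> R -> R) :
  0 <= n1 -> 0 < s -> 0 <= K -> 0 <= m ->
  (forall t x z, 0 < t < T -> 0 < z < 1 -> `|c t x z| <= K) ->
  slab_cont T 1 g ->
  (forall t x z, 0 <= t < T -> 0 <= z <= 1 -> `|g t x z| <= B) ->
  (forall t x z, 0 < t < T -> 0 < z < 1 ->
     exists2 r, `|r| <= m & parop n1 (s * s) (c t x z) g t x z r) ->
  (forall x z, 0 <= z <= 1 -> `|g 0 x z| <= m) ->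
  (forall t x, 0 <= t < T -> g t x 0 = 0 /\ g t x 1 = 0) ->
  forall t x z, 0 <= t < T -> 0 <= z <= 1 -> `|g t x z| <= expR (1 * T) * m.
Proof.
move=> n10 s0 K0 m0 hc cg hB hg h0 hw.
have pE t x z : bexp 1 s m 0 0 t x z = expR (1 * t) * m.
  by rewrite /bexp !mul0r !addr0.
have ss0 : 0 <= s * s by rewrite mulr_ge0// ltW.
have H : forall t x z, 0 <= t < T -> 0 <= z <= 1 -> `|g t x z| <= bexp 1 s m 0 0 t x z.
  apply: (comparison ltr01 n10 ss0 K0 hc cg (@slab_cont_bexp _ T 1 1 s m 0 0) (B := B)
    (fp := fun t x z => expR (1 * t) * (1 * m + (1 - 1) * (0 * expR (- z / s) + 0 * expR (z / s))))).
  - move=> t x z ht hz; split; first exact: hB.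
    by rewrite pE mulr_ge0// expR_ge0.
  - move=> t x z ht hz; have [r rm pr] := hg t x z ht hz; exists r => //.
    apply: le_trans rm _; rewrite rate1 expR_mul_ge//.
    by case/andP: ht => /ltW.
  - by move=> t x z _ _; apply: parop_bexp; rewrite gt_eqF.
  - by move=> x z hz; rewrite pE mulr0 expR0 mul1r h0.
  - move=> t x ht; have [-> ->] := hw t x ht.
    by rewrite normr0 !pE mulr_ge0 ?expR_ge0.
move=> t x z ht hz; apply: le_trans (H t x z ht hz) _; rewrite pE.
by case/andP: ht => ? /ltW ?; exact: expR_le1_mul.
Qed.

Section Solution.
Variables (T n1 s : R) (c : R -> R -> R) (f w : R -> R -> R -> R).
Hypotheses (n10 : 0 <= n1) (s0 : 0 < s) (s1 : s <= 1).
Hypothesis solw : sol T n1 (s * s) c f w.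

(** A translate in [x] solves the same equation and vanishes at the walls too, so that tangential
    differences do not see the boundary layer and [zero_wall_bound] applies to them. *)
Lemma sol_xdiff (M h : R) : 0 <= M -> 0 <= h ->
  (forall t x z, 0 < t < T -> 0 < z < 1 -> `|f t (x + h) z - f t x z| <= M * h) ->
  (forall x z, 0 <= z <= 1 -> `|w 0 (x + h) z - w 0 x z| <= M * h) ->
  forall t x z, 0 <= t < T -> 0 <= z <= 1 ->
    `|w t (x + h) z - w t x z| <= expR (1 * T) * (M * h).
Proof.
move=> M0 h0 hf hw0.
have [B hB] := sol_bdd solw; have [K K0 hK] := sol_coef solw.
pose g t x z := 1 * w t (x + h) (z + 0) + (-1) * w t x z.
have gE t x z : g t x z = w t (x + h) z - w t x z by rewrite /g addr0 mul1r mulN1r.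
have := @zero_wall_bound T n1 s K (B + B) (M * h) (fun t _ z => c t z) g n10 s0 K0.
move=> /(_ _ _ _ _ _ _ _)/wrap[].
- exact: mulr_ge0.
- by move=> t x z; exact: hK.
- exact: (@slab_cont_lin _ T 1 1 (-1) _ _ (@slab_cont_xshift T h w (sol_cont solw)) (sol_cont solw)).
- move=> t x z ht hz; rewrite gE; apply: le_trans (ler_normB _ _) _.
  by apply: lerD; exact: hB.
- move=> t x z ht hz; exists (1 * f t (x + h) z + (-1) * f t x z).
    by rewrite mul1r mulN1r; exact: hf.
  apply: parop_lin; last exact: (sol_op solw x ht hz).
  by apply: parop_shift; rewrite addr0; exact: (sol_op solw (x + h) ht hz).
- by move=> x z hz; rewrite gE; exact: hw0.
- move=> t x ht; rewrite !gE; have [-> ->] := sol_wall solw x ht.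
  by have [-> ->] := sol_wall solw (x + h) ht; rewrite subrr.
by move=> H t x z ht hz; rewrite -gE; exact: H.
Qed.

Lemma sol_xdiff2 (M h k : R) : 0 <= M -> 0 <= h -> 0 <= k ->
  (forall t x z, 0 < t < T -> 0 < z < 1 ->
    `|f t (x + h + k) z - f t (x + h) z - (f t (x + k) z - f t x z)| <= M * h * k) ->
  (forall x z, 0 <= z <= 1 ->
    `|w 0 (x + h + k) z - w 0 (x + h) z - (w 0 (x + k) z - w 0 x z)| <= M * h * k) ->
  forall t x z, 0 <= t < T -> 0 <= z <= 1 ->
    `|w t (x + h + k) z - w t (x + h) z - (w t (x + k) z - w t x z)| <=
      expR (1 * T) * (M * h * k).
Proof.
move=> M0 h0 k0 hf hw0.
have [B hB] := sol_bdd solw; have [K K0 hK] := sol_coef solw.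
pose g1 t x z := 1 * w t (x + k) (z + 0) + (-1) * w t x z.
pose g t x z := 1 * g1 t (x + h) (z + 0) + (-1) * g1 t x z.
have gE t x z : g t x z =
    w t (x + h + k) z - w t (x + h) z - (w t (x + k) z - w t x z).
  by rewrite /g /g1 !addr0 !mul1r !mulN1r.
have c1 : slab_cont T 1 g1.
  exact: (@slab_cont_lin _ T 1 1 (-1) _ _ (@slab_cont_xshift T k w (sol_cont solw)) (sol_cont solw)).
have p1 t x z : 0 < t < T -> 0 < z < 1 ->
    parop n1 (s * s) (c t z) g1 t x z (1 * f t (x + k) z + (-1) * f t x z).
  move=> ht hz; apply: parop_lin; last exact: (sol_op solw x ht hz).
  by apply: parop_shift; rewrite addr0; exact: (sol_op solw (x + k) ht hz).
have := @zero_wall_bound T n1 s K (B + B + (B + B)) (M * h * k) (fun t _ z => c t z) g n10 s0 K0.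
move=> /(_ _ _ _ _ _ _ _)/wrap[].
- by rewrite !mulr_ge0.
- by move=> t x z; exact: hK.
- exact: (@slab_cont_lin _ T 1 1 (-1) _ _ (@slab_cont_xshift T h g1 c1) c1).
- move=> t x z ht hz; rewrite gE; apply: le_trans (ler_normB _ _) _.
  by apply: lerD; apply: le_trans (ler_normB _ _) _; apply: lerD; exact: hB.
- move=> t x z ht hz.
  exists (1 * (1 * f t (x + h + k) z + (-1) * f t (x + h) z) +
          (-1) * (1 * f t (x + k) z + (-1) * f t x z)).
    by rewrite !mul1r !mulN1r; exact: hf.
  apply: parop_lin; last exact: (p1 t x z ht hz).
  by apply: (@parop_shift _ _ _ _ h 0 g1); rewrite addr0; exact: (p1 t (x + h) z ht hz).
- by move=> x z hz; rewrite gE; exact: hw0.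
- move=> t x ht; rewrite !gE; have [-> ->] := sol_wall solw x ht.
  have [-> ->] := sol_wall solw (x + h) ht.
  have [-> ->] := sol_wall solw (x + k) ht.
  by have [-> ->] := sol_wall solw (x + h + k) ht; rewrite !subrr.
by move=> H t x z ht hz; rewrite -gE; exact: H.
Qed.

(** Since [s <= 1], one has [exp(- z / s) <= exp(- z) <= 1 / (1 + z) <= 1 - z / 2]. The factor [2]
    lets the barrier [2 M (1 - exp(- z / s))] start above initial data bounded by [M z]. *)
Lemma one_sub_exp_ge (z : R) : 0 <= z <= 1 -> z <= 2 * (1 - expR (- z / s)).
Proof.
move=> /andP[z0 z1].
have zs : z <= z / s by rewrite ler_pdivlMr// ler_piMr.
have e1 : expR (- z / s) <= expR (- z) by rewrite ler_expR mulNr lerN2.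
have e2 : expR (- z) * (1 + z) <= 1.
  by rewrite -[leRHS](expRxMexpNx_1 (- z)) opprK ler_wpM2l ?expR_ge0// expR_ge1Dx.
have e3 : expR (- z) <= 1 - z / 2.
  have ep := expR_gt0 (- z).
  have e4 : (1 - z / 2) * (1 + z) >= 1 by nra.
  by rewrite -(ler_pM2r (_ : 0 < 1 + z)); lra.
lra.
Qed.

(* The barriers are e^t 2 M (1 - exp(- z / s)) and its reflection in z = 1 / 2. *)
Lemma sol_wall_decay (M : R) : 0 <= M ->
  (forall t x z, 0 < t < T -> 0 < z < 1 -> `|f t x z| <= M) ->
  (forall x z, 0 <= z <= 1 -> `|w 0 x z| <= M * z /\ `|w 0 x z| <= M * (1 - z)) ->
  forall t x z, 0 <= t < T -> 0 <= z <= 1 ->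
    `|w t x z| <= expR (1 * T) * (2 * M * (z / s)) /\
    `|w t x z| <= expR (1 * T) * (2 * M * ((1 - z) / s)).
Proof.
move=> M0 hf hw0.
have [B hB] := sol_bdd solw; have [K K0 hK] := sol_coef solw.
have sn : s != 0 by rewrite gt_eqF.
have M2 : 0 <= 2 * M by rewrite mulr_ge0.
have hc t (x : R) z : 0 < t < T -> 0 < z < 1 -> `|c t z| <= K by exact: hK.
have ss0 : 0 <= s * s by rewrite mulr_ge0// ltW.
have em1 (y : R) : 0 <= y -> 0 <= 1 - expR (- y / s).
  move=> y0; rewrite subr_ge0 -expR0 ler_expR mulNr oppr_le0 divr_ge0// ltW//.
have em2 (y : R) : 1 - expR (- y / s) <= y / s.
  by have := expR_ge1Dx (- y / s); rewrite mulNr; lra.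
pose A := 2 * M.
(* This factor turns [exp(z / s)] into [exp(- (1 - z) / s)], the profile reflected to the upper
   wall. *)
pose D := - A * expR (- 1 / s).
have pE t x z : bexp 1 s A (- A) 0 t x z = expR (1 * t) * (A * (1 - expR (- z / s))).
  by rewrite /bexp; ring.
have pE' t x z : bexp 1 s A 0 D t x z = expR (1 * t) * (A * (1 - expR (- (1 - z) / s))).
  rewrite /bexp /D -mulrA -expRD.
  have -> : - 1 / s + z / s = - (1 - z) / s by ring.
  by ring.
have H1 : forall t x z, 0 <= t < T -> 0 <= z <= 1 -> `|w t x z| <= bexp 1 s A (- A) 0 t x z.
  apply: (comparison ltr01 n10 ss0 K0 hc (sol_cont solw) (@slab_cont_bexp _ T 1 1 s A (- A) 0) (B := B)
    (fp := fun t x z => expR (1 * t) * (1 * A + (1 - 1) * (- A * expR (- z / s) + 0 * expR (z / s))))).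
  - move=> t x z ht hz; split; first exact: hB.
    by rewrite pE !mulr_ge0 ?expR_ge0// em1//; case/andP: hz.
  - move=> t x z ht hz; exists (f t x z); last exact: (sol_op solw x ht hz).
    apply: le_trans (hf t x z ht hz) _; rewrite rate1.
    apply: (@le_trans _ _ A); first by rewrite /A; lra.
    by apply: expR_mul_ge => //; case/andP: ht => /ltW.
  - by move=> t x z _ _; exact: parop_bexp.
  - move=> x z hz; rewrite pE mulr0 expR0 mul1r /A mulrAC mulrC.
    apply: le_trans (proj1 (hw0 x z hz)) _.
    by rewrite ler_wpM2l// one_sub_exp_ge.
  - move=> t x ht; have [-> ->] := sol_wall solw x ht.
    by rewrite normr0 !pE !mulr_ge0 ?expR_ge0// em1.
have H2 : forall t x z, 0 <= t < T -> 0 <= z <= 1 -> `|w t x z| <= bexp 1 s A 0 D t x z.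
  apply: (comparison ltr01 n10 ss0 K0 hc (sol_cont solw) (@slab_cont_bexp _ T 1 1 s A 0 D) (B := B)
    (fp := fun t x z => expR (1 * t) * (1 * A + (1 - 1) * (0 * expR (- z / s) + D * expR (z / s))))).
  - move=> t x z ht /[dup] hz /andP[z0 z1]; split; first exact: hB.
    by rewrite pE' !mulr_ge0 ?expR_ge0// em1// subr_ge0.
  - move=> t x z ht hz; exists (f t x z); last exact: (sol_op solw x ht hz).
    apply: le_trans (hf t x z ht hz) _; rewrite rate1.
    apply: (@le_trans _ _ A); first by rewrite /A; lra.
    by apply: expR_mul_ge => //; case/andP: ht => /ltW.
  - by move=> t x z _ _; exact: parop_bexp.
  - move=> x z hz; rewrite pE' mulr0 expR0 mul1r /A mulrAC mulrC.
    apply: le_trans (proj2 (hw0 x z hz)) _.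
    rewrite ler_wpM2l// one_sub_exp_ge//.
    by case/andP: hz => *; apply/andP; split; lra.
  - move=> t x ht; have [-> ->] := sol_wall solw x ht.
    by rewrite normr0 !pE' !mulr_ge0 ?expR_ge0// em1 ?subr_ge0 ?subrr.
move=> t x z ht hz; case/andP: (ht) => t0 /ltW tT; case/andP: (hz) => z0 z1.
split.
  apply: le_trans (H1 t x z ht hz) _; rewrite pE.
  apply: (@le_trans _ _ (expR (1 * t) * (A * (z / s)))).
    by rewrite ler_wpM2l ?expR_ge0// ler_wpM2l.
  by apply: expR_le1_mul => //; rewrite mulr_ge0// divr_ge0// ltW.
apply: le_trans (H2 t x z ht hz) _; rewrite pE'.
apply: (@le_trans _ _ (expR (1 * t) * (A * ((1 - z) / s)))).
  by rewrite ler_wpM2l ?expR_ge0// ler_wpM2l.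
by apply: expR_le1_mul => //; rewrite mulr_ge0// divr_ge0 ?subr_ge0// ltW.
Qed.

End Solution.
End Estimates.

(** * Normal differences across the layer, and the interior limit *)

Section LayerEstimates.
Context {R : realType}.

Lemma sq_ge0 (y : R) : 0 <= y * y.
Proof. by rewrite -expr2 sqr_ge0. Qed.

(** A solution shifted in [z] has the shifted drift. To subtract the unshifted one, its drift is
    changed too, at the price of the source [(c' - c) * wx]. *)
Lemma parop_coef n1 n3 c c' (w : R -> R -> R -> R) t x z (r wx : R) :
  is_derive x (1:R) (fun y => w t y z) wx -> parop n1 n3 c w t x z r ->
  parop n1 n3 c' w t x z (r + (c' - c) * wx).
Proof.
move=> dw [gt [gx [gxx [gz [gzz [? dx ? ->]]]]]].
exists gt, gx, gxx, gz, gzz; split => //.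
have -> : wx = gx.
  have dx1 := deriv2_is_derive dx.
  by rewrite -(@derive_val _ _ _ _ _ _ _ dw) -(@derive_val _ _ _ _ _ _ _ dx1).
by ring.
Qed.

(* The boundary layer profile of width s, the integral of which over [0, 1] is bounded
   uniformly in s. *)
Definition layer (s l z : R) := 1 + (expR (- z / s) + expR ((z - l) / s)) / s.

Lemma layer_ge1 s l z : 0 < s -> 1 <= layer s l z.
Proof. by move=> s0; rewrite /layer lerDl divr_ge0// ?addr_ge0 ?expR_ge0// ltW. Qed.

Section Solution.
Variables (T n1 s : R) (c : R -> R -> R) (f w wx : R -> R -> R -> R).
Hypotheses (n10 : 0 <= n1) (s0 : 0 < s) (s1 : s <= 1).
Hypothesis solw : sol T n1 (s * s) c f w.

(* The barrier is a multiple of e^(2 t) h layer s (1 - h): the exponentials in layer are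
   preserved by s^2 d_zz, and at z = 0, z = 1 - h they dominate the wall bound h / s. *)
Lemma sol_zdiff (M Kc Mx h : R) : 0 <= M -> 0 <= Kc -> 0 <= Mx -> 0 < h < 1 ->
  (forall t x z, 0 < t < T -> 0 < z < 1 ->
     is_derive x (1:R) (fun y => w t y z) (wx t x z) /\ `|wx t x z| <= Mx) ->
  (forall t x z, 0 < t < T -> 0 < z < 1 -> `|f t x z| <= M) ->
  (forall t x z, 0 < t < T -> 0 < z < 1 - h -> `|f t x (z + h) - f t x z| <= M * h) ->
  (forall t z, 0 < t < T -> 0 < z < 1 - h ->
     `|c t (z + h) - c t z| <= Kc * h * layer s (1 - h) z) ->
  (forall x z, 0 <= z <= 1 -> `|w 0 x z| <= M * z /\ `|w 0 x z| <= M * (1 - z)) ->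
  (forall x z, 0 <= z <= 1 - h -> `|w 0 x (z + h) - w 0 x z| <= M * h) ->
  forall t x z, 0 <= t < T -> 0 <= z <= 1 - h ->
    `|w t x (z + h) - w t x z| <=
       expR (2 * T) * ((M + Kc * Mx + expR (1 * T) * (2 * M)) * h * layer s (1 - h) z).
Proof.
move=> M0 Kc0 Mx0 /andP[h0 h1] hwx hf hfd hcd hw0 hwd.
have [B hB] := sol_bdd solw; have [K K0 hK] := sol_coef solw.
have sn : s != 0 by rewrite gt_eqF.
have ss0 : 0 <= s * s by rewrite mulr_ge0// ltW.
(* The summands pay, in this order, for the source and the initial data, for the variation of the
   drift times [wx], and for the wall values bounded by [sol_wall_decay]. *)
set C := M + Kc * Mx + expR (1 * T) * (2 * M).
have e2M : 0 <= expR (1 * T) * (2 * M) by rewrite !mulr_ge0// expR_ge0.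
have KM : 0 <= Kc * Mx by rewrite mulr_ge0.
have C0 : 0 <= C by rewrite /C; lra.
pose A := C * h.
have A0 : 0 <= A by rewrite /A mulr_ge0// ltW.
(* With this [D] the second exponential peaks at [z = 1 - h], the upper end of the shifted slab, and
   the two exponentials add up to [A * (layer - 1)]. *)
pose D := A / s * expR ((h - 1) / s).
pose p := bexp 2 s A (A / s) D.
have mE z : A / s * expR (- z / s) + D * expR (z / s) = A * (layer s (1 - h) z - 1).
  rewrite /D /layer.
  have -> : (z - (1 - h)) / s = (h - 1) / s + z / s by ring.
  by rewrite expRD; ring.
have pE t x z : p t x z = expR (2 * t) * (A * layer s (1 - h) z).
  by rewrite /p /bexp -addrA mE; ring.
have lay z := @layer_ge1 s (1 - h) z s0.
have l0 : 0 < 1 - h by lra.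
pose g t x z := 1 * w t (x + 0) (z + h) + (-1) * w t x z.
have gE t x z : g t x z = w t x (z + h) - w t x z by rewrite /g addr0 mul1r mulN1r.
have zh z : 0 < z < 1 - h -> 0 < z + h < 1 by move=> /andP[? ?]; apply/andP; split; lra.
have zz z : 0 < z < 1 - h -> 0 < z < 1 by move=> /andP[? ?]; apply/andP; split; lra.
have zhc z : 0 <= z <= 1 - h -> 0 <= z + h <= 1 by move=> /andP[? ?]; apply/andP; split; lra.
have zzc z : 0 <= z <= 1 - h -> 0 <= z <= 1 by move=> /andP[? ?]; apply/andP; split; lra.
have cg : slab_cont T (1 - h) g.
  apply: (@slab_cont_lin _ T (1 - h) 1 (-1) (fun t x z => w t (x + 0) (z + h)) w).
    apply: (@slab_cont_shift _ T (1 - h) 1 0 h w (ltW h0) _ (sol_cont solw)).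
    by rewrite subrK.
  apply: continuous_subspaceW (sol_cont solw) => q [/= ? ?]; split => //=.
  exact: zzc.
have hc t (x : R) z : 0 < t < T -> 0 < z < 1 - h -> `|c t (z + h)| <= K.
  by move=> ht hz; apply: hK => //; exact: zh.
have H : forall t x z, 0 <= t < T -> 0 <= z <= 1 - h -> `|g t x z| <= p t x z.
  apply: (comparison l0 n10 ss0 K0 hc cg (@slab_cont_bexp _ T (1 - h) 2 s A (A / s) D) (B := B + B)
    (fp := fun t x z => expR (2 * t) * (2 * A + (2 - 1) * (A / s * expR (- z / s) + D * expR (z / s))))).
  - move=> t x z ht hz; split.
      rewrite gE; apply: le_trans (ler_normB _ _) _.
      by apply: lerD; apply: hB => //; [exact: zhc|exact: zzc].
    rewrite -/(p t x z) pE mulr_ge0 ?expR_ge0// mulr_ge0//.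
    by apply: le_trans (lay z).
  - move=> t x z ht hz; have [dwx bwx] := hwx t x z ht (zz _ hz).
    exists (1 * f t x (z + h) + (-1) * (f t x z + (c t (z + h) - c t z) * wx t x z)).
      (* At rate [2] the barrier has the right-hand side [A + A * layer], up to the factor in time,
         and [A * layer] alone already dominates a source of layer shape. *)
      have -> : 2 * A + (2 - 1) * (A / s * expR (- z / s) + D * expR (z / s)) =
          A + A * layer s (1 - h) z by rewrite mE; ring.
      have t0 : 0 <= t by case/andP: ht => /ltW.
      apply: (@le_trans _ _ (A * layer s (1 - h) z)); last first.
        apply: le_trans (@expR_mul_ge _ 2 t _ _ t0 _) => //; first by lra.
        by rewrite addr_ge0// mulr_ge0//; apply: le_trans (lay z).
      have -> : 1 * f t x (z + h) + -1 * (f t x z + (c t (z + h) - c t z) * wx t x z) =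
        (f t x (z + h) - f t x z) - (c t (z + h) - c t z) * wx t x z by ring.
      apply: le_trans (ler_normB _ _) _.
      apply: (@le_trans _ _ (M * h + Kc * h * layer s (1 - h) z * Mx)).
        apply: lerD; first exact: hfd.
        by rewrite normrM; apply: ler_pM => //; exact: hcd.
      rewrite /A /C; have := lay z; move: (layer _ _ _) => la la1.
      have : 0 <= M * h * (la - 1) by rewrite !mulr_ge0 ?subr_ge0// ltW.
      have : 0 <= expR (1 * T) * (2 * M) * h * la.
        by rewrite !mulr_ge0 ?expR_ge0//; lra.
      nra.
    apply: parop_lin; last exact: (parop_coef _ dwx (sol_op solw x ht (zz _ hz))).
    by apply: parop_shift; rewrite addr0; exact: (sol_op solw x ht (zh _ hz)).
  - by move=> t x z _ _; exact: parop_bexp.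
  - move=> x z hz; rewrite gE -/(p 0 x z) pE mulr0 expR0 mul1r.
    apply: le_trans (hwd x z hz) _.
    rewrite /A /C; have := lay z; move: (layer _ _ _) => la la1.
    have : M * h <= (M + Kc * Mx + expR (1 * T) * (2 * M)) * h.
      by rewrite ler_wpM2r ?(ltW h0)//; lra.
    move=> /le_trans; apply; rewrite ler_peMr// mulr_ge0// ?ltW//.
  - move=> t x ht; have [w0 w1] := sol_wall solw x ht.
    have t0 : 0 <= t by case/andP: ht.
    have [hh hh'] : 0 <= h <= 1 /\ 0 <= 1 - h <= 1 by split; apply/andP; split; lra.
    have [d1 _] := sol_wall_decay n10 s0 s1 solw M0 hf hw0 x ht hh.
    have [_ d2] := sol_wall_decay n10 s0 s1 solw M0 hf hw0 x ht hh'.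
    rewrite !gE add0r subrK w0 w1 subr0 sub0r normrN -!/(p t x _) !pE.
    have wl z : h / s <= h * layer s (1 - h) z ->
       expR (1 * T) * (2 * M * (h / s)) <= expR (2 * t) * (A * layer s (1 - h) z).
      move=> hz; apply: le_trans (@expR_mul_ge _ 2 t _ _ t0 _) => //; last first.
        by rewrite mulr_ge0//; apply: le_trans (lay z).
      rewrite /A /C -(mulrA _ h); apply: (@le_trans _ _ (expR (1 * T) * (2 * M) * (h * layer s (1 - h) z))).
        by rewrite mulrA ler_wpM2l.
      rewrite ler_wpM2r//; last by lra.
      by rewrite mulr_ge0// ?(ltW h0)//; apply: le_trans (lay z).
    have le1 (a b y : R) : 0 < y -> 0 <= a -> y * s^-1 <= y * (1 + (1 + expR b) / s).
      move=> y0 a0; rewrite ler_wpM2l// ?(ltW y0)// mulrDl.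
      have : 0 <= expR b / s by rewrite divr_ge0 ?expR_ge0// ltW.
      by rewrite mul1r; lra.
    split.
      apply: le_trans d1 _; apply: wl.
      by rewrite /layer oppr0 mul0r expR0; apply: (le1 1).
    apply: le_trans d2 _; rewrite opprB addrCA subrr addr0; apply: wl.
    by rewrite /layer subrr mul0r expR0 (addrC (expR _)); apply: (le1 1).
move=> t x z ht hz; rewrite -gE; apply: le_trans (H t x z ht hz) _; rewrite pE.
case/andP: ht => ? /ltW ?; apply: expR_le1_mul => //.
by rewrite mulr_ge0//; apply: le_trans (lay z).
Qed.

Lemma amgm1 (y e : R) : 0 < e -> `|y| <= (y * y / e + e) / 2.
Proof.
move=> e0; have -> : y * y = `|y| * `|y| by rewrite -normrM ger0_norm// sq_ge0.
move: `|y| => a; have : 0 <= (a - e) * (a - e) / e.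
  by apply: divr_ge0; [exact: sq_ge0|exact: ltW].
have -> : (a - e) * (a - e) / e = a * a / e - 2 * a + e by field; rewrite gt_eqF.
lra.
Qed.

(* V is the inviscid solution along the characteristic X at height z0, and the barrier is
   a quadratic around (X t, z0) of width e; it stays above the O(1) values at the walls
   because these are at distance d from z0. *)
Lemma sol_frozen (M K1 d sg e z0 : R) (X X' V V' : R -> R) :
  0 <= M -> 0 <= K1 -> 0 < d -> d <= z0 -> d <= 1 - z0 -> 0 < e <= 1 ->
  (forall t, 0 <= t < T -> {for t, continuous X}) ->
  (forall t, 0 < t < T -> is_derive t (1:R) X (X' t)) ->
  slab_cont T 1 (fun t _ _ => V t) ->
  (forall t, 0 < t < T -> is_derive t (1:R) V (V' t)) ->
  (forall t x z, 0 < t < T -> 0 < z < 1 ->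
     `|f t x z - V' t| <= M * (`|x - X t| + `|z - z0|)) ->
  (forall t z, 0 < t < T -> 0 < z < 1 -> `|c t z - X' t| <= K1 * (`|z - z0| + sg)) ->
  (forall x z, 0 <= z <= 1 -> `|w 0 x z - V 0| <= M * (`|x - X 0| + `|z - z0|)) ->
  (forall t, 0 <= t < T -> `|V t| <= M) ->
  let k := 2 * K1 + 1 in
  let A := M + M / (d * d) in
  forall t x z, 0 <= t < T -> 0 <= z <= 1 ->
    `|w t x z - V t| <= expR (k * T) * A *
      ((((x - X t) * (x - X t) + (z - z0) * (z - z0)) / e + e) +
       T * ((K1 * (sg * sg) + 2 * (n1 + s * s)) / e)).
Proof.
move=> M0 K10 d0 dz dz1 /andP[e0 e1] cX dX cV dV hfV hcX hw0 hV k A.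
have [B hB] := sol_bdd solw; have [K K0 hK] := sol_coef solw.
have dd0 : 0 < d * d by rewrite mulr_gt0.
(* In [A], the summand [M] serves the source and the initial data. At the walls the bracket is at
   least [d^2 / e], and [M / (d * d)] lifts the barrier above [|V| <= M], because [e <= 1]. *)
have A0 : 0 <= A by rewrite /A addr_ge0// divr_ge0// ltW.
have k0 : 0 <= k by rewrite /k; lra.
have en : e != 0 by rewrite gt_eqF.
have ss0 : 0 <= s * s by rewrite mulr_ge0// ltW.
(* [E0 / e] collects what the growth rate [k] does not absorb: the offset [sg] of the drift, and the
   viscosity acting on the quadratic. *)
pose E0 := K1 * (sg * sg) + 2 * (n1 + s * s).
have E00 : 0 <= E0.
  by rewrite /E0 addr_ge0// mulr_ge0 ?sq_ge0// addr_ge0.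
pose D := expR (k * T) * A * (E0 / e).
have D0 : 0 <= D by rewrite /D; apply: mulr_ge0; [rewrite mulr_ge0 ?expR_ge0|rewrite divr_ge0// ltW].
pose p := bquad k A D e X z0.
pose Q t x z := (((x - X t) * (x - X t) + (z - z0) * (z - z0)) / e + e).
have Q0 t x z : 0 <= Q t x z.
  by rewrite /Q addr_ge0 ?(ltW e0)// divr_ge0 ?(ltW e0)// addr_ge0// sq_ge0.
have QM t x z : M * (`|x - X t| + `|z - z0|) <= A * Q t x z.
  apply: (@le_trans _ _ (M * Q t x z)).
    rewrite ler_wpM2l//; have := amgm1 (x - X t) e0; have := amgm1 (z - z0) e0.
    have sqe y : 0 <= y * y / e by apply: divr_ge0; [exact: sq_ge0|exact: ltW].
    by have := sqe (x - X t); have := sqe (z - z0); rewrite /Q mulrDl; lra.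
  by rewrite ler_wpM2r// /A lerDl divr_ge0// ltW.
pose g t x z := 1 * w t x z + (-1) * V t.
have gE t x z : g t x z = w t x z - V t by rewrite /g mul1r mulN1r.
have H : forall t x z, 0 <= t < T -> 0 <= z <= 1 -> `|g t x z| <= p t x z.
  apply: (comparison ltr01 n10 ss0 K0 (fun t (x : R) z => hK t z)
    (@slab_cont_lin _ T 1 1 (-1) w (fun t _ _ => V t) (sol_cont solw) cV)
    (@slab_cont_bquad _ T 1 k A D e X z0 cX) (B := B + M)
    (fp := fun t x z => expR (k * t) * A * (k * Q t x z + 2 * (c t z - X' t) * (x - X t) / e
       - 2 * (n1 + s * s) / e) + D)).
  - move=> t x z ht hz; split.
      rewrite -/(g t x z) gE; apply: le_trans (ler_normB _ _) _.
      by apply: lerD; [exact: hB|exact: hV].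
    have t0 : 0 <= t by case/andP: ht.
    by rewrite /bquad addr_ge0 ?(mulr_ge0 D0)// mulr_ge0 ?mulr_ge0 ?expR_ge0//; exact: Q0.
  - move=> t x z ht hz; exists (1 * f t x z + (-1) * V' t); last first.
      apply: parop_lin; first exact: (sol_op solw x ht hz).
      by apply: parop_time; exact: dV.
    rewrite mul1r mulN1r; apply: le_trans (hfV t x z ht hz) _.
    apply: le_trans (QM t x z) _.
    have [t0 tT] : 0 <= t /\ t <= T by case/andP: ht => /ltW ? /ltW.
    have eA1 : A * Q t x z <= expR (k * t) * (A * Q t x z).
      by apply: expR_mul_ge => //; exact: mulr_ge0.
    have eA2 : expR (k * t) * (A * (E0 / e)) <= D.
      by rewrite /D -mulrA; apply: expR_le1_mul => //; rewrite mulr_ge0// divr_ge0// ltW.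
    suff : Q t x z - E0 / e <= k * Q t x z + 2 * (c t z - X' t) * (x - X t) / e
       - 2 * (n1 + s * s) / e.
      move=> HH; have := ler_wpM2l (mulr_ge0 (expR_ge0 (k * t)) A0) HH.
      by move: eA1 eA2; rewrite -!mulrA !mulrBr; lra.
    (* The product [2 K1 (|z - z0| + sg) |x - X|] is split into squares. They cost [2 K1] of the
       rate [k], and the remaining [1] is kept for the source. *)
    have : - (2 * (c t z - X' t) * (x - X t)) <=
        2 * K1 * ((x - X t) * (x - X t) + (z - z0) * (z - z0)) + K1 * (sg * sg).
      apply: le_trans (ler_norm _) _; rewrite normrN !normrM normr_nat.
      apply: (@le_trans _ _ (2 * (K1 * (`|z - z0| + sg)) * `|x - X t|)).
        by rewrite ler_wpM2r// ler_wpM2l// hcX.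
      have -> : (x - X t) * (x - X t) = `|x - X t| * `|x - X t|.
        by rewrite -normrM ger0_norm// sq_ge0.
      have -> : (z - z0) * (z - z0) = `|z - z0| * `|z - z0|.
        by rewrite -normrM ger0_norm// sq_ge0.
      move: `|x - X t| `|z - z0| => a b.
      have q1 : 0 <= K1 * ((a - b) * (a - b)) by rewrite mulr_ge0// sq_ge0.
      have q2 : 0 <= K1 * ((a - sg) * (a - sg)) by rewrite mulr_ge0// sq_ge0.
      have q3 : 0 <= K1 * (b * b) by rewrite mulr_ge0// sq_ge0.
      nra.
    move=> HH; rewrite /Q /E0 /k.
    have : - (2 * (c t z - X' t) * (x - X t)) / e <=
       (2 * K1 * ((x - X t) * (x - X t) + (z - z0) * (z - z0)) + K1 * (sg * sg)) / e.
      by rewrite ler_wpM2r// invr_ge0 ltW.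
    have K1e : 0 <= K1 * e by rewrite mulr_ge0// ltW.
    by move: K1e; move: (e^-1) => ei; nra.
  - move=> t x z ht hz; apply: parop_bquad => //; exact: dX.
  - move=> x z hz; rewrite -/(g 0 x z) gE /bquad !mulr0 expR0 mul1r addr0.
    by apply: le_trans (hw0 x z hz) _; exact: QM.
  - move=> t x ht; have [w0 w1] := sol_wall solw x ht.
    have t0 : 0 <= t by case/andP: ht.
    rewrite -!/(g t x _) !gE w0 w1 sub0r normrN.
    suff wl z : d * d <= (z - z0) * (z - z0) -> `|V t| <= bquad k A D e X z0 t x z.
      by split; apply: wl; nra.
    move=> dzz; apply: le_trans (hV t ht) _; rewrite /bquad.
    apply: (@le_trans _ _ (expR (k * t) * A * Q t x z)); last first.
      by rewrite lerDl mulr_ge0.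
    rewrite -mulrA; apply: le_trans (@expR_mul_ge _ k t _ k0 t0 _); last exact: mulr_ge0.
    apply: (@le_trans _ _ (M / (d * d) * (d * d / e))).
      rewrite mulrA divfK ?gt_eqF// ler_peMr// invf_ge1//.
    apply: ler_pM.
    + by rewrite divr_ge0// ltW.
    + by rewrite divr_ge0// ltW.
    + by rewrite /A lerDr.
    + rewrite /Q; apply: (@le_trans _ _ (((x - X t) * (x - X t) + (z - z0) * (z - z0)) / e)).
        rewrite ler_wpM2r ?invr_ge0 ?(ltW e0)//; apply: le_trans dzz _.
        by rewrite lerDr sq_ge0.
      by rewrite lerDl ltW.
move=> t x z ht hz; rewrite -gE; apply: le_trans (H t x z ht hz) _.
have [t0 tT] : 0 <= t /\ t <= T by case/andP: ht => ? /ltW.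
rewrite /p /bquad [leRHS]mulrDr; apply: lerD.
  by rewrite -!mulrA; apply: expR_le1_mul => //; rewrite mulr_ge0//; exact: Q0.
rewrite -/E0 (mulrC T) mulrA -/D.
exact: ler_wpM2l.
Qed.

End Solution.
End LayerEstimates.

(** * Characteristics of the Euler flow *)

Section Characteristics.
Context {R : realType}.

(** At a fixed height the Euler velocity depends on time alone, so that a characteristic is a
    primitive. Clamping time to [[0, T]] makes the integrand continuous on the line, and integrating
    from [-1] makes [0] an interior point, which gives continuity there. *)
Lemma primitive_exists (T t1 x1 : R) (v : R -> R) : 0 < T ->
  {within [set t | 0 <= t <= T], continuous v} ->
  exists X : R -> R, [/\ X t1 = x1, forall t, 0 <= t < T -> {for t, continuous X} &
    forall t, 0 < t < T -> is_derive t (1:R) X (v t)].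
Proof.
move=> T0 cv.
pose cl (t : R) := Num.min T (Num.max 0 t).
have ccl : continuous cl.
  move=> t; apply: continuous_min; first exact: cvg_cst.
  by apply: continuous_max; [exact: cvg_cst|exact: cvg_id].
have clI t : [set t | 0 <= t <= T] (cl t).
  by rewrite /= /cl le_min (ltW T0) le_max lexx/= ge_min lexx.
have clE t : 0 <= t <= T -> cl t = t.
  by move=> /andP[t0 tT]; rewrite /cl (max_idPr t0); exact/min_idPr.
pose V t := v (cl t).
have cV : continuous V.
  move=> t; have /subspace_continuousP/(_ _ (clI t)) H := cv.
  apply: cvg_trans H => P wP; have H2 := ccl t _ wP.
  by apply: (@filterS _ (nbhs t) _ _ _ _ H2) => y; apply; exact: clI.
pose F (x : R) := (\int[lebesgue_measure]_(y in [set` `[(-1)%R, x]]) (V y))%R.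
have dF t : -1 < t -> derivable F t 1 /\ derive1 F t = V t.
  move=> t1'; apply: (@continuous_FTC1_closed _ V (-1) t (t + 1)) => //.
  - by rewrite ltrDl.
  - apply: continuous_compact_integrable; first exact: segment_compact.
    exact: continuous_subspaceT.
  - exact: cV.
exists (fun t => F t + (x1 - F t1)); split.
- by rewrite addrC subrK.
- move=> t /andP[t0 _]; apply: cvgD; last exact: cvg_cst.
  have [dFt _] : derivable F t 1 /\ derive1 F t = V t by apply: dF; lra.
  by apply/differentiable_continuous/derivable1_diffP.
- move=> t /andP[t0 tT].
  have [dFt FE] : derivable F t 1 /\ derive1 F t = V t by apply: dF; lra.
  have dFt' : is_derive t (1:R) F (v t).
    apply: DeriveDef => //; rewrite -derive1E FE /V clE//.
    by rewrite !ltW.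
  by apply: (isd_eq (isdD dFt' (isd_cst t (x1 - F t1)))); rewrite addr0.
Qed.

Lemma is_derive_of_cvg (h : R -> R) (x d : R) :
  (e^-1 * (h (x + e) - h x)) @[e --> 0^'] --> d -> is_derive x (1:R) h d.
Proof.
move=> H.
have H' : (e^-1 *: (h (e *: 1 + x) - h x)) @[e --> 0^'] --> d.
  by apply: cvg_trans H; apply: near_eq_cvg; near=> e; rewrite /= [e%:A]mulr1 (addrC e).
by apply: DeriveDef; [apply/cvg_ex; exists d|exact: cvg_lim H'].
Unshelve. all: by end_near. Qed.

(** Only partial derivatives are at hand, so the increment is split into a step in [t] at the fixed
    position [X t] and a step in [x] at the new time. The second is handled by the mean value
    theorem and the joint continuity of [ux]. *)
Lemma is_derive_along (u ux : R -> R -> R) (X : R -> R) (t ut X' : R) :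
  is_derive t (1:R) (fun s => u s (X t)) ut ->
  (\forall s \near t, forall x, is_derive x (1:R) (fun y => u s y) (ux s x)) ->
  {for (t, X t), continuous (fun q : R * R => ux q.1 q.2)} ->
  is_derive t (1:R) X X' ->
  is_derive t (1:R) (fun s => u s (X s)) (ut + ux t (X t) * X').
Proof.
move=> dut dux cux dX.
have H1 := is_derive_cvg dut; have H2 := is_derive_cvg dX.
have cX : X (t + e) @[e --> 0^'] --> X t.
  have cX0 : {for t, continuous X}.
    by apply/differentiable_continuous/derivable1_diffP; case: dX.
  have h : t + e @[e --> (0 : R)] --> t + 0 by apply: cvgD; [exact: cvg_cst|exact: cvg_id].
  rewrite addr0 in h; have h' := cvg_comp _ _ h cX0.
  by apply: cvg_trans h'; apply: cvg_app; exact: cvg_within.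
(* Where [X] has not moved, the quotient is replaced by [ux]: multiplied by [X (t + e) - X t] it
   still gives the increment, and the limit is not disturbed. *)
pose phi e := if X (t + e) == X t then ux (t + e) (X t) else
  (u (t + e) (X (t + e)) - u (t + e) (X t)) / (X (t + e) - X t).
have cphi : phi e @[e --> 0^'] --> ux t (X t).
  apply/cvgrPdist_le => /= r r0.
  move/cvgrPdist_le: cux => /(_ r r0)/nbhs_ballP[d /= d0 hd].
  move/nbhs_ballP: dux => [d' /= d'0 hd'].
  have nX : \forall e \near 0^', `|X t - X (t + e)| < d by move/cvgrPdist_lt: cX; apply.
  have ne m : 0 < m -> \forall e \near (0:R)^', `|e| < m.
    move=> m0; exists m => // e; rewrite /ball_/= sub0r normrN => //.
  near=> e.
  have ed : `|e| < d by near: e; exact: ne.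
  have ed' : `|e| < d' by near: e; exact: ne.
  have Xd : `|X t - X (t + e)| < d by near: e.
  have dxe y : is_derive y (1:R) (fun y => u (t + e) y) (ux (t + e) y).
    by apply: hd'; rewrite /ball/= opprD addNKr normrN.
  have cu p q : {within `[p, q], continuous (fun y => u (t + e) y)}.
    by apply: derivable_within_continuous => y _; case: (dxe y).
  have close y : `|X t - y| < d -> `|ux t (X t) - ux (t + e) y| <= r.
    by move=> Xy; apply: (hd (t + e, y)); split; rewrite /ball/= ?opprD ?addNKr ?normrN.
  rewrite /phi; case: eqP => [_|/eqP XX].
    by apply: close; rewrite subrr normr0.
  have [XX'|XX'|XX'] := ltgtP (X (t + e)) (X t); last by rewrite XX' eqxx in XX.
    have [xi + E] := @MVT R (fun y => u (t + e) y) (ux (t + e)) _ _ XX' (fun y _ => dxe y) (cu _ _).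
    rewrite in_itv/= => /andP[x1 x2].
    have -> : (u (t + e) (X (t + e)) - u (t + e) (X t)) / (X (t + e) - X t) = ux (t + e) xi.
      rewrite -opprB E -mulrN opprB mulfK// subr_eq0 lt_eqF//.
    by apply: close; move: Xd; rewrite !gtr0_norm ?subr_gt0//; lra.
  have [xi + E] := @MVT R (fun y => u (t + e) y) (ux (t + e)) _ _ XX' (fun y _ => dxe y) (cu _ _).
  rewrite in_itv/= => /andP[x1 x2].
  have -> : (u (t + e) (X (t + e)) - u (t + e) (X t)) / (X (t + e) - X t) = ux (t + e) xi.
    by rewrite E mulfK// subr_eq0 gt_eqF.
  by apply: close; move: Xd; rewrite !ltr0_norm ?subr_lt0//; lra.
apply: (@is_derive_of_cvg (fun s => u s (X s))).
have cc : phi e * (e^-1 * (X (t + e) - X t)) + e^-1 * (u (t + e) (X t) - u t (X t))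
   @[e --> 0^'] --> ux t (X t) * X' + ut by apply: cvgD => //; exact: cvgM.
rewrite addrC; apply: cvg_trans cc; apply: near_eq_cvg; near=> e.
rewrite /phi; case: eqP => [->|/eqP XX]; first by rewrite subrr !mulr0 add0r.
rewrite mulrCA -mulrDr divfK ?subr_eq0//; congr (_ * _).
by rewrite addrA subrK.
Unshelve. all: by end_near. Qed.

End Characteristics.

Section DiffBound.
Context {R : realType}.

Lemma derive_le_bound (h : R -> R) (x d K r : R) : 0 < r -> is_derive x (1:R) h d ->
  (forall e, 0 < e < r -> `|h (x + e) - h x| <= K * e) -> `|d| <= K.
Proof.
move=> r0 /is_derive_cvg dh hK.
have dh' : `|e^-1 * (h (x + e) - h x)| @[e --> 0^'+] --> `|d|.
  apply: cvg_norm; apply: cvg_trans dh; apply: cvg_app => P [e e0 eP].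
  by exists e => // y ye y0; apply: eP => //; rewrite gt_eqF.
apply: (cvgr_to_le dh'); near=> e.
have e0 : 0 < e by [].
rewrite normrM gtr0_norm ?invr_gt0// mulrC ler_pdivrMr//.
by apply: hK; rewrite e0/=; near: e; exact: nbhs_right_lt.
Unshelve. all: by end_near. Qed.

(** A difference quotient of step [e] is controlled by a profile whose upper peak sits at [1 - e].
    For [e <= s], moving this peak to the wall costs at most the factor [exp(1)]. *)
Lemma layer_le (s e z : R) : 0 < s -> e <= s -> layer s (1 - e) z <= expR 1 * layer s 1 z.
Proof.
move=> s0 es; rewrite /layer.
have e1 : 1 <= expR (1 : R) by rewrite -expR0 ler_expR.
rewrite mulrDr mulr1 lerD// mulrA ler_wpM2r ?invr_ge0 ?(ltW s0)// mulrDr lerD//.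
  by rewrite ler_peMl ?expR_ge0.
rewrite -expRD ler_expR -(divff (lt0r_neq0 s0)).
by rewrite -mulrDl ler_wpM2r ?invr_ge0 ?(ltW s0)//; lra.
Qed.

End DiffBound.

Section InteriorContinuity.
Context {R : realType}.
Implicit Types (T L : R) (F G : st R -> R).

Lemma open_cyl T : open (cyl T).
Proof.
have c1 : continuous (fun q : st R => q.1) by move=> q; exact: cvg_fst.
have c2 : continuous (fun q : st R => q.2.2).
  by move=> q; apply: (@cvg_comp _ _ _ snd snd); exact: cvg_snd.
have -> : cyl T = ((fun q : st R => q.1) @^-1` `]0, T[%classic) `&`
                  ((fun q : st R => q.2.2) @^-1` `]0, 1[%classic).
  by apply/seteqP; split => q /=; rewrite !in_itv.
apply: openI.
- by move/continuousP : c1; apply; exact: interval_open.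
- by move/continuousP : c2; apply; exact: interval_open.
Qed.

Lemma cyl_sub T : cyl T `<=` cyl_bar T.
Proof. by move=> q [/andP[/ltW ? /ltW ?] /andP[/ltW ? /ltW ?]]; split; apply/andP. Qed.

Lemma within_cyl_bar_at T G p : {within cyl_bar T, continuous G} -> cyl T p ->
  {for p, continuous G}.
Proof.
move=> cG cp.
have : {within cyl T, continuous G} := continuous_subspaceW (@cyl_sub T) cG.
by rewrite continuous_open_subspace; [apply; rewrite inE|exact: open_cyl].
Qed.

Lemma C1_derive_cont T F i p : C1_cyl T F -> cyl T p -> {for p, continuous ('D_(dir4 i) F)}.
Proof.
move=> CF cp; have [G cG GE] := C1_ext i CF.
have Gp := within_cyl_bar_at cG cp.
have H : 'D_(dir4 i) F q @[q --> p] --> G p.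
  apply: cvg_trans Gp; apply: near_eq_cvg.
  have H : \forall q \near p, cyl T q by apply: open_nbhs_nbhs; split => //; exact: open_cyl.
  by apply: filterS H => q /GE.
by rewrite (GE p cp) in H.
Qed.

Lemma path_cont T F (A : set R) (X : R -> R) (z0 : R) :
  (forall t, A t -> 0 <= t <= T) -> 0 <= z0 <= 1 -> {within cyl_bar T, continuous F} ->
  (forall t, A t -> {for t, continuous X}) ->
  {within A, continuous (fun t => F (stpt t (X t) z0))}.
Proof.
move=> AT hz cF cX; apply/subspace_continuousP => t At.
have cp : (fun t => stpt t (X t) z0) t' @[t' --> within A (nbhs t)]
   --> within (cyl_bar T) (nbhs (stpt t (X t) z0)).
  have c0 : (fun t => stpt t (X t) z0) t' @[t' --> t] --> nbhs (stpt t (X t) z0).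
    exact: (cvg_pair (@cvg_id _ (nbhs t)) (cvg_pair (cvg_pair (cX t At) (cvg_cst (0 : R))) (cvg_cst z0))).
  move=> P wP; have H := c0 _ wP.
  apply: (@filterS _ (nbhs t) _ _ _ _ H) => t' H' At'; apply: H'.
  by split => //; exact: AT.
have /subspace_continuousP/(_ (stpt t (X t) z0))/(_ _)/wrap[] := cF.
  by split => //; exact: AT.
by move=> /(cvg_comp _ _ cp).
Qed.

Lemma slab_cont_time T (V : R -> R) : {within [set t | 0 <= t < T], continuous V} ->
  slab_cont T 1 (fun t _ _ => V t).
Proof.
move=> cV; apply/subspace_continuousP => q [hq _].
have cp : (fun q : R * R * R => q.1.1) q' @[q' --> within (slab T 1) (nbhs q)]
   --> within [set t | 0 <= t < T] (nbhs q.1.1).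
  have c0 : (fun q : R * R * R => q.1.1) q' @[q' --> q] --> nbhs q.1.1.
    by apply: (@cvg_comp _ _ _ fst fst); exact: cvg_fst.
  move=> P wP; have H := c0 _ wP.
  by apply: (@filterS _ (nbhs q) _ _ _ _ H) => q' H' [hq' _]; exact: H'.
have /subspace_continuousP/(_ q.1.1)/(_ _)/wrap[] := cV; first exact: hq.
by move=> /(cvg_comp _ _ cp).
Qed.

(** When [X'] is the horizontal velocity this is the material derivative, and the Euler equation
    says that it equals [f2] along the curve. *)
Lemma is_derive_v2_along T (u : R -> R -> R -> R) (X : R -> R) (X' t z0 : R) :
  C1_cyl T (lift2 u) -> 0 < t < T -> 0 < z0 < 1 -> is_derive t (1:R) X X' ->
  is_derive t (1:R) (fun s => u s (X s) z0)
    (Dt (lift2 u) (stpt t (X t) z0) + Dx (lift2 u) (stpt t (X t) z0) * X').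
Proof.
move=> Cu ht hz dX.
apply: (@is_derive_along _ (fun s y => u s y z0) (fun s y => Dx (lift2 u) (stpt s y z0))).
- apply: (@is_derive_dt _ (lift2 u) t (X t) z0).
  exact: (C1_derivable Cu (cylP (X t) ht hz)).
- apply: (near_itv ht) => s hs x; apply: (@is_derive_dx _ (lift2 u)).
  exact: (C1_derivable Cu (cylP x hs hz)).
- have cD := @C1_derive_cont T _ (Some 0) _ Cu (cylP (X t) ht hz).
  apply: (@cvg_comp _ _ _ (fun q : R * R => stpt q.1 q.2 z0) (Dx (lift2 u)) _
    (nbhs (stpt t (X t) z0))); last exact: cD.
  exact: (cvg_pair (@cvg_fst _ _ (nbhs t) (nbhs (X t)) _)
    (cvg_pair (cvg_pair (@cvg_snd _ _ (nbhs t) (nbhs (X t)) _) (cvg_cst (0 : R))) (cvg_cst z0))).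
Qed.

End InteriorContinuity.

(** * Viscous and inviscid flows *)

Lemma sol_bound {R : realType} (T n1 s M : R) (c : R -> R -> R) (f w : R -> R -> R -> R) :
  0 <= n1 -> 0 < s -> 0 <= M -> sol T n1 (s * s) c f w ->
  (forall t x z, 0 < t < T -> 0 < z < 1 -> `|f t x z| <= M) ->
  (forall x z, 0 <= z <= 1 -> `|w 0 x z| <= M) ->
  forall t x z, 0 <= t < T -> 0 <= z <= 1 -> `|w t x z| <= expR (1 * T) * M.
Proof.
move=> n10 s0 M0 [cw [B wB] ow w0 [K K0 cK]] fM wM.
apply: (@zero_wall_bound R T n1 s K B M (fun t _ z => c t z) w n10 s0 K0 M0) => //.
- by move=> t x z ht hz; exact: cK.
- by move=> t x z ht hz; exists (f t x z); [exact: fM|exact: ow].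
Qed.

Section Flow.
Context {R : realType}.
Variables (T L : R) (a : R -> R) (b : R -> R -> R) (f1 : R -> R -> R) (f2 : R -> R -> R -> R)
  (N : set (R * R)) (u1 : R * R -> R -> R -> R) (u2 : R * R -> R -> R -> R -> R)
  (v1 : R -> R -> R) (v2 : R -> R -> R -> R).
Hypotheses (hT : 0 < T) (hL : 0 < L).
Hypothesis hf : forall j : 'I_3,
  smooth_cyl T (fun q => plane_parallel f1 f2 q.1 q.2 0 j) /\
  forall t, periodic2 L (fun p => plane_parallel f1 f2 t p 0 j).
Hypothesis hN : forall nu, N nu -> 0 < nu.1 /\ 0 < nu.2.
Hypothesis hvisc : forall nu, N nu ->
  viscous_solution T L a b f1 f2 nu.1 nu.2 (u1 nu) (u2 nu).
Hypothesis heuler : euler_solution T L a b f1 f2 v1 v2.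

Lemma plane_parallelE0 (g1 : R -> R -> R) (g2 : R -> R -> R -> R) t p :
  plane_parallel g1 g2 t p 0 0 = g1 t p.2.
Proof. by rewrite mxE. Qed.

Lemma plane_parallelE1 (g1 : R -> R -> R) (g2 : R -> R -> R -> R) t p :
  plane_parallel g1 g2 t p 0 1 = g2 t p.1.1 p.2.
Proof. by rewrite mxE. Qed.

Lemma plane_parallelE2 (g1 : R -> R -> R) (g2 : R -> R -> R -> R) t p :
  plane_parallel g1 g2 t p 0 2 = 0.
Proof. by rewrite mxE. Qed.

Let smooth_f1 : smooth_cyl T (lift2 (fun t _ z => f1 t z)).
Proof.
have [+ _] := hf 0; congr (smooth_cyl T).
by apply/funext => q; rewrite plane_parallelE0.
Qed.

Let smooth_f2 : smooth_cyl T (lift2 f2).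
Proof.
have [+ _] := hf 1; congr (smooth_cyl T).
by apply/funext => q; rewrite plane_parallelE1.
Qed.

Let periodic_f2 t x z : f2 t (x + L) z = f2 t x z.
Proof.
have [_ /(_ t x 0 z)[+ _]] := hf 1.
by rewrite !plane_parallelE1.
Qed.

(** Nothing here refers to a viscosity: [M] bounds the force and the Euler solution, the value of
    which at time [0] is the common initial datum. Every constant below is computed from [M], [T]
    and the distance to the walls. *)
Record data_bound (M : R) : Prop := DataBound {
  db_ge0 : 0 <= M ;
  db_f1 : forall t z z', 0 <= t <= T -> 0 <= z <= 1 -> 0 <= z' <= 1 ->
    `|f1 t z| <= M /\ `|f1 t z' - f1 t z| <= M * `|z' - z| ;
  db_f2 : forall t x x' z z', 0 <= t <= T -> 0 <= z <= 1 -> 0 <= z' <= 1 ->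
    `|f2 t x z| <= M /\ `|f2 t x' z' - f2 t x z| <= M * (`|x' - x| + `|z' - z|) ;
  db_f2xx : forall t x z h k, 0 <= t <= T -> 0 <= z <= 1 -> 0 <= h -> 0 <= k ->
    `|f2 t (x + h + k) z - f2 t (x + h) z - (f2 t (x + k) z - f2 t x z)| <= M * h * k ;
  db_v1 : forall t z z', 0 <= t <= T -> 0 <= z <= 1 -> 0 <= z' <= 1 ->
    `|v1 t z| <= M /\ `|v1 t z' - v1 t z| <= M * `|z' - z| ;
  db_v2 : forall t x x' z z', 0 <= t <= T -> 0 <= z <= 1 -> 0 <= z' <= 1 ->
    `|v2 t x z| <= M /\ `|v2 t x' z' - v2 t x z| <= M * (`|x' - x| + `|z' - z|) ;
  db_v2xx : forall x z h k, 0 <= z <= 1 -> 0 <= h -> 0 <= k ->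
    `|v2 0 (x + h + k) z - v2 0 (x + h) z - (v2 0 (x + k) z - v2 0 x z)| <= M * h * k }.

Let T0T : 0 <= (0:R) <= T. Proof. by rewrite lexx ltW. Qed.

Lemma viscous_initial nu x z : N nu -> 0 <= z <= 1 ->
  u1 nu 0 z = v1 0 z /\ u2 nu 0 x z = v2 0 x z.
Proof.
move=> /hvisc[_ _ _ _ _ _ ic] hz; have [-> ->] := ic x z hz.
by have [-> ->] := euler_ic heuler x hz.
Qed.

(** The Euler solution is only C^1, so that [db_v2xx] is taken from one viscous solution: its second
    [x]-derivative is bounded up to [t = 0], where both flows have the same value. *)
Lemma data_boundP nu : N nu -> exists M, data_bound M.
Proof.
move=> Nnu.
have [M1 M10 H1] := C1_lip hT hL (smooth_C1 smooth_f1) (fun _ _ _ => erefl).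
have [M2 M20 H2] := C1_lip hT hL (smooth_C1 smooth_f2) periodic_f2.
have [M3 M30 H3] := C1_lip (u := fun t _ z => v1 t z) hT hL (euler_reg1 heuler) (fun _ _ _ => erefl).
have [M4 M40 H4] := C1_lip hT hL (euler_reg2 heuler) (euler_periodic heuler).
have [M5 M50 H5] := lift2_second_diff (W := predT) hT hL isT isT smooth_f2 periodic_f2.
have [//|//|M6 M60 H6] := lift2_second_diff hT hL _ _ (visc_reg2 (hvisc Nnu)) (visc_periodic (hvisc Nnu)).
- by rewrite /= /par_order !big_cons big_nil.
- by rewrite /= /par_order !big_cons big_nil.
have le_mul (c m y : R) : 0 <= y -> c <= m * y -> m <= M1 + M2 + M3 + M4 + M5 + M6 ->
    c <= (M1 + M2 + M3 + M4 + M5 + M6) * y.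
  by move=> y0 cm mM; apply: le_trans cm _; exact: ler_wpM2r.
exists (M1 + M2 + M3 + M4 + M5 + M6); split.
- lra.
- move=> t z z' ht hz hz'; have [h1 h2] := H1 t 0 0 z z' ht hz hz'; split; first lra.
  apply: le_mul (normr_ge0 _) _ (_ : M1 <= _); last lra.
  by apply: le_trans h2 _; rewrite subrr normr0 add0r.
- move=> t x x' z z' ht hz hz'; have [h1 h2] := H2 t x x' z z' ht hz hz'; split; first lra.
  by apply: le_mul (addr_ge0 (normr_ge0 _) (normr_ge0 _)) h2 _; lra.
- move=> t x z h k ht hz h0 k0; have := H5 t x z h k ht hz h0 k0.
  by rewrite -!mulrA => h1; apply: le_mul (mulr_ge0 h0 k0) h1 _; lra.
- move=> t z z' ht hz hz'; have [h1 h2] := H3 t 0 0 z z' ht hz hz'; split; first lra.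
  apply: le_mul (normr_ge0 _) _ (_ : M3 <= _); last lra.
  by apply: le_trans h2 _; rewrite subrr normr0 add0r.
- move=> t x x' z z' ht hz hz'; have [h1 h2] := H4 t x x' z z' ht hz hz'; split; first lra.
  by apply: le_mul (addr_ge0 (normr_ge0 _) (normr_ge0 _)) h2 _; lra.
- move=> x z h k hz h0 k0; have := H6 0 x z h k T0T hz h0 k0.
  rewrite -!mulrA => h1; apply: le_mul (mulr_ge0 h0 k0) _ (_ : M6 <= _); last lra.
  apply: le_trans h1; rewrite le_eqVlt; apply/orP; left; apply/eqP; congr `| _ - _ - (_ - _) |.
  + by have [_ ->] := viscous_initial (x + h + k) Nnu hz.
  + by have [_ ->] := viscous_initial (x + h) Nnu hz.
  + by have [_ ->] := viscous_initial (x + k) Nnu hz.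
  + by have [_ ->] := viscous_initial x Nnu hz.
Qed.

Variables (M : R).
Hypothesis hM : data_bound M.
Let M0 := db_ge0 hM.

(** The no-slip condition of the viscous flow, read at time [0], is inherited by the Euler flow
    through the common initial datum. *)
Lemma initial_zero nu x (i : bool) : N nu -> v1 0 (wall_pt i) = 0 /\ v2 0 x (wall_pt i) = 0.
Proof.
move=> Nnu.
have hi : 0 <= (wall_pt i : R) <= 1 by case: i; rewrite /wall_pt /= ?lexx ?ler01.
have [<- <-] := viscous_initial x Nnu hi.
exact: (visc_bc (hvisc Nnu) x i T0T).
Qed.

Lemma initial_lip nu x z : N nu -> 0 <= z <= 1 ->
  [/\ `|v1 0 z| <= M * z, `|v1 0 z| <= M * (1 - z),
      `|v2 0 x z| <= M * z & `|v2 0 x z| <= M * (1 - z)].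
Proof.
move=> Nnu hz; have [z0 z1] := andP hz.
have z1' : 0 <= 1 - z by rewrite subr_ge0.
have [a0 b0] := initial_zero x false Nnu; have [a1 b1] := initial_zero x true Nnu.
rewrite /wall_pt/= in a0 b0 a1 b1.
have h0 : 0 <= (0 : R) <= 1 by rewrite lexx ler01.
have h1 : 0 <= (1 : R) <= 1 by rewrite lexx ler01.
have [_] := db_v1 hM T0T h0 hz; rewrite a0 !subr0 (ger0_norm z0) => ->.
have [_] := db_v1 hM T0T h1 hz; rewrite a1 !subr0 (distrC z) (ger0_norm z1') => ->.
have [_] := db_v2 hM x x T0T h0 hz; rewrite b0 subrr normr0 add0r !subr0 (ger0_norm z0) => ->.
have [_] := db_v2 hM x x T0T h1 hz.
by rewrite b1 subrr normr0 add0r subr0 (distrC z) (ger0_norm z1') => ->.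
Qed.

Section Viscous.
Variable nu : R * R.
Hypothesis Nnu : N nu.
Let hv := hvisc Nnu.
Let s := Num.sqrt nu.2.
Let n0 : 0 < nu.1 /\ 0 < nu.2. Proof. exact: hN. Qed.
Let s0 : 0 < s. Proof. by rewrite sqrtr_gt0; case: n0. Qed.
Let ss : s * s = nu.2. Proof. by rewrite -expr2 sqr_sqrtr// ltW//; case: n0. Qed.
Let n10 : 0 <= nu.1. Proof. by case: n0 => /ltW. Qed.

(** Viewed as constant in [x], [u1] is given zero drift and zero horizontal diffusion, so that the
    estimates for [u2] apply to it verbatim. *)
Lemma sol_u1 : sol T 0 (s * s) (fun _ _ => 0) (fun t _ z => f1 t z) (fun t _ z => u1 nu t z).
Proof.
have C1 := C12_C1 (visc_reg1 hv).
split.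
- by apply: lift2_slab_cont; exact: (C1_cont C1).
- have [B _ hB] := C1_lip (u := fun t _ z => u1 nu t z) hT hL C1 (fun _ _ _ => erefl).
  exists B => t x z /andP[t0 /ltW tT] hz.
  by have [] := hB t 0 0 z z (introT andP (conj t0 tT)) hz hz.
- move=> t x z ht hz; 
  rewrite -[f1 t z]/(lift1 f1 (stpt t x z)) -(visc_eq1 hv (cylP x ht hz)) -ss.
  exact: C12_parop1 (visc_reg1 hv) ht hz.
- move=> t x /andP[t0 /ltW tT]; have ht : 0 <= t <= T by rewrite t0.
  have [-> _] := visc_bc hv x false ht.
  by have [-> _] := visc_bc hv x true ht.
- by exists 0 => // *; rewrite normr0.
Qed.

Lemma sol_u2 : sol T nu.1 (s * s) (u1 nu) f2 (u2 nu).
Proof.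
have C1 := C12_C1 (visc_reg2 hv).
split.
- by apply: lift2_slab_cont; exact: (C1_cont C1).
- have [B _ hB] := C1_lip hT hL C1 (visc_periodic hv).
  exists B => t x z /andP[t0 /ltW tT] hz.
  by have [] := hB t x 0 z z (introT andP (conj t0 tT)) hz hz.
- move=> t x z ht hz; 
  rewrite -[f2 t x z]/(lift2 f2 (stpt t x z)) -(visc_eq2 hv (cylP x ht hz)) -ss.
  exact: C12_parop (visc_reg2 hv) ht hz.
- move=> t x /andP[t0 /ltW tT]; have ht : 0 <= t <= T by rewrite t0.
  have [_ ->] := visc_bc hv x false ht.
  by have [_ ->] := visc_bc hv x true ht.
- have [B hB] := sol_bdd sol_u1; exists `|B| => // t z /andP[t0 tT] /andP[z0 z1].
  by apply: le_trans (hB t 0 z _ _) (ler_norm _); rewrite ?(ltW t0) ?(ltW z0) ?(ltW z1).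
Qed.

Lemma u1_bound t z : 0 <= t < T -> 0 <= z <= 1 -> `|u1 nu t z| <= expR (1 * T) * M.
Proof.
move=> ht hz; apply: (sol_bound (lexx 0) s0 M0 sol_u1 _ _ 0 ht hz).
- move=> t' _ z' /andP[/ltW t0 /ltW t1] /andP[/ltW z0 /ltW z1].
  have ht' : 0 <= t' <= T by rewrite t0 t1.
  have hz' : 0 <= z' <= 1 by rewrite z0 z1.
  by have [] := db_f1 hM ht' hz' hz'.
- move=> _ z' hz'; have [-> _] := viscous_initial 0 Nnu hz'.
  by have [] := db_v1 hM T0T hz' hz'.
Qed.

Lemma u2_bound t x z : 0 <= t < T -> 0 <= z <= 1 -> `|u2 nu t x z| <= expR (1 * T) * M.
Proof.
move=> ht hz; apply: (sol_bound n10 s0 M0 sol_u2 _ _ x ht hz).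
- move=> t' x' z' /andP[/ltW t0 /ltW t1] /andP[/ltW z0 /ltW z1].
  have ht' : 0 <= t' <= T by rewrite t0 t1.
  have hz' : 0 <= z' <= 1 by rewrite z0 z1.
  by have [] := db_f2 hM x' x' ht' hz' hz'.
- move=> x' z' hz'; have [_ ->] := viscous_initial x' Nnu hz'.
  by have [] := db_v2 hM x' x' T0T hz' hz'.
Qed.

Hypothesis nu2_le1 : nu.2 <= 1.
Let s1 : s <= 1. Proof. by rewrite -sqrtr1 ler_wsqrtr. Qed.

Let tT_cc t : 0 < t < T -> 0 <= t <= T.
Proof. by move=> /andP[/ltW -> /ltW ->]. Qed.
Let z01_cc (z : R) : 0 < z < 1 -> 0 <= z <= 1.
Proof. by move=> /andP[/ltW -> /ltW ->]. Qed.
Let tT_co t : 0 < t < T -> 0 <= t < T.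
Proof. by move=> /andP[/ltW -> ->]. Qed.

Lemma u2_xdiff h t x z : 0 <= h -> 0 <= t < T -> 0 <= z <= 1 ->
  `|u2 nu t (x + h) z - u2 nu t x z| <= expR (1 * T) * (M * h).
Proof.
move=> h0 ht hz; apply: (sol_xdiff n10 s0 sol_u2 M0 h0) => // {ht hz}.
- move=> t' x' z' /tT_cc ht /z01_cc hz; have [_] := db_f2 hM x' (x' + h) ht hz hz.
  by rewrite subrr normr0 addr0 (addrAC x') subrr add0r (ger0_norm h0).
- move=> x' z' hz.
  have [_ ->] := viscous_initial (x' + h) Nnu hz; have [_ ->] := viscous_initial x' Nnu hz.
  have [_] := db_v2 hM x' (x' + h) T0T hz hz.
  by rewrite subrr normr0 addr0 (addrAC x') subrr add0r (ger0_norm h0).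
Qed.

Lemma u2_dx t x z : 0 < t < T -> 0 < z < 1 ->
  is_derive x (1:R) (fun y => u2 nu t y z) (Dx (lift2 (u2 nu)) (stpt t x z)).
Proof.
move=> ht hz; apply: (@is_derive_dx _ (lift2 (u2 nu))).
exact: (C1_derivable (C12_C1 (visc_reg2 hv)) (cylP x ht hz)).
Qed.

Lemma u2_dx_bound t x z : 0 < t < T -> 0 < z < 1 ->
  `|Dx (lift2 (u2 nu)) (stpt t x z)| <= expR (1 * T) * M.
Proof.
move=> ht hz; apply: (derive_le_bound ltr01 (u2_dx x ht hz)) => e /andP[/ltW e0 _].
rewrite -mulrA; apply: u2_xdiff => //; [exact: tT_co|exact: z01_cc].
Qed.

(** The second differences of [u2] obey a bound uniform in the viscosities. This equicontinuity in
    [x] lets the convergence of [u2] pass to its [x]-derivative. *)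
Lemma u2_dx_lip t x z k : 0 <= k -> 0 < t < T -> 0 < z < 1 ->
  `|Dx (lift2 (u2 nu)) (stpt t (x + k) z) - Dx (lift2 (u2 nu)) (stpt t x z)| <=
    expR (1 * T) * M * k.
Proof.
move=> k0 ht hz.
have d : is_derive x (1:R) (fun y => u2 nu t (y + k) z - u2 nu t y z)
    (Dx (lift2 (u2 nu)) (stpt t (x + k) z) - Dx (lift2 (u2 nu)) (stpt t x z)).
  apply: isdD; last by apply: isdN; exact: u2_dx.
  by apply: (@isd_shift _ (fun y => u2 nu t y z)); exact: u2_dx.
apply: (derive_le_bound ltr01 d) => e /andP[/ltW e0 _].
rewrite -!mulrA (mulrC k) (mulrA M).
apply: (sol_xdiff2 n10 s0 sol_u2 M0 e0 k0); [| |exact: tT_co|exact: z01_cc].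
- by move=> t' x' z' /tT_cc ht' /z01_cc hz'; exact: (db_f2xx hM).
- move=> x' z' hz'.
  have [_ ->] := viscous_initial (x' + e + k) Nnu hz'.
  have [_ ->] := viscous_initial (x' + e) Nnu hz'.
  have [_ ->] := viscous_initial (x' + k) Nnu hz'.
  have [_ ->] := viscous_initial x' Nnu hz'.
  exact: (db_v2xx hM).
Qed.

(** [CA] and [CB] are the constant of [sol_zdiff] for [u1], with [Kc = Mx = 0], and for [u2], with
    [Kc = CA] and [Mx] the bound of [u2_dx_bound]. *)
Definition CA := expR (2 * T) * (M + expR (1 * T) * (2 * M)).
Definition CB := expR (2 * T) * (M + CA * (expR (1 * T) * M) + expR (1 * T) * (2 * M)).

Lemma CA_ge0 : 0 <= CA.
Proof. by rewrite /CA mulr_ge0 ?expR_ge0// addr_ge0// mulr_ge0 ?expR_ge0// mulr_ge0. Qed.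

Let hzz (z h : R) : 0 < h -> 0 <= z <= 1 - h -> 0 <= z <= 1.
Proof. by move=> ? /andP[? ?]; apply/andP; split; lra. Qed.
Let hzh (z h : R) : 0 < h -> 0 <= z <= 1 - h -> 0 <= z + h <= 1.
Proof. by move=> ? /andP[? ?]; apply/andP; split; lra. Qed.

Lemma u1_zdiff h t z : 0 < h < 1 -> 0 <= t < T -> 0 <= z <= 1 - h ->
  `|u1 nu t (z + h) - u1 nu t z| <= CA * h * layer s (1 - h) z.
Proof.
move=> hh ht hz; have [h0 h1] := andP hh.
have := sol_zdiff (lexx 0) s0 s1 sol_u1 M0 (lexx 0) (lexx 0) hh (wx := fun _ _ _ => 0).
move=> /(_ _ _ _ _ _ _ t 0 z ht hz)/wrap[].
- by move=> t' x' z' _ _; rewrite normr0; split; [exact: isd_cst|exact: lexx].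
- by move=> t' x z' /tT_cc ht' /z01_cc hz'; have [] := db_f1 hM ht' hz' hz'.
- move=> t' x z' /tT_cc ht' /andP[/ltW z0 /ltW z1].
  have hz' : 0 <= z' <= 1 - h by rewrite z0.
  have [_] := db_f1 hM ht' (hzz h0 hz') (hzh h0 hz').
  by rewrite (addrAC z') subrr add0r (gtr0_norm h0).
- by move=> *; rewrite subrr normr0 !mul0r.
- move=> x z' hz'; have [-> _] := viscous_initial x Nnu hz'.
  by have [] := initial_lip x Nnu hz'.
- move=> x z' hz'.
  have [-> _] := viscous_initial x Nnu (hzz h0 hz').
  have [-> _] := viscous_initial x Nnu (hzh h0 hz').
  have [_] := db_v1 hM T0T (hzz h0 hz') (hzh h0 hz').
  by rewrite (addrAC z') subrr add0r (gtr0_norm h0).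
- by rewrite mulr0 addr0 /CA -!mulrA.
Qed.

(** The drift of [u2] is [u1], and [u1_zdiff] bounds its variation in exactly the form that
    [sol_zdiff] asks of the coefficient; this is why that hypothesis carries the factor [layer]. *)
Lemma u2_zdiff h t x z : 0 < h < 1 -> 0 <= t < T -> 0 <= z <= 1 - h ->
  `|u2 nu t x (z + h) - u2 nu t x z| <= CB * h * layer s (1 - h) z.
Proof.
move=> hh ht hz; have [h0 h1] := andP hh.
have EM0 : 0 <= expR (1 * T) * M by rewrite mulr_ge0 ?expR_ge0.
have := sol_zdiff n10 s0 s1 sol_u2 M0 CA_ge0 EM0 hh
  (wx := fun t x z => Dx (lift2 (u2 nu)) (stpt t x z)).
move=> /(_ _ _ _ _ _ _ t x z ht hz)/wrap[].
- by move=> t' x' z' ht' hz'; split; [exact: u2_dx|exact: u2_dx_bound].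
- by move=> t' x' z' /tT_cc ht' /z01_cc hz'; have [] := db_f2 hM x' x' ht' hz' hz'.
- move=> t' x' z' /tT_cc ht' /andP[/ltW z0 /ltW z1].
  have hz' : 0 <= z' <= 1 - h by rewrite z0.
  have [_] := db_f2 hM x' x' ht' (hzz h0 hz') (hzh h0 hz').
  by rewrite subrr normr0 add0r (addrAC z') subrr add0r (gtr0_norm h0).
- move=> t' z' /tT_co ht' /andP[/ltW z0 /ltW z1].
  by apply: u1_zdiff => //; rewrite z0.
- move=> x' z' hz'; have [_ ->] := viscous_initial x' Nnu hz'.
  by have [] := initial_lip x' Nnu hz'.
- move=> x' z' hz'.
  have [_ ->] := viscous_initial x' Nnu (hzz h0 hz').
  have [_ ->] := viscous_initial x' Nnu (hzh h0 hz').
  have [_] := db_v2 hM x' x' T0T (hzz h0 hz') (hzh h0 hz').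
  by rewrite subrr normr0 add0r (addrAC z') subrr add0r (gtr0_norm h0).
- move=> H; apply: le_trans H _; rewrite /CB; rewrite le_eqVlt; apply/orP; left; apply/eqP; ring.
Qed.

(** The step of the quotient is kept below [s], for the sake of [layer_le], and below [1 - z], to
    stay in the channel. *)
Let zdiff_dz (h : R -> R) (z d C : R) : 0 <= C -> 0 < z < 1 -> is_derive z (1:R) h d ->
  (forall e, 0 < e < 1 -> 0 <= z <= 1 - e -> `|h (z + e) - h z| <= C * e * layer s (1 - e) z) ->
  `|d| <= C * (expR 1 * layer s 1 z).
Proof.
move=> C0 /andP[z0 z1] dh H.
have r0 : 0 < Num.min s (1 - z) by rewrite lt_min s0 subr_gt0.
apply: (derive_le_bound r0 dh) => e /andP[e0]; rewrite lt_min => /andP[es ez].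
have he : 0 < e < 1 by apply/andP; split; lra.
have hz : 0 <= z <= 1 - e by apply/andP; split; lra.
apply: le_trans (H e he hz) _; rewrite mulrAC ler_wpM2r ?(ltW e0)// ler_wpM2l//.
exact: layer_le (ltW es).
Qed.

Lemma u1_dz_bound t x z : 0 < t < T -> 0 < z < 1 ->
  `|Dz (lift1 (u1 nu)) (stpt t x z)| <= CA * (expR 1 * layer s 1 z).
Proof.
move=> ht hz; apply: (zdiff_dz (h := fun z => u1 nu t z) CA_ge0 hz).
  apply: (@is_derive_dz _ (lift1 (u1 nu)) t x z).
  exact: (C1_derivable (C12_C1 (visc_reg1 hv)) (cylP x ht hz)).
by move=> e he hze; apply: u1_zdiff => //; exact: tT_co.
Qed.

Lemma CB_ge0 : 0 <= CB.
Proof.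
apply: mulr_ge0; first exact: expR_ge0.
apply: addr_ge0; last by rewrite mulr_ge0 ?expR_ge0// mulr_ge0.
by rewrite addr_ge0// mulr_ge0 ?CA_ge0// mulr_ge0 ?expR_ge0.
Qed.

Lemma u2_dz_bound t x z : 0 < t < T -> 0 < z < 1 ->
  `|Dz (lift2 (u2 nu)) (stpt t x z)| <= CB * (expR 1 * layer s 1 z).
Proof.
move=> ht hz; apply: (zdiff_dz (h := fun z => u2 nu t x z) CB_ge0 hz).
  apply: (@is_derive_dz _ (lift2 (u2 nu)) t x z).
  exact: (C1_derivable (C12_C1 (visc_reg2 hv)) (cylP x ht hz)).
by move=> e he hze; apply: u2_zdiff => //; exact: tT_co.
Qed.

Definition CZ (d : R) := expR (1 * T) * (M + M / (d * d)) * (2 + 2 * T).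

Lemma CZ_ge0 d : 0 <= CZ d.
Proof.
apply: mulr_ge0; last by rewrite addr_ge0// mulr_ge0// ltW.
by apply: mulr_ge0; rewrite ?expR_ge0// addr_ge0// divr_ge0// sq_ge0.
Qed.

(** Without drift the barrier is centred on the constant curve [0]. The heights [z] and [z0] are
    kept distinct because the estimate is also the drift hypothesis of [sol_frozen] for [u2], with
    offset [s]. *)
Lemma u1_frozen d z0 t z : 0 < d -> d <= z0 -> d <= 1 - z0 -> 0 <= t < T -> 0 <= z <= 1 ->
  `|u1 nu t z - v1 t z0| <= CZ d * (`|z - z0| + s).
Proof.
move=> d0 dz0 dz1 ht hz.
have hz0 : 0 < z0 < 1 by apply/andP; split; lra.
have hz0c := z01_cc hz0.
(* With the larger of the two lengths as width, [(z - z0)^2 / e] and [s^2 / e] are bounded by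
   [|z - z0|] and [s]. *)
pose e := Num.max `|z - z0| s.
have e0 : 0 < e by rewrite lt_max s0 orbT.
have e1 : e <= 1.
  by rewrite ge_max s1 andbT ler_norml; move: (hz) => /andP[? ?]; apply/andP; split; lra.
have he : 0 < e <= 1 by rewrite e0.
have cV : slab_cont T 1 (fun t _ _ => v1 t z0).
  apply: slab_cont_time.
  apply: (@path_cont _ T (lift1 v1) _ (fun _ => 0) z0) => //.
  - by move=> t' /andP[-> /ltW].
  - by case: (euler_reg1 heuler).
  - by move=> t' _; exact: cvg_cst.
have dV t' : 0 < t' < T -> is_derive t' (1:R) (fun t => v1 t z0) (f1 t' z0).
  move=> ht'; rewrite -[f1 t' z0]/(lift1 f1 (stpt t' 0 z0)) -(euler_eq1 heuler (cylP 0 ht' hz0)).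
  apply: (@is_derive_dt _ (lift1 v1) t' 0 z0).
  exact: (C1_derivable (euler_reg1 heuler) (cylP 0 ht' hz0)).
have cX (t' : R) : 0 <= t' < T -> {for t', continuous (fun _ : R => 0 : R)}.
  by move=> _; exact: cvg_cst.
have dX (t' : R) : 0 < t' < T -> is_derive t' (1:R) (fun _ : R => 0 : R) 0.
  by move=> _; exact: isd_cst.
have := sol_frozen (lexx 0) s0 sol_u1 M0 (lexx 0) d0 dz0 dz1 he (X := fun _ => 0)
  (X' := fun _ => 0) (sg := 0) cX dX cV dV.
move=> /(_ _ _ _ _ t 0 z ht hz)/wrap[].
- move=> t' x' z' /tT_cc ht' /z01_cc hz'; have [_ h] := db_f1 hM ht' hz0c hz'.
  by apply: le_trans h _; rewrite ler_wpM2l// lerDr.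
- by move=> t' z' _ _; rewrite subrr normr0 mul0r.
- move=> x' z' hz'; have [_ h] := db_v1 hM T0T hz0c hz'.
  have [-> _] := viscous_initial x' Nnu hz'.
  by apply: le_trans h _; rewrite ler_wpM2l// lerDr.
- move=> t' /andP[t0 /ltW tT]; have ht' : 0 <= t' <= T by rewrite t0.
  by have [] := db_v1 hM ht' hz0c hz0c.
move=> H; apply: le_trans H _.
rewrite /CZ !mulr0 add0r -[leRHS]mulrA ler_wpM2l//.
  by rewrite mulr_ge0 ?expR_ge0// addr_ge0// divr_ge0// sq_ge0.
have zz : (z - z0) * (z - z0) / e <= `|z - z0|.
  have -> : (z - z0) * (z - z0) = `|z - z0| * `|z - z0|.
    by rewrite -normrM ger0_norm// sq_ge0.
  by rewrite ler_pdivrMr// ler_wpM2l// le_max lexx.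
have se : (s * s) / e <= s by rewrite ler_pdivrMr// ler_wpM2l ?(ltW s0)// le_max lexx orbT.
have eb : e <= `|z - z0| + s.
  by rewrite ge_max lerDl (ltW s0)/= lerDr.
have : 0 <= T * (s - s * s / e) by rewrite mulr_ge0 ?subr_ge0// ltW.
have : 0 <= T * `|z - z0| by rewrite mulr_ge0// ltW.
rewrite subrr mul0r !add0r; have := normr_ge0 (z - z0).
move: zz se eb; move: (`|z - z0|) (s * s) => y q.
rewrite -[2 * q / e]mulrA; move: (q / e) (_ / e) => w' w''.
have := ltW s0; move: s => s'; lra.
Qed.

Definition CY (d : R) := let K := CZ d in
  expR ((2 * K + 1) * T) * (M + M / (d * d)) * (1 + T * (K + 2)).

(** The characteristic is made to pass through the point under study, where the quadratic vanishes.
    There remain the width and the viscous error divided by it. *)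
Lemma u2_frozen d z0 t x : 0 < d -> d <= z0 -> d <= 1 - z0 -> 0 < t < T ->
  nu.1 + nu.2 <= 1 ->
  `|u2 nu t x z0 - v2 t x z0| <= CY d * Num.sqrt (nu.1 + nu.2).
Proof.
move=> d0 dz0 dz1 ht n1.
have hz0 : 0 < z0 < 1 by apply/andP; split; lra.
have hz0c := z01_cc hz0.
(* This width balances [e] against an error of order [(nu1 + nu3) / e]. *)
pose e := Num.sqrt (nu.1 + nu.2).
have n_gt0 : 0 < nu.1 + nu.2 by case: n0 => ? ?; exact: addr_gt0.
have e0 : 0 < e by rewrite sqrtr_gt0.
have e1 : e <= 1 by rewrite -sqrtr1 ler_wsqrtr.
have he : 0 < e <= 1 by rewrite e0.
have cv : {within [set t | 0 <= t <= T], continuous (fun t => v1 t z0)}.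
  apply: (@path_cont _ T (lift1 v1) _ (fun _ => 0) z0) => //.
  - by case: (euler_reg1 heuler).
  - by move=> t' _; exact: cvg_cst.
have [X [X1 cX dX]] := primitive_exists t x hT cv.
have cV : slab_cont T 1 (fun t _ _ => v2 t (X t) z0).
  apply: slab_cont_time.
  apply: (@path_cont _ T (lift2 v2) _ X z0) => //.
  - by move=> t' /andP[-> /ltW].
  - by case: (euler_reg2 heuler).
have dV t' : 0 < t' < T -> is_derive t' (1:R) (fun t => v2 t (X t) z0) (f2 t' (X t') z0).
  move=> ht'; rewrite -[f2 t' (X t') z0]/(lift2 f2 (stpt t' (X t') z0)).
  rewrite -(euler_eq2 heuler (cylP (X t') ht' hz0)) (mulrC (lift1 _ _)).
  exact: (is_derive_v2_along (euler_reg2 heuler) ht' hz0 (dX t' ht')).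
have := sol_frozen n10 s0 sol_u2 M0 (CZ_ge0 d) d0 dz0 dz1 he (sg := s) cX dX cV dV.
move=> /(_ _ _ _ _ t x z0 (tT_co ht) hz0c)/wrap[].
- move=> t' x' z' /tT_cc ht' /z01_cc hz'.
  by have [_ h] := db_f2 hM (X t') x' ht' hz0c hz'.
- by move=> t' z' /tT_co ht' /z01_cc hz'; exact: u1_frozen.
- move=> x' z' hz'; have [_ h] := db_v2 hM (X 0) x' T0T hz0c hz'.
  by have [_ ->] := viscous_initial x' Nnu hz'.
- move=> t' /andP[t0 /ltW tT]; have ht' : 0 <= t' <= T by rewrite t0.
  by have [] := db_v2 hM (X t') (X t') ht' hz0c hz0c.
rewrite X1 => H; apply: le_trans H _.
have ee : e * e = nu.1 + nu.2 by rewrite -expr2 sqr_sqrtr// ltW.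
have nle : (CZ d * (s * s) + 2 * (nu.1 + s * s)) / e <= (CZ d + 2) * e.
  have -> : (CZ d + 2) * e = (CZ d + 2) * (nu.1 + nu.2) / e.
    by rewrite -ee mulrA mulfK// gt_eqF.
  rewrite ler_wpM2r ?invr_ge0 ?(ltW e0)// ss [leRHS]mulrDl lerD2r ler_wpM2l ?CZ_ge0// lerDr.
  exact: n10.
rewrite /CY -/e !subrr !mul0r addr0 mul0r add0r.
rewrite -[leRHS]mulrA ler_wpM2l//.
  by rewrite mulr_ge0 ?expR_ge0// addr_ge0// divr_ge0// sq_ge0.
rewrite [leRHS]mulrDl mul1r lerD2l -mulrA ler_wpM2l// ltW//.
Qed.

End Viscous.

(** * Pointwise convergence inside the channel *)

Section VanishingViscosity.
Variable nu_ : nat -> R * R.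
Hypothesis Nnu_ : forall n, N (nu_ n).
Hypothesis nu_1 : (nu_ n).1 @[n --> \oo] --> (0 : R).
Hypothesis nu_2 : (nu_ n).2 @[n --> \oo] --> (0 : R).

Lemma near_nu_le e : 0 < e -> \forall n \near \oo, (nu_ n).1 <= e /\ (nu_ n).2 <= e.
Proof.
move=> e0; near=> n; split; near: n; apply: (cvgr_le (0 : R)) => //.
Unshelve. all: by end_near. Qed.

Let cvg_le (w g : nat -> R) (l : R) : (\forall n \near \oo, `|w n - l| <= g n) ->
  g n @[n --> \oo] --> 0 -> w n @[n --> \oo] --> l.
Proof.
move=> wg g0; apply/cvgrPdist_le => e e0; near=> n.
rewrite distrC; apply: (@le_trans _ _ (g n)); first by near: n.
by near: n; apply: (cvgr_le (0 : R)).
Unshelve. all: by end_near. Qed.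

Let cvg_sqrt0 (g : nat -> R) (c : R) : g n @[n --> \oo] --> (0 : R) ->
  c * Num.sqrt (g n) @[n --> \oo] --> (0 : R).
Proof.
move=> g0; rewrite -(mulr0 c); apply: cvgM; first exact: cvg_cst.
rewrite -(@sqrtr0 R); apply: (@cvg_comp _ _ _ g Num.sqrt); first exact: g0.
exact: sqrt_continuous.
Qed.

Lemma cvg_u1 t z : 0 < t < T -> 0 < z < 1 -> u1 (nu_ n) t z @[n --> \oo] --> v1 t z.
Proof.
move=> /andP[t0 tT] hz; have [z0 z1] := andP hz.
pose d := Num.min z (1 - z).
have d0 : 0 < d by rewrite lt_min z0 subr_gt0.
have dz : d <= z by rewrite ge_min lexx.
have dz1 : d <= 1 - z by rewrite ge_min lexx orbT.
apply: cvg_le (cvg_sqrt0 (CZ d) nu_2); near=> n.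
have [n1 n2] : (nu_ n).1 <= 1 /\ (nu_ n).2 <= 1 by near: n; exact: near_nu_le.
have hz' : 0 <= z <= 1 by rewrite !ltW.
have := u1_frozen (Nnu_ n) n2 d0 dz dz1 (introT andP (conj (ltW t0) tT)) hz'.
by rewrite subrr normr0 add0r.
Unshelve. all: by end_near. Qed.

Lemma cvg_u2 t x z : 0 < t < T -> 0 < z < 1 -> u2 (nu_ n) t x z @[n --> \oo] --> v2 t x z.
Proof.
move=> ht hz; have [z0 z1] := andP hz.
pose d := Num.min z (1 - z).
have d0 : 0 < d by rewrite lt_min z0 subr_gt0.
have dz : d <= z by rewrite ge_min lexx.
have dz1 : d <= 1 - z by rewrite ge_min lexx orbT.
have n12 : (nu_ n).1 + (nu_ n).2 @[n --> \oo] --> (0 : R).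
  by rewrite -[X in _ --> X](addr0 (0:R)); exact: cvgD.
apply: cvg_le (cvg_sqrt0 (CY d) n12); near=> n.
have [n1 n2] : (nu_ n).1 <= 1 / 2 /\ (nu_ n).2 <= 1 / 2 by near: n; apply: near_nu_le.
by apply: u2_frozen => //; lra.
Unshelve. all: by end_near. Qed.

(** The derivative is compared with a difference quotient of fixed step [k]. The quotients converge
    because [u2] does, and the quotient of [u2] is its derivative at some [xi] in [[x, x + k]],
    close to that at [x] uniformly in [n] by [u2_dx_lip]. *)
Lemma cvg_u2_dx t x z : 0 < t < T -> 0 < z < 1 ->
  Dx (lift2 (u2 (nu_ n))) (stpt t x z) @[n --> \oo] --> Dx (lift2 v2) (stpt t x z).
Proof.
move=> ht hz.
have dv : is_derive x (1:R) (fun y => v2 t y z) (Dx (lift2 v2) (stpt t x z)).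
  apply: (@is_derive_dx _ (lift2 v2)).
  exact: (C1_derivable (euler_reg2 heuler) (cylP x ht hz)).
apply/cvgrPdist_le => e e0.
(* One share is for the quotient of [v2], two for the values of [u2] at [x] and [x + k], and one for
   moving from [xi] to [x]. *)
pose e' := e / 4.
have e'0 : 0 < e' by rewrite divr_gt0.
have EM : 0 <= expR (1 * T) * M by rewrite mulr_ge0 ?expR_ge0.
have : \forall k \near (0 : R)^'+, `|Dx (lift2 v2) (stpt t x z) - k^-1 * (v2 t (x + k) z - v2 t x z)| <= e'.
  have := is_derive_cvg dv => /cvgrPdist_le/(_ _ e'0).
  move=> [r r0 H]; exists r => // k rk k0; apply: H => //; rewrite gt_eqF//.
move=> near_k.
near (0 : R)^'+ => k.
have k0 : 0 < k by [].
have vk : `|Dx (lift2 v2) (stpt t x z) - k^-1 * (v2 t (x + k) z - v2 t x z)| <= e' by near: k.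
have kM : expR (1 * T) * M * k <= e'.
  have : k <= e' / (expR (1 * T) * M + 1) by near: k; apply: nbhs_right_le; rewrite divr_gt0// ltr_wpDl.
  rewrite ler_pdivlMr ?ltr_wpDl// => kk; apply: le_trans kk.
  by rewrite mulrC ler_wpM2l ?(ltW k0)// lerDl.
have ke0 : 0 < k * e' by rewrite mulr_gt0.
near=> n.
have ux : `|v2 t x z - u2 (nu_ n) t x z| <= k * e'.
  by near: n; have /cvgrPdist_le := @cvg_u2 t x z ht hz; apply.
have uxk : `|v2 t (x + k) z - u2 (nu_ n) t (x + k) z| <= k * e'.
  by near: n; have /cvgrPdist_le := @cvg_u2 t (x + k) z ht hz; apply.
have xk : x <= x + k by rewrite lerDl ltW.
have [|xi + E] := @MVT_segment R (fun y => u2 (nu_ n) t y z)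
    (fun y => Dx (lift2 (u2 (nu_ n))) (stpt t y z)) _ _ xk (fun y _ => u2_dx (Nnu_ n) y ht hz).
  by apply: derivable_within_continuous => y _; case: (u2_dx (Nnu_ n) y ht hz).
rewrite in_itv/= => /andP[xi1 xi2].
have uxi : `|Dx (lift2 (u2 (nu_ n))) (stpt t xi z) - Dx (lift2 (u2 (nu_ n))) (stpt t x z)| <= e'.
  have xi0 : 0 <= xi - x by rewrite subr_ge0.
  have := u2_dx_lip (Nnu_ n) x xi0 ht hz; rewrite (addrC x) subrK => H.
  apply: le_trans H _; apply: le_trans kM; rewrite ler_wpM2l//; lra.
have E' : Dx (lift2 (u2 (nu_ n))) (stpt t xi z) = k^-1 * (u2 (nu_ n) t (x + k) z - u2 (nu_ n) t x z).
  by rewrite E (addrAC x) subrr add0r mulrCA mulVf ?mulr1// gt_eqF.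
have : `|k^-1 * (v2 t (x + k) z - v2 t x z) - Dx (lift2 (u2 (nu_ n))) (stpt t xi z)| <= e' + e'.
  rewrite E' -mulrBr normrM (gtr0_norm (_ : 0 < k^-1)) ?invr_gt0//.
  rewrite mulrC ler_pdivrMr//.
  have -> : v2 t (x + k) z - v2 t x z - (u2 (nu_ n) t (x + k) z - u2 (nu_ n) t x z) =
    (v2 t (x + k) z - u2 (nu_ n) t (x + k) z) - (v2 t x z - u2 (nu_ n) t x z) by ring.
  apply: le_trans (ler_normB _ _) _; rewrite mulrDl (mulrC e').
  exact: lerD.
move: vk uxi; rewrite /e' !ler_norml.
by move=> /andP[? ?] /andP[? ?] /andP[? ?]; apply/andP; split; lra.
Unshelve. all: by end_near. Qed.

End VanishingViscosity.

End Flow.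

(** * Charges and densities *)

Section BorelBoxes.
Context {R : realType}.

Lemma measurable_box (A B C : set R) : measurable A -> measurable B -> measurable C ->
  measurable ((A `*` B) `*` C : set (mpt R)).
Proof. by move=> mA mB mC; apply: measurableX => //; exact: measurableX. Qed.

(** The topology and the product sigma-algebra of [R * R * R] are built separately. An open set is a
    union of countably many boxes with rational centres and radii [1 / (n + 1)], each of which is
    measurable. *)
Lemma open_measurable_pt (O : set (pt R)) : open O -> measurable (O : set (mpt R)).
Proof.
move=> oO.
pose box (a b c : rat) (n : nat) : set (pt R) :=
  (ball (ratr a : R) n.+1%:R^-1 `*` ball (ratr b : R) n.+1%:R^-1) `*` ball (ratr c : R) n.+1%:R^-1.
have mbox a b c n : measurable (box a b c n : set (mpt R)).
  by apply: measurable_box; exact: measurable_ball.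
have -> : (O : set (mpt R)) = \bigcup_(a : rat) \bigcup_(b : rat) \bigcup_(c : rat) \bigcup_n
    (if `[< box a b c n `<=` O >] then box a b c n else set0).
  apply/seteqP; split => [[[x y] z] Op|p [a _ [b _ [c _ [n _]]]]]; last first.
    by case: ifPn => // /asboolP; apply.
  have /nbhs_ballP[e /= e0 eO] : nbhs (x, y, z) O by exact: open_nbhs_nbhs.
  have [n ne] : exists n : nat, n.+1%:R^-1 < e / 2.
    exists (Num.trunc (e / 2)^-1).
    rewrite invf_plt ?posrE ?divr_gt0//.
    by rewrite truncnS_gt.
  have rat_near (w : R) : exists q : rat, `|ratr q - w| < n.+1%:R^-1.
    have [|q] := @rat_in_itvoo R (w - n.+1%:R^-1) (w + n.+1%:R^-1).
      by rewrite ltrBlDr -addrA ltrDl addr_gt0// invr_gt0.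
    rewrite in_itv/= => /andP[q1 q2]; exists q.
    by rewrite ltr_norml ltrBrDl q1 ltrBlDl q2.
  have [a ax] := rat_near x; have [b bz] := rat_near y; have [c cz] := rat_near z.
  exists a => //; exists b => //; exists c => //; exists n => //.
  rewrite ifT; first by split.
  apply/asboolP => -[[x' y'] z'] [[/= ax' by'] cz']; apply: eO.
  have tri (q w w' : R) : `|q - w| < n.+1%:R^-1 -> ball q n.+1%:R^-1 w' -> ball w e w'.
    rewrite /ball/= => qw qw'.
    have -> : w - w' = (q - w') - (q - w) by ring.
    apply: le_lt_trans (ler_normB _ _) _.
    by rewrite (splitr e); apply: ltrD; [exact: lt_trans qw' ne|exact: lt_trans qw ne].
  by split; [split|]; [exact: tri ax ax'|exact: tri bz by'|exact: tri cz cz'].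
do 3 (apply: bigcupT_measurable_rat => ?); apply: bigcupT_measurable => n.
by case: ifPn.
Qed.

Lemma within_continuous_measurable (D : set (pt R)) (g : pt R -> R) :
  measurable (D : set (mpt R)) -> {within D, continuous g} ->
  measurable_fun (D : set (mpt R)) g.
Proof.
move=> mD cg; apply: (measurability _ (RGenOpens.measurableE R)).
move=> _ [_ [a [b ->] <-]].
have cg' : forall U : set R, open U -> open ((g : subspace D -> R) @^-1` U).
  by move=> U oU; move/(@continuousP (subspace D) R) : cg; exact.
have : open (g @^-1` `]a, b[%classic : set (subspace D)) by exact/cg'/interval_open.
move=> /open_subspaceP[V oV VD].
 rewrite setIC -VD; apply: measurableI => //.
exact: open_measurable_pt.
Qed.

Lemma measurable_cell (L : R) : measurable (cell L : set (mpt R)).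
Proof.
have -> : (cell L : set (mpt R)) = (`]0, L[%classic `*` `]0, L[%classic) `*` `]0, 1[%classic.
  apply/seteqP; split; case=> [[x y] z] /=; rewrite !in_itv/=; first by case.
  by case=> -[].
by apply: measurable_box; exact: measurable_itv.
Qed.

Lemma measurable_cell_bar (L : R) : measurable (cell_bar L : set (mpt R)).
Proof.
have -> : (cell_bar L : set (mpt R)) = (`[0, L]%classic `*` `[0, L]%classic) `*` `[0, 1]%classic.
  apply/seteqP; split; case=> [[x y] z] /=; rewrite !in_itv/=; first by case.
  by case=> -[].
by apply: measurable_box; exact: measurable_itv.
Qed.

Lemma cell_barE (L : R) : cell_bar L = (`[0, L]%classic `*` `[0, L]%classic) `*` `[0, 1]%classic.
Proof.
apply/seteqP; split; case=> [[x y] z] /=; rewrite !in_itv/=; first by case.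
by case=> -[].
Qed.

Lemma wallsE (L : R) : walls L = (`[0, L]%classic `*` `[0, L]%classic) `*` ([set 0] `|` [set 1]).
Proof.
apply/seteqP; split; case=> [[x y] z]; rewrite /walls cell_barE /=.
  by move=> [[? ?] ?].
by move=> [? [->|->]]; (split; first by split => //; rewrite in_itv/= lexx ler01); [left|right].
Qed.

Lemma measurable_walls (L : R) : measurable (walls L : set (mpt R)).
Proof.
rewrite wallsE; apply: measurable_box; [exact: measurable_itv|exact: measurable_itv|].
by apply: measurableU; exact: measurable_set1.
Qed.

Lemma compact_cell_bar (L : R) : compact (cell_bar L).
Proof.
by rewrite cell_barE; apply: compact_setX; [apply: compact_setX|]; exact: segment_compact.
Qed.

Lemma cell_sub (L : R) : cell L `<=` cell_bar L.
Proof.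
by move=> p [/andP[/ltW ? /ltW ?] /andP[/ltW ? /ltW ?] /andP[/ltW ? /ltW ?]]; split; apply/andP.
Qed.

Lemma walls_sub (L : R) : walls L `<=` cell_bar L.
Proof. by move=> p []. Qed.

End BorelBoxes.

(** * Integrals against a charge through arbitrary splittings *)

Section ChargeIntegral.
Context {R : realType}.
Local Notation T := (mpt R).

(** [charge_int] is defined through a Hahn decomposition obtained by choice, which cannot be
    computed. Any difference of finite measures may take its place, without mutual singularity. *)
Definition splits (nu : {charge set T -> \bar R}) (m1 m2 : {measure set T -> \bar R}) :=
  [/\ (m1 setT < +oo)%E, (m2 setT < +oo)%E &
      forall A, measurable A -> nu A = (m1 A - m2 A)%E].

Lemma finite_le_setT (m : {measure set T -> \bar R}) A : (m setT < +oo)%E -> measurable A ->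
  m A \is a fin_num.
Proof.
move=> mT mA; rewrite ge0_fin_numE//; apply: le_lt_trans mT.
by rewrite le_measure ?inE.
Qed.

Lemma bounded_integrable (m : {measure set T -> \bar R}) (D : set T) (f : T -> R) (B : R) :
  (m setT < +oo)%E -> measurable D -> measurable_fun D f ->
  (forall p, D p -> `|f p| <= B) -> m.-integrable D (EFin \o f).
Proof.
move=> mT mD mf fB; apply: measurable_bounded_integrable => //.
  by apply: le_lt_trans mT; rewrite le_measure ?inE.
exists B; split; first exact: num_real.
by move=> x Bx p Dp; apply: le_trans (fB p Dp) (ltW Bx).
Qed.

Lemma jordan_finite (nu : {charge set T -> \bar R}) : (jordan_pos (hahnP nu) setT < +oo)%E /\
  (jordan_neg (hahnP nu) setT < +oo)%E.
Proof. by split; rewrite -ge0_fin_numE// fin_num_measure. Qed.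

Lemma splits_jordan (nu : {charge set T -> \bar R}) : splits nu (jordan_pos (hahnP nu)) (jordan_neg (hahnP nu)).
Proof.
have [jp jn] := jordan_finite nu; split => // A mA.
rewrite (jordan_decomp (hahnP nu) mA) /cadd/=.
by rewrite /cscale/= EFinN mulN1e.
Qed.

(** The positive Jordan part plus [m2] is the same measure as the negative Jordan part plus [m1].
    Integrating [f] against both and rearranging finite numbers gives the claim. *)
Lemma charge_int_splits nu m1 m2 (D : set T) (f : T -> R) (B : R) :
  splits nu m1 m2 -> measurable D -> measurable_fun D f ->
  (forall p, D p -> `|f p| <= B) ->
  charge_int D nu f = \int[m1]_(p in D) f p - \int[m2]_(p in D) f p.
Proof.
move=> [m1T m2T E] mD mf fB; have [jpT jnT EJ] := splits_jordan nu.
rewrite /charge_int; move: jpT jnT EJ.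
set jp := jordan_pos (hahnP nu); set jn := jordan_neg (hahnP nu) => jpT jnT EJ.
have ijp := bounded_integrable jpT mD mf fB.
have ijn := bounded_integrable jnT mD mf fB.
have i1 := bounded_integrable m1T mD mf fB.
have i2 := bounded_integrable m2T mD mf fB.
have mEf : measurable_fun D (EFin \o f) by exact: measurable_int i1.
have H : (\int[jp]_(p in D) (f p)%:E + \int[m2]_(p in D) (f p)%:E =
          \int[jn]_(p in D) (f p)%:E + \int[m1]_(p in D) (f p)%:E)%E.
  rewrite -(integral_measure_add mD ijp i2) -(integral_measure_add mD ijn i1).
  apply: eq_measure_integral => A mA _.
  transitivity (jp A + m2 A)%E; first exact: measure_addE.
  transitivity (jn A + m1 A)%E; last exact/esym/measure_addE.
  have H : (jp A - jn A = m1 A - m2 A)%E by rewrite -(E A mA) (EJ A mA).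
  have fjp : jp A \is a fin_num by rewrite fin_num_measure.
  have fjn : jn A \is a fin_num by rewrite fin_num_measure.
  have fm1 := finite_le_setT m1T mA; have fm2 := finite_le_setT m2T mA.
  move: H; rewrite -(fineK fjp) -(fineK fjn) -(fineK fm1) -(fineK fm2).
  move=> [H]; rewrite -!EFinD; congr EFin; lra.
move: H; rewrite /Rintegral.
have f1 := integrable_fin_num mD ijp; have f2 := integrable_fin_num mD ijn.
have f3 := integrable_fin_num mD i1; have f4 := integrable_fin_num mD i2.
rewrite -(fineK f1) -(fineK f2) -(fineK f3) -(fineK f4) => -[].
by rewrite /=; lra.
Qed.

Lemma leeBlDr_ge0 (x y : \bar R) : (0 <= y)%E -> (x - y <= x)%E.
Proof. by move=> y0; rewrite geeDl// leeNl oppe0. Qed.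

(** The Jordan decomposition is minimal: its positive part has mass [nu P <= m1 P] on the positive
    set [P], and likewise for the negative part with [m2]. *)
Lemma variation_splits nu m1 m2 : splits nu m1 m2 ->
  (charge_variation (hahnP nu) setT <= m1 setT + m2 setT)%E.
Proof.
move=> [m1T m2T E]; rewrite /charge_variation/=.
have [[mP _] [mN _] _ _] := hahnP nu.
apply: leeD.
- rewrite jordan_posE cjordan_posE /crestr0 mem_set// /crestr setTI (E _ mP).
  apply: (@le_trans _ _ (m1 (hahn_pos nu))).
    by apply: leeBlDr_ge0; exact: measure_ge0.
  by apply: le_measure; rewrite ?inE.
- rewrite jordan_negE cjordan_negE /crestr0 mem_set// /crestr setTI (E _ mN).
  have f1 := finite_le_setT m1T mN; have f2 := finite_le_setT m2T mN.
  rewrite oppeB; last by rewrite fin_num_adde_defl// fin_numN.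
  apply: (@le_trans _ _ (m2 (hahn_neg nu))); last by apply: le_measure; rewrite ?inE.
  by rewrite addeC; apply: leeBlDr_ge0; exact: measure_ge0.
Qed.

Lemma maddE (m1 m2 : {measure set T -> \bar R}) A :
  (measure_add m1 m2 : {measure set T -> \bar R}) A = (m1 A + m2 A)%E.
Proof. exact: measure_addE. Qed.

Lemma splits_cadd nu1 nu2 m1 m2 m1' m2' : splits nu1 m1 m2 -> splits nu2 m1' m2' ->
  splits (cadd nu1 nu2) (measure_add m1 m1') (measure_add m2 m2').
Proof.
move=> [h1 h2 E] [h1' h2' E']; split.
- by rewrite maddE lte_add_pinfty.
- by rewrite maddE lte_add_pinfty.
move=> A mA; transitivity (nu1 A + nu2 A)%E; first by [].
rewrite (E _ mA) (E' _ mA) !maddE.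
have f1 := finite_le_setT h1 mA; have f2 := finite_le_setT h2 mA.
have f3 := finite_le_setT h1' mA; have f4 := finite_le_setT h2' mA.
by rewrite -(fineK f1) -(fineK f2) -(fineK f3) -(fineK f4) -!EFinD; congr EFin; ring.
Qed.

End ChargeIntegral.

Lemma integrable_bddM {R : realType} d (T : measurableType d) (mu : {measure set T -> \bar R})
    (D : set T) (f g : T -> R) (B : R) : measurable D -> measurable_fun D f ->
  (forall x, D x -> `|f x| <= B) -> mu.-integrable D (EFin \o g) ->
  mu.-integrable D (EFin \o (fun x => f x * g x)).
Proof.
move=> mD mf fB ig; have [mg _] := integrableP _ _ _ ig.
apply: (@le_integrable _ _ _ _ _ mD _ (fun x => `|B|%:E * (EFin \o g) x)%E).
- apply/measurable_EFinP; apply: measurable_funM => //; exact/measurable_EFinP.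
- move=> x Dx /=; rewrite lee_fin !normrM normr_id ler_wpM2r//.
  exact: le_trans (fB x Dx) (ler_norm _).
- exact: integrableZl.
Qed.

Section Density.
Context {R : realType} d (T : measurableType d).
Variables (mu m : {measure set T -> \bar R}) (g : T -> R).
Hypotheses (g0 : forall x, 0 <= g x) (ig : mu.-integrable setT (EFin \o g)).
Hypothesis mE : forall A, measurable A -> m A = (\int[mu]_(x in A) (g x)%:E)%E.

Import HBNNSimple.

Let mg : measurable_fun setT g.
Proof. by apply/measurable_EFinP; exact: measurable_int ig. Qed.

(** Monotone convergence on both sides reduces to simple functions, and linearity reduces these to
    indicators, where the claim is [mE]. *)
Lemma ge0_integral_density (D : set T) (f : T -> R) : measurable D -> (forall x, 0 <= f x) ->
  measurable_fun D f ->
  (\int[m]_(x in D) (f x)%:E = \int[mu]_(x in D) (f x * g x)%:E)%E.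
Proof.
move=> mD f0 mf.
have mf' : measurable_fun D (EFin \o f) by exact/measurable_EFinP.
pose h := nnsfun_approx mD mf'.
have hf x : D x -> (EFin \o h n) x @[n --> \oo] --> (f x)%:E.
  move=> Dx; apply: (@cvg_nnsfun_approx _ _ _ _ mD (EFin \o f) mf') => // y _.
  by rewrite lee_fin.
have mh n : measurable_fun D (h n) by apply: measurable_funTS; exact: measurable_funP.
have nd x a b : (a <= b)%N -> h a x <= h b x.
  by move=> ab; exact/lefP/nd_nnsfun_approx.
have -> : (\int[m]_(x in D) (f x)%:E = limn (fun n => \int[m]_(x in D) (h n x)%:E))%E.
  rewrite -(monotone_convergence _ mD).
  - by apply: eq_integral => x /[!inE] Dx; apply/esym/cvg_lim => //; exact: hf.
  - by move=> n; exact/measurable_EFinP.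
  - by move=> n x _; rewrite lee_fin.
  - by move=> x _ a b ab; rewrite lee_fin nd.
have -> : (\int[mu]_(x in D) (f x * g x)%:E =
    limn (fun n => \int[mu]_(x in D) (h n x * g x)%:E))%E.
  rewrite -(monotone_convergence _ mD).
  - apply: eq_integral => x /[!inE] Dx; apply/esym/cvg_lim => //.
    under eq_fun do rewrite EFinM.
    by rewrite EFinM; apply: cvgeZr => //; exact: hf.
  - by move=> n; apply/measurable_EFinP; apply: measurable_funM => //; exact: measurable_funTS.
  - by move=> n x _; rewrite lee_fin mulr_ge0.
  - by move=> x _ a b ab; rewrite lee_fin ler_wpM2r// nd.
congr (limn _); apply/funext => n.
transitivity (\int[m]_(x in D)
   (\sum_(y \in range (h n)) (y * \1_(h n @^-1` [set y]) x)%:E))%E.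
  by apply: eq_integral => x _; rewrite fimfunE -fsumEFin.
have y0 y : y \in range (h n) -> 0 <= y by rewrite inE => -[x _ <-].
have mpre y : measurable (h n @^-1` [set y]) by exact: measurable_sfunP.
rewrite ge0_integral_fsum//; last 2 first.
- move=> y; apply/measurable_EFinP; apply: measurable_funM; first exact: measurable_cst.
  exact: measurable_indic.
- by move=> y x Dx; exact: nnfun_muleindic_ge0.
transitivity (\int[mu]_(x in D)
   (\sum_(y \in range (h n)) ((y * \1_(h n @^-1` [set y]) x)%:E * (g x)%:E)))%E; last first.
  apply: eq_integral => x _; rewrite EFinM -ge0_mule_fsuml => [|y]; last exact: nnfun_muleindic_ge0.
  by rewrite fsumEFin// -fimfunE.
have mterm y : measurable_fun D (fun x => (y * \1_(h n @^-1` [set y]) x)%:E).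
  apply/measurable_EFinP; apply: measurable_funM; first exact: measurable_cst.
  exact: measurable_indic.
have mgD : measurable_fun D (EFin \o g) by apply/measurable_EFinP; exact: measurable_funTS.
rewrite ge0_integral_fsum//; last 2 first.
- by move=> y; apply: emeasurable_funM.
- by move=> y x Dx; rewrite mule_ge0 ?lee_fin// -lee_fin EFinM nnfun_muleindic_ge0.
apply: eq_fsbigr => r rh; have r0 := y0 r rh.
under eq_integral do rewrite EFinM.
have i1 : measurable_fun D (fun x => (\1_(h n @^-1` [set r]) x)%:E : \bar R).
  by apply/measurable_EFinP; exact: measurable_indic.
have i2 x : D x -> (0 <= (\1_(h n @^-1` [set r]) x)%:E :> \bar R)%E by rewrite lee_fin.
rewrite (ge0_integralZl _ mD i1 i2 (r0 : (0 <= r%:E)%E)).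
rewrite integral_indic// mE; last exact: measurableI.
under [RHS]eq_integral => x _.
  have -> : ((r * \1_(h n @^-1` [set r]) x)%:E * (g x)%:E =
    r%:E * ((EFin \o g) \_ (h n @^-1` [set r])) x)%E.
    rewrite -EFinM -mulrA EFinM; congr (_ * _)%E.
    by rewrite epatch_indic/= -EFinM mulrC.
  over.
have i3 : measurable_fun D ((EFin \o g) \_ (h n @^-1` [set r])).
  apply: (measurable_funS measurableT) => //.
  by apply/(measurable_restrictT _ _).1 => //; apply/measurable_EFinP; exact: measurable_funTS.
have i4 x : D x -> (0 <= ((EFin \o g) \_ (h n @^-1` [set r])) x)%E.
  by move=> _; rewrite /patch; case: ifP => // _; rewrite lee_fin.
rewrite (ge0_integralZl _ mD i3 i4 (r0 : (0 <= r%:E)%E)).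
by rewrite -integral_mkcondr setIC.
Qed.

Lemma density_finite : (m setT < +oo)%E.
Proof.
rewrite mE//; have /integrableP[_] := ig.
by under eq_integral do rewrite /= ger0_norm//.
Qed.

Lemma Rintegral_density (D : set T) (f : T -> R) (B : R) : measurable D ->
  measurable_fun D f -> (forall x, D x -> `|f x| <= B) ->
  \int[m]_(x in D) f x = \int[mu]_(x in D) (f x * g x).
Proof.
move=> mD mf fB.
(* Adding [C] makes [f] nonnegative on [D]; the maximum with [0] makes it so everywhere, as
   [ge0_integral_density] asks. *)
pose C := `|B|; pose f' x := Num.max 0 (f x + C).
have f'E x : D x -> f' x = f x + C.
  move=> Dx; apply/max_idPr; have := fB x Dx; rewrite ler_norml => /andP[? _].
  by have := ler_norm B; rewrite /C; lra.
have mf' : measurable_fun D f'.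
  by apply: measurable_maxr => //; apply: measurable_funD => //; exact: measurable_cst.
have f'0 x : 0 <= f' x by rewrite le_max lexx.
have f'B x : D x -> `|f' x| <= C + C.
  move=> Dx; rewrite f'E//; apply: le_trans (ler_normD _ _) _; rewrite /C normr_id.
  by rewrite lerD2r; exact: le_trans (fB x Dx) (ler_norm _).
have fE x : D x -> f x = f' x - C by move=> /f'E ->; rewrite addrK.
have bm (h : T -> R) b : measurable_fun D h -> (forall x, D x -> `|h x| <= b) -> m.-integrable D (EFin \o h).
  move=> mh hb; apply: measurable_bounded_integrable => //.
    by apply: le_lt_trans density_finite; rewrite le_measure ?inE.
  exists b; split; first exact: num_real.
  by move=> x bx p Dp; apply: le_trans (hb p Dp) (ltW bx).
have igD : mu.-integrable D (EFin \o g) by exact: integrableS ig.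
have bmu (h : T -> R) b : measurable_fun D h -> (forall x, D x -> `|h x| <= b) ->
    mu.-integrable D (EFin \o (fun x => h x * g x)).
  by move=> mh hb; exact: (integrable_bddM mD mh hb igD).
have mC : measurable_fun D (fun _ : T => C) by exact: measurable_cst.
have C0 : 0 <= C by exact: normr_ge0.
have CC x : D x -> `|(fun _ : T => C) x| <= C by move=> _; rewrite /C normr_id.
transitivity (\int[m]_(x in D) (f' x - C)).
  by apply: eq_Rintegral => x /[!inE] /fE.
rewrite RintegralB//; [|exact: bm f'B|exact: bm CC].
transitivity (\int[mu]_(x in D) (f' x * g x - C * g x)); last first.
  by apply: eq_Rintegral => x /[!inE] /fE ->; rewrite mulrBl.
rewrite RintegralB//; [|exact: bmu f'B|exact: bmu CC].
rewrite /Rintegral; congr (fine _ - fine _).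
- exact: ge0_integral_density.
- exact: (@ge0_integral_density D (fun _ => C)).
Qed.

End Density.

Section DensityCharge.
Context {R : realType}.
Local Notation T := (mpt R).
Variables (mu : {measure set T -> \bar R}) (D0 : set T) (h : T -> R).
Hypothesis ih : mu.-integrable setT (fun p => ((h \_ D0) p)%:E).

(** The measures have the positive and the negative part of the density as densities. Together they
    give both the integrals and the total variation of the charge. *)
Lemma density_splits : exists m1 m2 : {measure set T -> \bar R},
  [/\ splits (density_charge mu D0 h) m1 m2,
      (m1 setT + m2 setT = \int[mu]_p `|(h \_ D0) p|%:E)%E &
      forall D (f : T -> R) B, measurable D -> measurable_fun D f ->
        (forall p, D p -> `|f p| <= B) ->
        \int[m1]_(p in D) f p - \int[m2]_(p in D) f p =
        \int[mu]_(p in D) (f p * (h \_ D0) p)].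
Proof.
set k := h \_ D0.
have ihp : mu.-integrable setT (EFin \o k^\+) by apply: integrable_funrpos.
have ihn : mu.-integrable setT (EFin \o k^\-) by apply: integrable_funrneg.
have p0 E : (0 <= induced_charge ihp E)%E.
  by apply: integral_ge0 => x _; rewrite lee_fin funrpos_ge0.
have n0 E : (0 <= induced_charge ihn E)%E.
  by apply: integral_ge0 => x _; rewrite lee_fin funrneg_ge0.
pose m1 : {measure set T -> \bar R} := measure_of_charge (induced_charge ihp) p0.
pose m2 : {measure set T -> \bar R} := measure_of_charge (induced_charge ihn) n0.
have m1E A : measurable A -> m1 A = (\int[mu]_(x in A) (k^\+ x)%:E)%E by [].
have m2E A : measurable A -> m2 A = (\int[mu]_(x in A) (k^\- x)%:E)%E by [].
exists m1, m2; split.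
- split.
  + exact: (density_finite (funrpos_ge0 k) ihp m1E).
  + exact: (density_finite (funrneg_ge0 k) ihn m2E).
  move=> A mA; rewrite m1E// m2E// /density_charge; case: pselect => // ih'.
  transitivity (\int[mu]_(x in A) ((k x)%:E))%E; first by [].
  rewrite -(integralB_EFin mA (integrableS measurableT mA (@subsetT _ A) ihp)
    (integrableS measurableT mA (@subsetT _ A) ihn)).
  by apply: eq_integral => x _; rewrite -EFinB -[in LHS](funrposBneg k).
- rewrite m1E// m2E// -ge0_integralD//.
  + by apply: eq_integral => x _; rewrite -EFinD; congr EFin; exact: (congr1 (@^~ x) (funrposDneg k)).
  + by move=> x _; rewrite lee_fin funrpos_ge0.
  + exact: measurable_int ihp.
  + by move=> x _; rewrite lee_fin funrneg_ge0.
  + exact: measurable_int ihn.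
- move=> D f B mD mf fB.
  rewrite (@Rintegral_density _ _ _ mu m1 k^\+ (funrpos_ge0 _) ihp m1E D f B mD mf fB).
  rewrite (@Rintegral_density _ _ _ mu m2 k^\- (funrneg_ge0 _) ihn m2E D f B mD mf fB).
  rewrite -RintegralB//; first last.
  + by apply: (integrable_bddM mD mf fB); exact: (integrableS measurableT mD (@subsetT _ D) ihn).
  + by apply: (integrable_bddM mD mf fB); exact: (integrableS measurableT mD (@subsetT _ D) ihp).
  apply: eq_Rintegral => x _; rewrite -mulrBr; congr (_ * _).
  exact: (congr1 (@^~ x) (funrposBneg k)).
Qed.

End DensityCharge.

(** * The boundary layer limit *)

Section LayerLimit.
Context {R : realType}.
Local Notation leb := (@lebesgue_measure R).

Lemma unit_within_LR (F f : R -> R) : {within `[0, 1], continuous F} ->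
  (forall z : R, 0 < z < 1 -> is_derive z (1:R) F (f z)) ->
  derivable_oo_LRcontinuous F 0 1 /\ {in `]0, 1[, derive1 F =1 f}.
Proof.
move=> cF dF; split.
  have /(continuous_within_itvP _ ltr01)[_ F0 F1] := cF.
  split => // z; rewrite in_itv/= => hz.
  by case: (dF z hz).
move=> z; rewrite in_itv/= => hz; rewrite derive1E.
by have := dF z hz => H; rewrite derive_val.
Qed.

Lemma within_unit_integrable (f : R -> R) : {within `[0, 1], continuous f} ->
  leb.-integrable `[0, 1] (EFin \o f).
Proof. by move=> cf; apply: continuous_compact_integrable => //; exact: segment_compact. Qed.

Lemma layer_cont (s : R) : continuous (layer s 1).
Proof.
move=> z; apply/differentiable_continuous/derivable1_diffP.
have d1 := isd_exp (isdM (isdD (isd_id z) (isd_cst z (-1))) (isd_cst z s^-1)).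
have d2 := isd_exp (isdM (isdN (isd_id z)) (isd_cst z s^-1)).
by case: (isdD (isd_cst z 1) (isdM (isdD d2 d1) (isd_cst z s^-1))).
Qed.

(** The factor [1 / s] in [layer] is what differentiating an exponential produces, so that the
    primitive [P] stays bounded; each of its three terms increases by at most [1]. *)
Lemma integral_layer (s : R) : 0 < s -> \int[leb]_(z in `[0, 1]) layer s 1 z <= 3.
Proof.
move=> s0.
pose P (z : R) := z + (expR ((z - 1) / s) - expR (- z / s)).
have dP z : is_derive z (1:R) P (layer s 1 z).
  have d1 := isd_exp (isdM (isdD (isd_id z) (isd_cst z (-1))) (isd_cst z s^-1)).
  have d2 := isd_exp (isdM (isdN (isd_id z)) (isd_cst z s^-1)).
  by apply: (isd_eq (isdD (isd_id z) (isdD d1 (isdN d2)))); rewrite /layer; ring.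
have cP : {within `[0, 1], continuous P}.
  by apply: derivable_within_continuous => z _; case: (dP z).
have [P1 P2] := unit_within_LR cP (fun z _ => dP z).
rewrite /Rintegral (continuous_FTC2 ltr01 (continuous_subspaceT (@layer_cont s)) P1 P2) -EFinB/=.
rewrite /P; have e1 := expR_gt0 (- 1 / s); have e2 := expR_gt0 ((0 - 1) / s).
by rewrite subrr oppr0 !mul0r expR0; lra.
Qed.

(** Only [z] is confined to the compact interval, whereas [w] may leave it: the averages in
    [C1_approx] reach slightly beyond [1]. *)
Lemma unif_cont_unit (psi : R -> R) (e : R) : continuous psi -> 0 < e ->
  \forall r \near (0 : R)^'+, forall z, 0 <= z <= 1 -> forall w, `|w - z| < r -> `|psi w - psi z| <= e.
Proof.
move=> cpsi e0.
have /compact_near_coveringP := @segment_compact R 0 1.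
move=> /(_ R (0^'+) (fun r z => forall w, `|w - z| < r -> `|psi w - psi z| <= e) _) H0.
have {}H0 := H0 _.
have H1 : forall z, (`[0, 1]%classic : set R) z -> \forall z' \near z & r \near (0 : R)^'+,
    forall w, `|w - z'| < r -> `|psi w - psi z'| <= e.
  move=> z _; have /cvgrPdist_le/(_ (e / 2)) := cpsi z.
  rewrite divr_gt0// => /(_ isT)/nbhs_ballP[r /= r0 hr].
  exists (ball z (r / 2), [set t | t < r / 2]); first split => /=.
  - by apply: nbhsx_ballx; rewrite divr_gt0.
  - by apply: nbhs_right_lt; rewrite divr_gt0.
  move=> [z' t]/= [zz' tr] w wz'.
  have h1 : `|psi z - psi z'| <= e / 2.
    by apply: hr; apply: (lt_trans zz'); lra.
  have h2 : `|psi z - psi w| <= e / 2.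
    apply: hr; rewrite /ball/= in zz' *.
    have -> : z - w = (z - z') - (w - z') by ring.
    by apply: le_lt_trans (ler_normB _ _) _; lra.
  have -> : psi w - psi z' = (psi z - psi z') - (psi z - psi w) by ring.
  by apply: le_trans (ler_normB _ _) _; lra.
apply: (@filterS _ (0^'+) _ _ _ _ (H0 H1)) => r H z hz.
by apply: H; rewrite /= in_itv.
Qed.

(** [q] is the moving average of [psi] over [[z, z + k]], with derivative a difference quotient of
    [psi]. Extending [psi] by its end values makes the average meaningful up to [z = 1]. *)
Lemma C1_approx (psi : R -> R) (e : R) : {within `[0, 1], continuous psi} -> 0 < e ->
  exists q q' : R -> R, [/\ forall z : R, 0 <= z <= 1 -> is_derive z (1:R) q (q' z),
    {within `[0, 1], continuous q'} & forall z, 0 <= z <= 1 -> `|q z - psi z| <= e].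
Proof.
move=> cpsi e0.
pose cl (t : R) := Num.min 1 (Num.max 0 t).
have ccl : continuous cl.
  move=> t; apply: continuous_min; first exact: cvg_cst.
  by apply: continuous_max; [exact: cvg_cst|exact: cvg_id].
have clI t : (`[0, 1]%classic : set R) (cl t).
  by rewrite /= in_itv/= /cl le_min ler01 le_max lexx/= ge_min lexx.
have clE t : 0 <= t <= 1 -> cl t = t.
  by move=> /andP[t0 tT]; rewrite /cl (max_idPr t0); exact/min_idPr.
pose V t := psi (cl t).
have cV : continuous V.
  move=> t; have /subspace_continuousP/(_ _ (clI t)) H := cpsi.
  apply: cvg_trans H => P wP; have H2 := ccl t _ wP.
  by apply: (@filterS _ (nbhs t) _ _ _ _ H2) => y; apply; exact: clI.
have [r0 r1 hr] : exists2 r : R, 0 < r < 1 &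
    forall z, 0 <= z <= 1 -> forall w, `|w - z| < r -> `|V w - V z| <= e.
  near (0 : R)^'+ => r; exists r; last by near: r; exact: unif_cont_unit.
  by apply/andP; split; [|near: r; exact: nbhs_right_lt].
(* The shift by [1] places the points in use, between [1] and [2 + k], inside the open interval from
   [0] to [4], where [primitive_exists] provides a derivative. *)
pose W t := V (t - 1).
have cW : continuous W.
  move=> t; apply: (@cvg_comp _ _ _ (fun t => t - 1) V); last exact: cV.
  by apply: cvgB; [exact: cvg_id|exact: cvg_cst].
have h4 : 0 < (4 : R) by [].
have [X [_ _ dX]] := @primitive_exists R 4 0 0 W h4 (continuous_subspaceT cW).
pose k := r0 / 2.
have [/andP[rp rl]] := r1.
have kp : 0 < k by rewrite /k; lra.
exists (fun z => k^-1 * (X (z + (1 + k)) - X (z + 1))), (fun z => k^-1 * (V (z + k) - V z)).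
have dXs (z a : R) : 0 <= z <= 1 -> 1 <= a <= 2 -> is_derive z (1:R) (fun z => X (z + a)) (V (z + (a - 1))).
  move=> /andP[z0 z1] /andP[a1 a2]; rewrite addrA; apply: (@isd_shift _ X); apply: dX.
  by apply/andP; split; lra.
split.
- move=> z hz; apply: isdZ; apply: isdD.
    by have := dXs z (1 + k) hz; rewrite addrAC subrr add0r; apply; apply/andP; split; rewrite /k; lra.
  by apply: isdN; have := dXs z 1 hz; rewrite subrr addr0; apply; rewrite lexx/=; lra.
- apply: continuous_subspaceT => z; apply: cvgM; first exact: cvg_cst.
  apply: cvgB; last exact: cV.
  apply: (@cvg_comp _ _ _ (fun t => t + k) V); last exact: cV.
  by apply: cvgD; [exact: cvg_id|exact: cvg_cst].
- move=> z hz; have [z0 z1] := andP hz.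
  have ab : z + 1 < z + (1 + k) by lra.
  have dX' (t : R) : z + 1 <= t <= z + (1 + k) -> is_derive t (1:R) X (W t).
    by move=> /andP[t1 t2]; apply: dX; apply/andP; split; rewrite /k in t2; lra.
  have dM t : t \in `]z + 1, z + (1 + k)[ -> is_derive t (1:R) X (W t).
    by rewrite in_itv/= => /andP[t1 t2]; apply: dX'; rewrite !ltW.
  have cM : {within `[z + 1, z + (1 + k)], continuous X}.
    apply: derivable_within_continuous => t; rewrite in_itv/= => ht.
    by case: (dX' t ht).
  have [c + ->] := @MVT R X W _ _ ab dM cM.
  rewrite in_itv/= => /andP[c1 c2].
  have -> : z + (1 + k) - (z + 1) = k by ring.
  rewrite mulrCA mulVf ?gt_eqF// mulr1.
  have -> : psi z = V z by rewrite /V clE.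
  by apply: hr => //; rewrite ltr_norml; rewrite /k in c2; apply/andP; split; lra.
Unshelve. all: by end_near. Qed.

Lemma Rint_bound_le (f g : R -> R) : {within `[0, 1], continuous f} ->
  {within `[0, 1], continuous g} -> (forall z, 0 <= z <= 1 -> `|f z| <= g z) ->
  `|\int[leb]_(z in `[0, 1]) f z| <= \int[leb]_(z in `[0, 1]) g z.
Proof.
move=> cf cg fg; have i1 := within_unit_integrable cf; have i2 := within_unit_integrable cg.
apply: le_trans (le_normr_Rintegral _ i1) _ => //.
by apply: le_Rintegral => //; exact: integrable_norm.
Qed.

Lemma unit_by_parts (q q' h d : R -> R) :
  (forall z : R, 0 <= z <= 1 -> is_derive z (1:R) q (q' z)) ->
  {within `[0, 1], continuous q'} ->
  {within `[0, 1], continuous h} -> {within `[0, 1], continuous d} ->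
  (forall z : R, 0 < z < 1 -> is_derive z (1:R) h (d z)) ->
  \int[leb]_(z in `[0, 1]) (q z * d z) =
    q 1 * h 1 - q 0 * h 0 - \int[leb]_(z in `[0, 1]) (q' z * h z).
Proof.
move=> dq cq' ch cd dh.
have cq : {within `[0, 1], continuous q}.
  by apply: derivable_within_continuous => z; rewrite in_itv/= => hz; case: (dq z hz).
have [q1 q2] := unit_within_LR cq (fun z (hz : 0 < z < 1) =>
  dq z (introT andP (conj (ltW (proj1 (andP hz))) (ltW (proj2 (andP hz)))))).
have [h1 h2] := unit_within_LR ch dh.
exact: (Rintegration_by_parts ltr01 cq' q1 q2 cd h1 h2).
Qed.

Lemma bounded_cvg_Rintegral d (T : measurableType d) (mu : {measure set T -> \bar R})
    (D : set T) (f_ : nat -> T -> R) (f : T -> R) (C : R) :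
  measurable D -> (mu D < +oo)%E -> (forall n, measurable_fun D (f_ n)) ->
  measurable_fun D f -> (forall n x, D x -> `|f_ n x| <= C) ->
  {ae mu, forall x, D x -> f_ n x @[n --> \oo] --> f x} ->
  \int[mu]_(x in D) f_ n x @[n --> \oo] --> \int[mu]_(x in D) f x.
Proof.
move=> mD Dfin mf_ mf fC ff.
have mEf_ n : measurable_fun D (EFin \o f_ n) by exact/measurable_EFinP.
have mEf : measurable_fun D (EFin \o f) by exact/measurable_EFinP.
have iC : mu.-integrable D (EFin \o (fun _ : T => `|C|)).
  apply: measurable_bounded_integrable => //.
  by exists `|C|; split; [exact: num_real|move=> x Cx y _; rewrite normr_id ltW].
have ff' : {ae mu, forall x, D x -> (EFin \o f_ n) x @[n --> \oo] --> (EFin \o f) x}.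
  by apply: filterS ff => x H Dx; apply: cvg_EFin; [exact: nearW|exact: H].
have fC' : {ae mu, forall x n, D x -> (`|(EFin \o f_ n) x| <= (EFin \o (fun _ : T => `|C|%R)) x)%E}.
  apply: aeW => x n Dx; rewrite /= lee_fin.
  exact: (le_trans (fC n x Dx) (ler_norm C)).
have [i0 _ H] := dominated_convergence mD mEf_ mEf ff' iC fC'.
apply: fine_cvg; rewrite fineK; first exact: H.
exact: integrable_fin_num.
Qed.

Lemma Rintegral_unit_cst (c : R) : \int[leb]_(z in `[0, 1]) (fun _ : R => c) z = c.
Proof. by rewrite Rintegral_cst//= lebesgue_measure_itv/= lte_fin ltr01 oppr0 adde0 mulr1. Qed.

Lemma within_unit_measurable (f : R -> R) : {within `[0, 1], continuous f} ->
  measurable_fun (`[0, 1] : set R) f.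
Proof. by move=> /within_unit_integrable/measurable_int/measurable_EFinP. Qed.

Lemma cvg_unit_dominated (f_ : nat -> R -> R) (f : R -> R) (C : R) :
  (forall n, {within `[0, 1], continuous (f_ n)}) -> {within `[0, 1], continuous f} ->
  (forall n z, 0 <= z <= 1 -> `|f_ n z| <= C) ->
  (forall z, 0 < z < 1 -> f_ n z @[n --> \oo] --> f z) ->
  \int[leb]_(z in `[0, 1]) f_ n z @[n --> \oo] --> \int[leb]_(z in `[0, 1]) f z.
Proof.
move=> cf_ cf fC ff.
apply: (@bounded_cvg_Rintegral _ _ leb _ f_ f C).
- exact: measurable_itv.
- by rewrite /= lebesgue_measure_itv/= lte_fin ltr01 oppr0 adde0 ltry.
- by move=> n; exact: within_unit_measurable.
- exact: within_unit_measurable.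
- by move=> n z; rewrite /= in_itv/=; exact: fC.
- exists ([set 0] `|` [set 1]); split.
  + by apply: measurableU; exact: measurable_set1.
  + by rewrite measureU0//; exact: lebesgue_measure_set1.
  move=> z /= /not_implyP[]; rewrite in_itv/= => /andP[z0 z1] nf.
  have [z0'|z0'] := eqVneq z 0; first by left.
  have [z1'|z1'] := eqVneq z 1; first by right.
  exfalso; apply: nf; apply: ff.
  by rewrite !lt_neqAle z0 z1 z1' eq_sym z0'.
Qed.

(* d_ n is only bounded in L^1, so psi is first replaced by a C^1 function q, for which
   integration by parts puts the derivative on q and leaves the bounded h_ n. *)
Lemma cvg_int_layer (psi h d : R -> R) (h_ d_ g_ : nat -> R -> R) (C K : R) :
  {within `[0, 1], continuous psi} ->
  (forall n, {within `[0, 1], continuous (h_ n)}) -> {within `[0, 1], continuous h} ->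
  (forall n, {within `[0, 1], continuous (d_ n)}) -> {within `[0, 1], continuous d} ->
  (forall n (z : R), 0 < z < 1 -> is_derive z (1:R) (h_ n) (d_ n z)) ->
  (forall z : R, 0 < z < 1 -> is_derive z (1:R) h (d z)) ->
  (forall n, h_ n 0 = 0 /\ h_ n 1 = 0) ->
  (forall n, {within `[0, 1], continuous (g_ n)}) ->
  (forall n z, 0 <= z <= 1 -> `|d_ n z| <= g_ n z) ->
  (forall n, \int[leb]_(z in `[0, 1]) g_ n z <= C) ->
  (forall z, 0 <= z <= 1 -> `|d z| <= C /\ `|h z| <= C) ->
  (forall n z, 0 <= z <= 1 -> `|h_ n z| <= K) ->
  (forall z, 0 < z < 1 -> h_ n z @[n --> \oo] --> h z) ->
  \int[leb]_(z in `[0, 1]) (psi z * d_ n z) @[n --> \oo] -->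
    \int[leb]_(z in `[0, 1]) (psi z * d z) + psi 0 * h 0 - psi 1 * h 1.
Proof.
move=> cpsi ch_ ch cd_ cd dh_ dh h_0 cg_ dg_ gC dC hK hh.
have C0 : 0 <= C.
  have h0 : 0 <= (0:R) <= 1 by rewrite lexx ler01.
  exact: le_trans (normr_ge0 _) (dC 0 h0).1.
have cM (f g : R -> R) : {within `[0, 1], continuous f} -> {within `[0, 1], continuous g} ->
    {within `[0, 1], continuous (fun z => f z * g z)}.
  by move=> cf cg z; apply: cvgM; [exact: cf|exact: cg].
apply/cvgrPdist_le => e e0.
(* Five errors of size [e / 8] are added at the end: replacing [psi] by [q] in the two integrals and
   at the two walls, and the convergence of the integrals with [q']. *)
pose e' := e / (8 * (C + 1)).
have C1 : 0 < C + 1 by rewrite ltr_wpDl.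
have e'0 : 0 < e' by rewrite divr_gt0// mulr_gt0.
have e'C : e' * C <= e / 8.
  rewrite /e' invfM mulrA -[leRHS]mulr1 -mulrA ler_wpM2l//; first by rewrite divr_ge0// ltW.
  by rewrite mulrC ler_pdivrMr// mul1r lerDl.
have e'1 : e' <= e / 8.
  rewrite /e' invfM mulrA -[leRHS]mulr1 ler_wpM2l//; first by rewrite divr_ge0// ltW.
  by rewrite invf_le1// lerDr.
have [q [q' [dq cq' qpsi]]] := C1_approx cpsi e'0.
have cq : {within `[0, 1], continuous q}.
  by apply: derivable_within_continuous => z; rewrite in_itv/= => hz; case: (dq z hz).
have E n : \int[leb]_(z in `[0, 1]) (q z * d_ n z) = - \int[leb]_(z in `[0, 1]) (q' z * h_ n z).
  rewrite (unit_by_parts dq cq' (ch_ n) (cd_ n) (dh_ n)); have [-> ->] := h_0 n.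
  by rewrite !mulr0 subrr sub0r.
have E' := unit_by_parts dq cq' ch cd dh.
have [Q Q0 hQ] : exists2 Q, 0 <= Q & forall z, 0 <= z <= 1 -> `|q' z| <= Q.
  have /compact_bounded[Q [_ hQ]] := continuous_compact cq' (@segment_compact R 0 1).
  exists (Num.max 0 (Q + 1)); first by rewrite le_max lexx.
  move=> z hz; rewrite le_max; apply/orP; right; apply: (hQ (Q + 1)); first by rewrite ltrDl.
  by exists z => //=; rewrite in_itv.
have cv : \int[leb]_(z in `[0, 1]) (q' z * h_ n z) @[n --> \oo] -->
    \int[leb]_(z in `[0, 1]) (q' z * h z).
  apply: (@cvg_unit_dominated _ _ (Q * K)).
  - by move=> n; exact: cM.
  - exact: cM.
  - by move=> n z hz; rewrite normrM; apply: ler_pM => //; [exact: hQ|exact: hK].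
  - by move=> z hz; apply: cvgM; [exact: cvg_cst|exact: hh].
have diff (f : R -> R) : {within `[0, 1], continuous f} ->
    `|\int[leb]_(z in `[0, 1]) (psi z * f z) - \int[leb]_(z in `[0, 1]) (q z * f z)| =
    `|\int[leb]_(z in `[0, 1]) ((psi z - q z) * f z)|.
  move=> cf; rewrite -RintegralB//; [|exact: within_unit_integrable (cM _ _ cpsi cf)
    |exact: within_unit_integrable (cM _ _ cq cf)].
  by congr (`|_|); apply: eq_Rintegral => z _; rewrite mulrBl.
have cpq : {within `[0, 1], continuous (fun z => psi z - q z)}.
  by move=> z; apply: cvgB; [exact: cpsi|exact: cq].
have D_ n : `|\int[leb]_(z in `[0, 1]) (psi z * d_ n z) - \int[leb]_(z in `[0, 1]) (q z * d_ n z)| <= e / 8.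
  rewrite diff//; apply: le_trans (Rint_bound_le (g := fun z => e' * g_ n z) (cM _ _ cpq (cd_ n)) _ _) _.
  - by move=> z; apply: cvgM; [exact: cvg_cst|exact: cg_].
  - move=> z hz; rewrite normrM; apply: ler_pM => //; last exact: dg_.
    by rewrite distrC qpsi.
  rewrite RintegralZl//; last exact: within_unit_integrable.
  by apply: le_trans e'C; rewrite ler_wpM2l// ltW.
have D : `|\int[leb]_(z in `[0, 1]) (psi z * d z) - \int[leb]_(z in `[0, 1]) (q z * d z)| <= e / 8.
  rewrite diff//; apply: le_trans (Rint_bound_le (g := fun z => e' * C) (cM _ _ cpq cd) _ _) _.
  - by apply: continuous_subspaceT => z; exact: cvg_cst.
  - move=> z hz; rewrite normrM; apply: ler_pM => //; last by case: (dC z hz).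
    by rewrite distrC qpsi.
  rewrite Rintegral_cst// /= lebesgue_measure_itv/= lte_fin ltr01 oppr0 adde0 /= mulr1.
  exact: e'C.
have bd z : 0 <= z <= 1 -> `|(psi z - q z) * h z| <= e / 8.
  move=> hz; rewrite normrM; apply: le_trans e'C; apply: ler_pM => //.
    by rewrite distrC qpsi.
  by case: (dC z hz).
have b0 := bd 0 (introT andP (conj (lexx 0) ler01)).
have b1 := bd 1 (introT andP (conj ler01 (lexx 1))).
have e8 : 0 < e / 8 by rewrite divr_gt0.
have near_n : \forall n \near \oo, `|\int[leb]_(z in `[0, 1]) (q' z * h z) -
    \int[leb]_(z in `[0, 1]) (q' z * h_ n z)| <= e / 8 by move/cvgrPdist_le: cv; apply.
near=> n.
have Bn : `|\int[leb]_(z in `[0, 1]) (q' z * h z) -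
    \int[leb]_(z in `[0, 1]) (q' z * h_ n z)| <= e / 8 by near: n; exact: near_n.
move: Bn (D_ n) D b0 b1; rewrite E E' !ler_norml.
move=> /andP[? ?] /andP[? ?] /andP[? ?] /andP[? ?] /andP[? ?].
by apply/andP; split; lra.
Unshelve. all: by end_near. Qed.

End LayerLimit.

(** * Fubini on the channel and on its walls *)

Section CellIntegrals.
Context {R : realType}.
Local Notation leb := (@lebesgue_measure R).
Local Notation R1 := (measurableTypeR R).

(** The horizontal product measure gets its own name so that its sigma-finiteness can be declared as
    an instance for Fubini's theorem. *)
Definition leb2 (A : set (R1 * R1)) : \bar R := (leb \x leb)%E A.

HB.instance Definition _ := Measure.copy leb2 (leb \x leb)%E.

Let leb2_sigma_finite : sigma_finite setT leb2.
Proof.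
exists (fun n => `[- n%:R, n%:R]%classic `*` `[- n%:R, n%:R]%classic).
  apply/esym/seteqP; split=> // -[x y] _.
  pose n := (Num.truncn `|x| + Num.truncn `|y|).+1.
  have bnd (w : R) : (Num.truncn `|w| < n)%N -> `|w| <= n%:R.
    move=> wn; apply: ltW; apply: lt_le_trans (truncnS_gt _) _; first by rewrite ler_nat.
  exists n => //=; rewrite !in_itv/= -!ler_norml; split; apply: bnd.
    by rewrite ltnS leq_addr.
  by rewrite ltnS leq_addl.
move=> n; split; first by apply: measurableX; exact: measurable_itv.
rewrite /leb2 product_measure1E; [|exact: measurable_itv|exact: measurable_itv].
have fin : (leb ((`[(- n%:R)%R, n%:R%R]%classic : set R1)) < +oo)%E.
  by rewrite lebesgue_measure_itv/=; case: ifP => _; rewrite ?ltry// -EFinD ltry.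
by apply: lte_mul_pinfty => //; rewrite ge0_fin_numE.
Qed.

HB.instance Definition _ := Measure_isSigmaFinite.Build _ _ _ leb2 leb2_sigma_finite.

Definition sq (L : R) : set (R1 * R1) := `]0, L[%classic `*` `]0, L[%classic.

Lemma measurable_sq L : measurable (sq L).
Proof. by apply: measurableX; exact: measurable_itv. Qed.

Lemma leb2_sq (L : R) : 0 < L -> (leb2 (sq L) = (L * L)%:E)%E.
Proof.
move=> L0; transitivity (leb `]0%R, L[%classic * leb `]0%R, L[%classic)%E.
  by apply: product_measure1E; exact: measurable_itv.
by rewrite !lebesgue_measure_itv/= lte_fin L0 oppr0 adde0 EFinM.
Qed.

Lemma leb3_cell (L : R) : 0 < L -> (leb3 (cell L) = (L * L)%:E)%E.
Proof.
move=> L0.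
have -> : (cell L : set (mpt R)) = sq L `*` `]0, 1[%classic.
  by apply/seteqP; split; case=> [[x y] z] /=; rewrite !in_itv/=; [case|case=> -[]].
transitivity (leb2 (sq L) * leb `]0%R, 1%R[%classic)%E.
  by apply: product_measure1E; [exact: measurable_sq|exact: measurable_itv].
rewrite leb2_sq//.
by rewrite lebesgue_measure_itv/= lte_fin ltr01 oppr0 adde0 mule1.
Qed.

(** [F] is controlled only on the open cell, so that Fubini's theorem is applied to its extension by
    zero. *)
Lemma cell_fubini (L : R) (F : pt R -> R) (B : R) : 0 < L ->
  measurable_fun (cell L : set (mpt R)) F -> (forall p, cell L p -> `|F p| <= B) ->
  measurable_fun (sq L) (fun q => \int[leb]_(z in `]0, 1[) F (q, z)) /\
  \int[leb3]_(p in cell L) F p = \int[leb2]_(q in sq L) \int[leb]_(z in `]0, 1[) F (q, z).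
Proof.
move=> L0 mF FB.
have mc := @measurable_cell R L.
have iF : leb3.-integrable (cell L) (EFin \o F).
  apply: measurable_bounded_integrable => //; first by rewrite leb3_cell// ltry.
  by exists B; split; [exact: num_real|move=> x Bx p cp; exact: le_trans (FB p cp) (ltW Bx)].
pose f (p : R1 * R1 * R1) : \bar R := ((F \_ (cell L)) p)%:E.
have fE : f = (EFin \o F) \_ (cell L).
  by apply/funext => p; rewrite /f /patch; case: ifP.
have if_ : (leb2 \x leb)%E.-integrable setT f.
  by rewrite fE; exact: (integrable_mkcond _ mc).1.
have cellE q z : (((q, z) : pt R) \in cell L) = (q \in sq L) && (z \in `]0, 1[%classic).
  apply/idP/andP; rewrite !inE; case: q => x y.
    by case=> /= ? ? ?; split => //; rewrite /sq /= !in_itv/=.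
  by rewrite /sq/= !in_itv/= => -[[? ?] ?]; split.
have mFc : measurable_fun setT (F \_ (cell L)).
  have H := measurable_restrictT (F : mpt R -> R) mc. exact: H.1.
have int_q q : q \in sq L -> leb.-integrable `]0, 1[ (EFin \o (fun z => F (q, z))).
  move=> qs; apply: measurable_bounded_integrable => //.
  - by rewrite /= lebesgue_measure_itv/= lte_fin ltr01 oppr0 adde0 ltry.
  - apply: (eq_measurable_fun (fun z => (F \_ (cell L)) (q, z))).
      by move=> z hz; rewrite /patch cellE qs hz.
    apply: measurable_funTS; apply: (measurableT_comp mFc).
    exact: measurable_pair1.
  - exists B; split; [exact: num_real|move=> x Bx z hz].
    apply: le_trans (FB (q, z) _) (ltW Bx).
    by apply/set_mem; rewrite cellE qs mem_set.
have FE q : fubini_F leb f q = (((fun q => \int[leb]_(z in `]0, 1[) F (q, z)) \_ (sq L)) q)%:E.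
  rewrite /fubini_F /patch; case: ifPn => qs.
    rewrite /Rintegral.
    have -> : (\int[leb]_y f (q, y) = \int[leb]_(z in `]0%R, 1%R[) (F (q, z))%:E)%E.
      rewrite [RHS]integral_mkcond; apply: eq_integral => z _.
      by rewrite /f /patch cellE qs /=; case: ifP.
    rewrite fineK//; apply: integrable_fin_num => //; exact: int_q.
  have f0 z : f (q, z) = 0%E by rewrite /f /patch cellE (negbTE qs).
  by under eq_integral do rewrite f0; rewrite integral0.
have msq := measurable_sq L.
split.
  have H : measurable_fun setT
      (EFin \o ((fun q => \int[leb]_(z in `]0, 1[) F (q, z)) \_ (sq L))).
    have HE : fubini_F leb f = EFin \o ((fun q => \int[leb]_(z in `]0, 1[) F (q, z)) \_ (sq L)).
      by apply/funext => q; exact: FE.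
    by rewrite -HE; exact: (@measurable_fubini_F _ _ _ _ _ leb2 leb f if_).
  have H' : measurable_fun setT ((fun q => \int[leb]_(z in `]0, 1[) F (q, z)) \_ (sq L)).
    exact/measurable_EFinP.
  exact: (measurable_restrictT _ msq).2 H'.
rewrite /Rintegral; congr fine.
have -> : (\int[leb3]_(x in cell L) (F x)%:E = \int[(leb2 \x leb)%E]_p f p)%E.
  by rewrite [LHS]integral_mkcond fE.
rewrite -(@integral12_prod_meas1 _ _ _ _ _ leb2 leb f if_) [RHS]integral_mkcond; apply: eq_integral => q _.
by rewrite FE /patch; case: ifP.
Qed.

End CellIntegrals.

Section WallIntegrals.
Context {R : realType}.
Local Notation leb := (@lebesgue_measure R).
Local Notation R1 := (measurableTypeR R).
Local Notation delta c := (@dirac _ R1 (c : R) R).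

Definition csq (L : R) : set (R1 * R1) := `[0, L]%classic `*` `[0, L]%classic.

Lemma measurable_csq L : measurable (csq L).
Proof. by apply: measurableX; exact: measurable_itv. Qed.

Lemma leb2_csq (L : R) : 0 < L -> (leb2 (csq L) = (L * L)%:E)%E.
Proof.
move=> L0; transitivity (leb `[0%R, L]%classic * leb `[0%R, L]%classic)%E.
  by apply: product_measure1E; exact: measurable_itv.
by rewrite !lebesgue_measure_itv/= lte_fin L0 oppr0 adde0 EFinM.
Qed.

Lemma sq_sub (L : R) : sq L `<=` csq L.
Proof. by move=> [x y] [] /=; rewrite !in_itv/= => /andP[/ltW ? /ltW ?] /andP[/ltW ? /ltW ?]; split; apply/andP; split. Qed.

Lemma csq_null (L : R) : 0 < L -> leb2 (csq L `\` sq L) = 0%E.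
Proof.
move=> L0; have m1 := measurable_csq L; have m2 := measurable_sq L.
have foo : (leb2 (csq L) < +oo)%E by rewrite leb2_csq// ltry.
transitivity (leb2 (csq L) - leb2 (csq L `&` sq L))%E; first exact: measureD.
rewrite setIidr; last exact: sq_sub.
by rewrite leb2_csq// leb2_sq// -EFinB subrr.
Qed.

(** The walls are closed squares while the cell is open; up to a null set both lie over [sq L], so
    that volume and wall integrals can be added under one integral sign. *)
Lemma integral_csq (L : R) (f : R1 * R1 -> R) : 0 < L -> leb2.-integrable (csq L) (EFin \o f) ->
  \int[leb2]_(q in csq L) f q = \int[leb2]_(q in sq L) f q.
Proof.
move=> L0 intf; have m1 := measurable_csq L; have m2 := measurable_sq L.
rewrite /Rintegral (@negligible_integral _ _ _ leb2 (csq L) (csq L `\` sq L))//.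
- by rewrite setDD setIidr//; exact: sq_sub.
- exact: measurableD.
- exact: csq_null.
Qed.

Lemma wallsX (L : R) : (walls L : set (mpt R)) = csq L `*` ([set 0] `|` [set 1]).
Proof. exact: wallsE. Qed.

Lemma wall_measure (L c : R) : 0 < L -> ((leb2 \x delta c)%E (walls L : set (mpt R)) < +oo)%E.
Proof.
move=> L0; rewrite wallsX.
pose W : set R1 := [set 0] `|` [set 1].
have -> : ((leb2 \x delta c)%E (csq L `*` W) = leb2 (csq L) * delta c W)%E.
  apply: product_measure1E; first exact: measurable_csq.
  by apply: measurableU; exact: measurable_set1.
by rewrite leb2_csq// diracE -EFinM ltry.
Qed.

(** [walls L] contains both walls, but the Dirac mass at [c] sees only the one at height [c]. *)
Lemma wall_fubini (L c B : R) (F : pt R -> R) : 0 < L -> c = 0 \/ c = 1 ->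
  measurable_fun (walls L : set (mpt R)) F -> (forall p, walls L p -> `|F p| <= B) ->
  [/\ (leb2 \x delta c)%E.-integrable (walls L : set (mpt R)) (EFin \o F),
      leb2.-integrable (sq L) (EFin \o (fun q => F (q, c))) &
      \int[(leb2 \x delta c)%E]_(p in (walls L : set (mpt R))) F p = \int[leb2]_(q in sq L) F (q, c)].
Proof.
move=> L0 c01 mF FB.
have mw := @measurable_walls R L.
have iF : (leb2 \x delta c)%E.-integrable (walls L : set (mpt R)) (EFin \o F).
  apply: measurable_bounded_integrable => //; first exact: wall_measure.
  by exists B; split; [exact: num_real|move=> x Bx p cp; exact: le_trans (FB p cp) (ltW Bx)].
have mFc : measurable_fun setT (F \_ (walls L)).
  have H := measurable_restrictT (F : mpt R -> R) mw. exact: H.1.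
have wE q : (((q, c) : pt R) \in walls L) = (q \in csq L).
  apply/idP/idP; rewrite !inE wallsX => //; first by case.
have mFq : measurable_fun (csq L) (fun q => F (q, c)).
  apply: (eq_measurable_fun (fun q => (F \_ (walls L)) (q, c))).
    by move=> q hq; rewrite /patch wE hq.
  apply: measurable_funTS; apply: (measurableT_comp mFc).
  exact: measurable_pair2.
have iq : leb2.-integrable (csq L) (EFin \o (fun q => F (q, c))).
  have foo : (leb2 (csq L) < +oo)%E by rewrite leb2_csq// ltry.
  apply: (measurable_bounded_integrable (measurable_csq L) foo mFq).
  exists B; split; [exact: num_real|move=> x Bx q hq].
  by apply: le_trans (FB (q, c) _) (ltW Bx); apply/set_mem; rewrite wE mem_set.
split => //.
  exact: (integrableS (measurable_csq L) (measurable_sq L) (@sq_sub L) iq).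
rewrite -integral_csq// /Rintegral; congr fine.
pose f (p : R1 * R1 * R1) : \bar R := ((F \_ (walls L)) p)%:E.
have fE : f = (EFin \o F) \_ (walls L).
  by apply/funext => p; rewrite /f /patch; case: ifP.
have if_ : (leb2 \x delta c)%E.-integrable setT f.
  by rewrite fE; exact: (integrable_mkcond _ mw).1.
transitivity (\int[(leb2 \x delta c)%E]_p f p)%E.
  by rewrite [LHS]integral_mkcond fE.
rewrite -(@integral12_prod_meas1 _ _ _ _ _ leb2 (delta c) f if_) [RHS]integral_mkcond.
apply: eq_integral => q _; rewrite /fubini_F integral_dirac//; last first.
  apply/measurable_EFinP; apply: (measurableT_comp mFc); exact: measurable_pair1.
by rewrite diracT mul1e /f /patch wE /=; case: ifP.
Qed.

Lemma surface_walls (L : R) : 0 < L -> (surface_measure (walls L : set (mpt R)) < +oo)%E.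
Proof.
move=> L0; pose W : set (mpt R) := walls L.
have -> : (surface_measure W = (leb2 \x delta 0%R)%E W + (leb2 \x delta 1%R)%E W)%E.
  exact: measure_addE.
by apply: lte_add_pinfty; exact: wall_measure.
Qed.

Lemma surface_fubini (L B : R) (F : pt R -> R) : 0 < L ->
  measurable_fun (walls L : set (mpt R)) F -> (forall p, walls L p -> `|F p| <= B) ->
  surface_measure.-integrable (walls L : set (mpt R)) (EFin \o F) /\
  \int[surface_measure]_(p in (walls L : set (mpt R))) F p =
  \int[leb2]_(q in sq L) (F (q, 0) + F (q, 1)).
Proof.
move=> L0 mF FB; have mw := @measurable_walls R L.
have [i0 j0 E0] := wall_fubini L0 (or_introl erefl : (0 : R) = 0 \/ (0 : R) = 1) mF FB.
have [i1 j1 E1] := wall_fubini L0 (or_intror erefl : (1 : R) = 0 \/ (1 : R) = 1) mF FB.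
split.
  apply: measurable_bounded_integrable => //.
    exact: surface_walls.
  by exists B; split; [exact: num_real|move=> x Bx p cp; exact: le_trans (FB p cp) (ltW Bx)].
rewrite RintegralD//; last exact: measurable_sq.
rewrite -E0 -E1 /Rintegral -fineD; [|exact: integrable_fin_num|exact: integrable_fin_num].
congr fine; exact: integral_measure_add.
Qed.

End WallIntegrals.

Section CellLayer.
Context {R : realType}.
Local Notation leb := (@lebesgue_measure R).
Local Notation R1 := (measurableTypeR R).

Lemma within_comp (A : topologicalType) (B : topologicalType) (C : topologicalType)
    (D : set A) (E : set B) (g : A -> B) (f : B -> C) :
  {within E, continuous f} -> continuous g -> (forall x, D x -> E (g x)) ->
  {within D, continuous (fun x => f (g x))}.
Proof.
move=> cf cg DE; apply/subspace_continuousP => x Dx.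
have cp : g x' @[x' --> within D (nbhs x)] --> within E (nbhs (g x)).
  move=> P wP; have H := cg x _ wP.
  by apply: (@filterS _ (nbhs x) _ _ _ _ H) => x' H' Dx'; apply: H'; exact: DE.
have /subspace_continuousP/(_ (g x))/(_ _)/wrap[] := cf; first exact: DE.
by move=> /(cvg_comp _ _ cp).
Qed.

Lemma continuous_pt2 (q : R * R) : continuous (fun z : R => (q, z)).
Proof. by move=> z; exact: (cvg_pair (cvg_cst q) (@cvg_id _ (nbhs z))). Qed.

Lemma le_unit_closure (f g : R -> R) : {within `[0, 1], continuous f} ->
  {within `[0, 1], continuous g} -> (forall z, 0 < z < 1 -> f z <= g z) ->
  forall z, 0 <= z <= 1 -> f z <= g z.
Proof.
move=> /(continuous_within_itvP _ ltr01)[_ f0 f1] /(continuous_within_itvP _ ltr01)[_ g0 g1] fg z.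
move=> /andP[]; rewrite le_eqVlt => /predU1P[<- _|z0].
  apply: (ler_cvg_to f0 g0); near=> w; apply: fg.
  by apply/andP; split; near: w; [exact: nbhs_right_gt|exact: nbhs_right_lt].
rewrite le_eqVlt => /predU1P[->|z1]; last by apply: fg; rewrite z0.
apply: (ler_cvg_to f1 g1); near=> w; apply: fg.
by apply/andP; split; near: w; [exact: nbhs_left_gt|exact: nbhs_left_lt].
Unshelve. all: by end_near. Qed.

Lemma cell_bar_bounded (L : R) (f : pt R -> R) : {within cell_bar L, continuous f} ->
  exists2 B, 0 <= B & forall p, cell_bar L p -> `|f p| <= B.
Proof.
move=> cf; have /compact_bounded[B [_ hB]] := continuous_compact cf (@compact_cell_bar R L).
exists (Num.max 0 (B + 1)); first by rewrite le_max lexx.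
move=> p hp; rewrite le_max; apply/orP; right; apply: (hB (B + 1)); first by rewrite ltrDl.
by exists p.
Qed.

Lemma csq_cell_bar (L z : R) (q : R1 * R1) : csq L q -> 0 <= z <= 1 -> cell_bar L (q, z).
Proof. by case: q => x y [] /=; rewrite !in_itv/= => hx hy hz; split. Qed.

Lemma unit_slice (L : R) (f : pt R -> R) (q : R1 * R1) : {within cell_bar L, continuous f} ->
  csq L q -> {within `[0, 1], continuous (fun z => f (q, z))}.
Proof.
move=> cf hq; apply: (@within_comp R (pt R) R _ _ (fun z : R => (q, z)) f cf (@continuous_pt2 q)).
by move=> z /=; rewrite in_itv/= => hz; exact: csq_cell_bar.
Qed.

Lemma Rintegral_unit_oo (f : R -> R) : {within `[0, 1], continuous f} ->
  \int[leb]_(z in `]0, 1[) f z = \int[leb]_(z in `[0, 1]) f z.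
Proof.
move=> /within_unit_measurable mf; rewrite /Rintegral; congr fine.
have mf' : measurable_fun (`]0, 1[ : set R) (EFin \o f).
  by apply/measurable_EFinP; apply: measurable_funS mf => //; exact: subset_itv_oo_cc.
exact/esym/(integral_itv_bndoo true false mf').
Qed.

Lemma within_mul (D : set (pt R)) (f g : pt R -> R) : {within D, continuous f} ->
  {within D, continuous g} -> {within D, continuous (fun p => f p * g p)}.
Proof. by move=> cf cg z; apply: cvgM; [exact: cf|exact: cg]. Qed.

Lemma cell_measurable (L : R) (f : pt R -> R) : {within cell_bar L, continuous f} ->
  measurable_fun (cell L : set (mpt R)) f.
Proof.
move=> cf; apply: within_continuous_measurable; first exact: measurable_cell.
exact: continuous_subspaceW (@cell_sub R L) cf.
Qed.

Lemma cell_fubini_cont (L : R) (f : pt R -> R) : 0 < L -> {within cell_bar L, continuous f} ->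
  measurable_fun (sq L) (fun q => \int[leb]_(z in `[0, 1]) f (q, z)) /\
  \int[leb3]_(p in cell L) f p = \int[leb2]_(q in sq L) \int[leb]_(z in `[0, 1]) f (q, z).
Proof.
move=> L0 cf; have [B _ fB] := cell_bar_bounded cf.
have [m E] := cell_fubini L0 (cell_measurable cf) (fun p hp => fB p (cell_sub hp)).
have slice q : q \in sq L ->
    \int[leb]_(z in `]0, 1[) f (q, z) = \int[leb]_(z in `[0, 1]) f (q, z).
  by move=> /set_mem/(@sq_sub R L) hq; apply: Rintegral_unit_oo; exact: unit_slice hq.
split; first by apply: eq_measurable_fun m.
by rewrite E; apply: eq_Rintegral.
Qed.

Lemma wall_measurable (L c : R) (f : pt R -> R) : 0 <= c <= 1 -> {within cell_bar L, continuous f} ->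
  measurable_fun (sq L) (fun q => f (q, c)).
Proof.
move=> hc cf.
have mf : measurable_fun (cell_bar L : set (mpt R)) f.
  by apply: within_continuous_measurable => //; exact: measurable_cell_bar.
have mfc := (measurable_restrictT (f : mpt R -> R) (@measurable_cell_bar R L)).1 mf.
apply: (eq_measurable_fun (fun q => (f \_ (cell_bar L)) (q, c))).
  move=> q /set_mem/(@sq_sub R L) hq; rewrite /patch mem_set//; exact: csq_cell_bar.
by apply: measurable_funTS; apply: (measurableT_comp mfc); exact: measurable_pair2.
Qed.

Lemma sq_cell (L : R) (q : R * R) z : sq L q -> 0 < z < 1 -> cell L (q, z).
Proof. by case: q => x y [] /=; rewrite !in_itv/= => hx hy hz; split. Qed.

(** On each vertical segment this is [cvg_int_layer]. The vertical integrals are bounded by [P * C],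
    uniformly in [n] and in the segment, where [P] bounds [phi]; bounded convergence over the square
    then applies, although [W_ n] need not be uniformly bounded. *)
Lemma cell_layer_limit (L C K : R) (phi H W : pt R -> R) (H_ W_ : nat -> pt R -> R)
    (g_ : nat -> R -> R) : 0 < L ->
  {within cell_bar L, continuous phi} ->
  {within cell_bar L, continuous H} -> {within cell_bar L, continuous W} ->
  (forall n, {within cell_bar L, continuous (H_ n)}) ->
  (forall n, {within cell_bar L, continuous (W_ n)}) ->
  (forall (q : R * R) (z : R), sq L q -> 0 < z < 1 ->
    is_derive z (1:R) (fun z => H (q, z)) (W (q, z))) ->
  (forall n (q : R * R) (z : R), sq L q -> 0 < z < 1 ->
    is_derive z (1:R) (fun z => H_ n (q, z)) (W_ n (q, z))) ->
  (forall n q, sq L q -> H_ n (q, 0) = 0 /\ H_ n (q, 1) = 0) ->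
  (forall n, {within `[0, 1], continuous (g_ n)}) ->
  (forall n, \int[leb]_(z in `[0, 1]) g_ n z <= C) ->
  (forall n p, cell L p -> `|W_ n p| <= g_ n p.2) ->
  (forall n p, cell_bar L p -> `|H_ n p| <= K) ->
  (forall p, cell L p -> H_ n p @[n --> \oo] --> H p) ->
  \int[leb3]_(p in cell L) (phi p * W_ n p) @[n --> \oo] -->
    \int[leb3]_(p in cell L) (phi p * W p) +
    \int[leb2]_(q in sq L) (phi (q, 0) * H (q, 0) - phi (q, 1) * H (q, 1)).
Proof.
move=> L0 cphi cH cW cH_ cW_ dH dH_ H_0 cg_ gC Wg HK HH.
have [P P0 hP] := cell_bar_bounded cphi.
have [BH BH0 hBH] := cell_bar_bounded cH.
have [BW BW0 hBW] := cell_bar_bounded cW.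
have [m E] := cell_fubini_cont L0 (within_mul cphi cW).
pose I (q : R * R) := \int[leb]_(z in `[0, 1]) (phi (q, z) * W (q, z)).
pose J (q : R * R) := phi (q, 0) * H (q, 0) - phi (q, 1) * H (q, 1).
have z0 : 0 <= (0:R) <= 1 by rewrite lexx ler01.
have z1 : 0 <= (1:R) <= 1 by rewrite lexx ler01.
have mJ : measurable_fun (sq L) J.
  apply: measurable_funB; first exact: (wall_measurable z0 (within_mul cphi cH)).
  exact: (wall_measurable z1 (within_mul cphi cH)).
have foo : (leb2 (sq L) < +oo)%E by rewrite leb2_sq// ltry.
have bnd (f : pt R -> R) q (g : R -> R) : {within cell_bar L, continuous f} -> sq L q ->
    {within `[0, 1], continuous g} -> (forall z, 0 < z < 1 -> `|f (q, z)| <= g z) ->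
    `|\int[leb]_(z in `[0, 1]) f (q, z)| <= \int[leb]_(z in `[0, 1]) g z.
  move=> cf hq cg fg; have cs := unit_slice cf (@sq_sub R L _ hq).
  apply: Rint_bound_le => //; apply: le_unit_closure => //.
  by move=> z; apply: cvg_norm; exact: cs.
have iI : leb2.-integrable (sq L) (EFin \o I).
  apply: (measurable_bounded_integrable (measurable_sq L) foo m).
  exists (P * BW); split; first exact: num_real.
  move=> B /ltW PB q hq; apply: le_trans PB.
  rewrite -(Rintegral_unit_cst (P * BW)); apply: (bnd (fun p => phi p * W p) q (fun _ => P * BW) (within_mul cphi cW) hq).
    exact: (@cst_continuous (subspace (`[0, 1] : set R)) R (P * BW)).
  move=> z hz; have cz := cell_sub (sq_cell hq hz).
  by rewrite normrM; apply: ler_pM => //; [exact: hP|exact: hBW].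
have iJ : leb2.-integrable (sq L) (EFin \o J).
  apply: (measurable_bounded_integrable (measurable_sq L) foo mJ).
  exists (P * BH + P * BH); split; first exact: num_real.
  move=> B /ltW PB q hq; apply: le_trans PB; have hq' := @sq_sub R L _ hq.
  apply: le_trans (ler_normB _ _) _; rewrite !normrM.
  by apply: lerD; apply: ler_pM => //; [exact/hP/csq_cell_bar|exact/hBH/csq_cell_bar
    |exact/hP/csq_cell_bar|exact/hBH/csq_cell_bar].
rewrite E -RintegralD//; last exact: measurable_sq.
under eq_fun do rewrite (cell_fubini_cont L0 (within_mul cphi (cW_ _))).2.
apply: (@bounded_cvg_Rintegral _ _ _ leb2 _ _ _ (P * C)) => //.
- exact: measurable_sq.
- by move=> n; exact: (cell_fubini_cont L0 (within_mul cphi (cW_ n))).1.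
- by apply: measurable_funD.
- move=> n q hq.
  have := bnd _ q (fun z => P * g_ n z) (within_mul cphi (cW_ n)) hq.
  move=> /(_ _ _)/le_trans; apply.
  + by move=> z; exact: (cvgM (cvg_cst P) (cg_ n z)).
  + move=> z hz; have cz := sq_cell hq hz.
    rewrite normrM; apply: ler_pM => //; first exact/hP/cell_sub.
    exact: (Wg n (q, z)).
  + rewrite RintegralZl//; last exact: within_unit_integrable.
    exact: ler_wpM2l.
- apply: aeW => q hq; have hq' := @sq_sub R L _ hq.
  rewrite /I /J addrA.
  have [C' [CC' BW' BH']] : exists C', [/\ C <= C', BW <= C' & BH <= C'].
    exists (Num.max C (Num.max BW BH)); split; by rewrite !le_max lexx ?orbT.
  apply: (@cvg_int_layer _ (fun z => phi (q, z)) (fun z => H (q, z)) (fun z => W (q, z))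
    (fun n z => H_ n (q, z)) (fun n z => W_ n (q, z)) g_ C' K).
  + exact: unit_slice hq'.
  + by move=> n; exact: (unit_slice (cH_ n) hq').
  + exact: unit_slice hq'.
  + by move=> n; exact: (unit_slice (cW_ n) hq').
  + exact: unit_slice hq'.
  + by move=> n z hz; exact: dH_.
  + by move=> z hz; exact: dH.
  + by move=> n; exact: H_0.
  + exact: cg_.
  + move=> n; apply: le_unit_closure => //.
      by move=> z; apply: cvg_norm; exact: (unit_slice (cW_ n) hq').
    by move=> z hz; exact: (Wg n (q, z) (sq_cell hq hz)).
  + by move=> n; exact: le_trans (gC n) CC'.
  + move=> z hz; have cz := csq_cell_bar hq' hz.
    by split; [exact: le_trans (hBW _ cz) BW'|exact: le_trans (hBH _ cz) BH'].
  + by move=> n z hz; exact: (HK n (q, z) (csq_cell_bar hq' hz)).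
  + by move=> z hz; exact: (HH (q, z) (sq_cell hq hz)).
Qed.

Lemma cell_integrable (L B : R) (f : pt R -> R) : 0 < L ->
  measurable_fun (cell L : set (mpt R)) f -> (forall p, cell L p -> `|f p| <= B) ->
  leb3.-integrable (cell L : set (mpt R)) (EFin \o f).
Proof.
move=> L0 mf fB.
have foo : (leb3 (cell L : set (mpt R)) < +oo)%E by rewrite leb3_cell// ltry.
apply: (measurable_bounded_integrable (@measurable_cell R L) foo mf).
by exists B; split; [exact: num_real|move=> x Bx p Dp; exact: le_trans (fB p Dp) (ltW Bx)].
Qed.

Lemma cell_int_le (L C : R) (f : pt R -> R) (g : R -> R) : 0 < L ->
  measurable_fun (cell L : set (mpt R)) f -> continuous g ->
  (forall p, cell L p -> `|f p| <= g p.2) -> \int[leb]_(z in `[0, 1]) g z <= C ->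
  \int[leb3]_(p in cell L) `|f p| <= L * L * C.
Proof.
move=> L0 mf cg fg gC.
have cgp : {within cell_bar L, continuous (fun p : pt R => g p.2)}.
  apply: continuous_subspaceT => p.
  by apply: (@cvg_comp _ _ _ (fun p : pt R => p.2) g); [exact: cvg_snd|exact: cg].
have [B _ hB] := cell_bar_bounded cgp.
have gB p : cell L p -> `|g p.2| <= B by move=> /cell_sub; exact: hB.
apply: (@le_trans _ _ (\int[leb3]_(p in cell L) g p.2)).
  apply: le_Rintegral => //; first exact: measurable_cell.
  - apply: (cell_integrable (B := B) L0); first exact: measurableT_comp.
    move=> p hp; rewrite normr_id; apply: le_trans (fg p hp) _.
    exact: le_trans (ler_norm _) (gB p hp).
  - exact: (cell_integrable L0 (cell_measurable cgp) gB).
have [_ ->] := cell_fubini_cont L0 cgp.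
rewrite (_ : \int[leb2]_(q in sq L) _ = \int[leb2]_(q in sq L) (\int[leb]_(z in `[0, 1]) g z))//.
rewrite Rintegral_cst//; last exact: measurable_sq.
have -> : fine (leb2 (sq L)) = L * L by rewrite leb2_sq.
by rewrite mulrC ler_wpM2l// mulr_ge0// ltW.
Qed.

End CellLayer.

(** * Test functions in L^1(0,T;C) *)

Section NullSets.
Context {R : realType} d (T : measurableType d) (mu : {measure set T -> \bar R}).
Import HBNNSimple.

(* No measurability of f is assumed: the integral of f >= 0 is a supremum over the
   simple functions below f. *)
Lemma integral_setD_null (D N : set T) (f : T -> \bar R) : measurable N -> mu N = 0%E ->
  (\int[mu]_(x in D) f x = \int[mu]_(x in D `\` N) f x)%E.
Proof.
move=> mN N0.
have ge0 (g : T -> \bar R) : (forall x, 0 <= g x)%E ->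
    (\int[mu]_(x in D) g x = \int[mu]_(x in D `\` N) g x)%E.
  move=> g0; rewrite !ge0_integralE//.
  have Dg x : ((g \_ (D `\` N)) x <= (g \_ D) x)%E.
    rewrite /patch; case: ifPn => [/set_mem[Dx _]|_]; first by rewrite mem_set.
    by case: ifP.
  apply/eqP; rewrite eq_le; apply/andP; split; last first.
    apply/ge_ereal_sup => /= _ [h hg <-]; apply: ereal_sup_ubound; exists h => // x.
    exact: le_trans (hg x) (Dg x).
  apply/ge_ereal_sup => /= _ [h hg <-].
  apply: ereal_sup_ubound; exists (proj_nnsfun h (measurableC mN)).
    move=> x; rewrite -mrestrict /patch; case: ifPn => [/set_mem Nx|_].
      have := hg x; rewrite /patch; case: ifPn => [/set_mem Dx|Dx].
        by rewrite mem_set.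
      by rewrite memNset// => -[]; move/negP : Dx => Dx /mem_set.
    by case: ifP.
  rewrite -mrestrict -integral_nnsfun; last exact: measurableC.
  rewrite -integralT_nnsfun -setTD; apply/esym.
  apply: ge0_negligible_integral => //.
    by apply/measurable_EFinP; exact: measurable_funTS.
  by move=> x _; rewrite lee_fin.
by rewrite integralE [RHS]integralE !ge0.
Qed.

End NullSets.

(** * Pairing charges with continuous and with Bochner integrable functions *)

Section ChargePairing.
Context {R : realType}.
Local Notation leb := (@lebesgue_measure R).
Variable L : R.
Local Notation Cb := (cell_bar L).
Implicit Types (nu : {charge set (mpt R) -> \bar R}) (g : pt R -> R).

Lemma cell_bar_measurable g : {within Cb, continuous g} ->
  measurable_fun (Cb : set (mpt R)) g.
Proof. by apply: within_continuous_measurable; exact: measurable_cell_bar. Qed.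

Lemma cell_bar_integrable (m : {measure set (mpt R) -> \bar R}) g : (m setT < +oo)%E ->
  {within Cb, continuous g} -> m.-integrable (Cb : set (mpt R)) (EFin \o g).
Proof.
move=> mT cg; have [B _ gB] := cell_bar_bounded cg.
exact: (bounded_integrable mT (@measurable_cell_bar R L) (cell_bar_measurable cg) gB).
Qed.

Lemma charge_int_bound nu g (B K : R) : {within Cb, continuous g} ->
  (forall p, Cb p -> `|g p| <= B) -> (charge_variation (hahnP nu) setT <= K%:E)%E -> 0 <= B ->
  `|charge_int Cb nu g| <= B * K.
Proof.
move=> cg gB vK B0; have [jp jn] := jordan_finite nu.
have mCb := @measurable_cell_bar R L.
have bnd (m : {measure set (mpt R) -> \bar R}) : (m setT < +oo)%E ->
    `|\int[m]_(p in (Cb : set (mpt R))) g p| <= B * fine (m setT).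
  move=> mT; apply: le_trans (le_normr_Rintegral _ _) _ => //.
    exact: cell_bar_integrable.
  have iB : m.-integrable (Cb : set (mpt R)) (EFin \o (fun _ => B)).
    by apply: cell_bar_integrable => // x; exact: cvg_cst.
  have ig : m.-integrable (Cb : set (mpt R)) (EFin \o (fun p => `|g p|)).
    by apply: cell_bar_integrable => // x; apply: cvg_norm; exact: cg.
  apply: le_trans (le_Rintegral mCb ig iB gB) _.
  rewrite Rintegral_cst// ler_wpM2l// fine_le//.
  - exact: finite_le_setT.
  - exact: finite_le_setT.
  - by rewrite le_measure ?inE.
move: vK; rewrite /charge_variation/=.
rewrite -[X in (X + _)%E]fineK ?ge0_fin_numE// -[X in (_ + X)%E]fineK ?ge0_fin_numE//.
rewrite -EFinD lee_fin => vK.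
apply: le_trans (ler_normB _ _) _; apply: le_trans (lerD (bnd _ jp) (bnd _ jn)) _.
by rewrite -mulrDr ler_wpM2l.
Qed.

Lemma charge_int_lin nu g g' (a : R) : {within Cb, continuous g} -> {within Cb, continuous g'} ->
  charge_int Cb nu (fun p => a * g p + g' p) = a * charge_int Cb nu g + charge_int Cb nu g'.
Proof.
move=> cg cg'; have [jp jn] := jordan_finite nu; have mCb := @measurable_cell_bar R L.
have cag : {within Cb, continuous (fun p => a * g p)}.
  by move=> x; exact: (cvgM (cvg_cst a) (cg x)).
have lin (m : {measure set (mpt R) -> \bar R}) : (m setT < +oo)%E ->
    \int[m]_(p in (Cb : set (mpt R))) (a * g p + g' p) =
    a * \int[m]_(p in (Cb : set (mpt R))) g p + \int[m]_(p in (Cb : set (mpt R))) g' p.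
  move=> mT; rewrite RintegralD//; [|exact: cell_bar_integrable|exact: cell_bar_integrable].
  by rewrite RintegralZl//; exact: cell_bar_integrable.
by rewrite /charge_int !lin//; ring.
Qed.

Lemma charge_int0 nu : charge_int Cb nu (fun _ => 0) = 0.
Proof. by rewrite /charge_int /Rintegral !integral0_eq// subrr. Qed.

Lemma continuous_simple (n : nat) (c : 'I_n -> R) (g : 'I_n -> pt R -> R) :
  (forall k, {within Cb, continuous (g k)}) ->
  {within Cb, continuous (fun p => \sum_(k < n) c k * g k p)}.
Proof.
move=> cg; elim: n c g cg => [|n IH] c g cg.
  under eq_fun do rewrite big_ord0.
  by move=> x; exact: cvg_cst.
under eq_fun do rewrite big_ord_recl.
move=> x; apply: cvgD; first exact: (cvgM (cvg_cst _) (cg ord0 x)).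
exact: (IH (fun k => c (lift ord0 k)) (fun k => g (lift ord0 k)) (fun k => cg _)).
Qed.

Lemma charge_int_sum nu (n : nat) (c : 'I_n -> R) (g : 'I_n -> pt R -> R) :
  (forall k, {within Cb, continuous (g k)}) ->
  charge_int Cb nu (fun p => \sum_(k < n) c k * g k p) =
  \sum_(k < n) c k * charge_int Cb nu (g k).
Proof.
move=> cg; elim: n c g cg => [|n IH] c g cg.
  by under eq_fun do rewrite big_ord0; rewrite big_ord0 charge_int0.
under eq_fun do rewrite big_ord_recl.
rewrite charge_int_lin//; last exact: (continuous_simple (c := fun k => c (lift ord0 k))).
rewrite big_ord_recl; congr (_ + _).
exact: (IH (fun k => c (lift ord0 k)) (fun k => g (lift ord0 k))).
Qed.

End ChargePairing.

Section Supnorm.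
Context {R : realType}.
Variables (L : R) (L0 : 0 < L).
Local Notation Cb := (cell_bar L).
Implicit Types (g : pt R -> R).
Definition nrm g : R := fine (supnorm Cb g).

Let Cb0 : Cb (0, 0, 0).
Proof. by split; rewrite /= lexx ?ler01 ?ltW. Qed.

Lemma supnorm_fin g : {within Cb, continuous g} -> supnorm Cb g \is a fin_num.
Proof.
move=> cg; have [B B0 gB] := cell_bar_bounded cg.
rewrite ge0_fin_numE.
  apply: (@le_lt_trans _ _ B%:E); last exact: ltry.
  by apply/ge_ereal_sup => _ [p hp <-]; rewrite lee_fin gB.
apply: (@le_trans _ _ (`|g (0, 0, 0)|%:E)); first by rewrite lee_fin.
by apply: ereal_sup_ubound; exists (0, 0, 0).
Qed.

Lemma le_nrm g p : {within Cb, continuous g} -> Cb p -> `|g p| <= nrm g.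
Proof.
move=> cg hp; rewrite -lee_fin fineK; last exact: supnorm_fin.
by apply: ereal_sup_ubound; exists p.
Qed.

Lemma nrm_le g B : {within Cb, continuous g} -> (forall p, Cb p -> `|g p| <= B) -> nrm g <= B.
Proof.
move=> cg gB; rewrite -lee_fin fineK; last exact: supnorm_fin.
by apply/ge_ereal_sup => _ [p hp <-]; rewrite lee_fin gB.
Qed.

Lemma nrm_ge0 g : {within Cb, continuous g} -> 0 <= nrm g.
Proof. by move=> cg; exact: le_trans (normr_ge0 _) (le_nrm cg Cb0). Qed.

Lemma nrm_dist g g' : {within Cb, continuous g} -> {within Cb, continuous g'} ->
  `|nrm g - nrm g'| <= nrm (g \- g').
Proof.
move=> cg cg'.
have cd : {within Cb, continuous (g \- g')} by move=> x; apply: cvgB; [exact: cg|exact: cg'].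
rewrite ler_distl; apply/andP; split.
  rewrite lerBlDr; apply: nrm_le => // p hp.
  have -> : g' p = g p - (g \- g') p by rewrite /=; ring.
  by apply: le_trans (ler_normB _ _) _; apply: lerD; exact: le_nrm.
apply: nrm_le => // p hp.
have -> : g p = g' p + (g \- g') p by rewrite /=; ring.
by apply: le_trans (ler_normD _ _) _; apply: lerD; exact: le_nrm.
Qed.

(** Such a function takes one value for each of the finitely many patterns of membership in the
    [E k]. It serves the norm of a simple function, which is not linear in the indicators. *)
Lemma measurable_pattern (n : nat) (E : 'I_n -> set R) (F : {ffun 'I_n -> bool} -> R) :
  (forall k, measurable (E k)) ->
  measurable_fun setT (fun t : R => F [ffun k => t \in E k]).
Proof.
move=> mE _ B mB; rewrite setTI.
have -> : (fun t : R => F [ffun k => t \in E k]) @^-1` B =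
    \bigcup_(a : {ffun 'I_n -> bool})
      (if F a \in B then \bigcap_(k : 'I_n) (if a k then E k else ~` E k) else set0).
  apply/seteqP; split => [t /= Ft|t [a _]].
    exists [ffun k => t \in E k] => //; rewrite mem_set// => k _; rewrite ffunE.
    by case: ifPn => [/set_mem//|/negP] H /mem_set.
  case: ifPn => // /set_mem FB H /=.
  suff -> : [ffun k => t \in E k] = a by [].
  apply/ffunP => k; rewrite ffunE; have := H k I; case: (a k).
    by move/mem_set.
  by move=> nE; apply/negbTE/negP => /set_mem.
apply: countable_bigcupT_measurable => // a; case: ifPn => // _.
rewrite -[X in measurable X]setCK setC_bigcap; apply: measurableC.
apply: countable_bigcupT_measurable => // k; apply: measurableC.
by case: (a k) => //; exact: measurableC.
Qed.

Lemma measurable_nrm_simple (n : nat) (E : 'I_n -> set R) (g : 'I_n -> pt R -> R) :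
  (forall k, measurable (E k)) ->
  measurable_fun setT (fun t : R => nrm (fun p => \sum_(k < n) \1_(E k) t * g k p)).
Proof.
move=> mE.
pose F (a : {ffun 'I_n -> bool}) := nrm (fun p => \sum_(k < n) (a k)%:R * g k p).
have := measurable_pattern F mE; congr (measurable_fun _ _); apply/funext => t.
rewrite /F; congr nrm; apply/funext => p; apply: eq_bigr => k _.
by rewrite ffunE indicE.
Qed.

End Supnorm.

Section BochnerTests.
Context {R : realType}.
Local Notation leb := (@lebesgue_measure R).
Local Notation R1 := (measurableTypeR R).
Variables (T L : R) (L0 : 0 < L).
Local Notation Cb := (cell_bar L).

Lemma simple_C_cont s t : simple_C L s -> {within Cb, continuous (s t)}.
Proof. by move=> [n [E [g [_ cg ->]]]]; exact: continuous_simple. Qed.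

(** The approximation by simple functions holds only off a null set, and measurability of the norm
    and of the pairings is obtained only there, as a limit. One [N] serves all families [lam] of
    charges. *)
Lemma L1_C_data (phi : R -> pt R -> R) : L1_C T L phi ->
  exists N : set R, [/\ measurable N, leb N = 0%E,
    leb.-integrable (`]0, T[ `\` N) (EFin \o (fun t => nrm L (phi t))) &
    forall (lam : R -> {charge set (mpt R) -> \bar R}) (K : R),
      (forall g, {within Cb, continuous g} ->
        measurable_fun `]0, T[ (fun t => charge_int Cb (lam t) g)) ->
      (forall t, 0 < t < T -> (charge_variation (hahnP (lam t)) setT <= K%:E)%E) ->
      measurable_fun (`]0, T[ `\` N) (fun t => charge_int Cb (lam t) (phi t))].
Proof.
move=> [cphi [s ss [N [mN N0 hN]]] iphi].
exists N.
have mD : measurable (`]0, T[ `\` N) by apply: measurableD => //; exact: measurable_itv.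
have cs n t : {within Cb, continuous (s n t)} := @simple_C_cont (s n) t (ss n).
have DT t : (`]0, T[ `\` N) t -> 0 < t < T by case; rewrite /= in_itv.
have cd n t : 0 < t < T -> {within Cb, continuous (s n t \- phi t)}.
  by move=> ht x; apply: cvgB; [exact: cs|exact: cphi].
have nrm0 t : (`]0, T[ `\` N) t -> nrm L (s n t \- phi t) @[n --> \oo] --> 0.
  move=> Dt; have ht := DT t Dt.
  have := contrapT (contra_not (@hN t) Dt.2) => /= /(_ ht).
  by move/fine_cvg.
split => //.
- have mn : measurable_fun (`]0, T[ `\` N) (fun t => nrm L (phi t)).
    apply: (@measurable_fun_cvg _ _ _ _ (fun n t => nrm L (s n t))).
      move=> n; have [k [E [g [mE cg ->]]]] := ss n.
      by apply: measurable_funTS; exact: measurable_nrm_simple.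
    move=> t Dt; have ht := DT t Dt; apply/subr_cvg0.
    apply/norm_cvg0P; apply: (squeeze_cvgr _ (cvg_cst 0) (nrm0 t Dt)).
    by apply: nearW => n; rewrite normr_ge0/=; apply: nrm_dist => //; exact: cphi.
  apply/integrableP; split; first exact/measurable_EFinP.
  apply: le_lt_trans iphi; rewrite (@integral_setD_null _ _ _ leb `]0, T[ N _ mN N0).
  rewrite le_eqVlt; apply/orP; left; apply/eqP; apply: eq_integral => t /set_mem Dt.
  have ht := DT t Dt; rewrite /= ger0_norm; last by apply: nrm_ge0 => //; exact: cphi.
  by rewrite /nrm fineK//; apply: supnorm_fin => //; exact: cphi.
- move=> lam K mlam vK.
  apply: (@measurable_fun_cvg _ _ _ _ (fun n t => charge_int Cb (lam t) (s n t))).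
    move=> n; have [k [E [g [mE cg ->]]]] := ss n.
    have -> : (fun t => charge_int Cb (lam t) (fun p => \sum_(j < k) \1_(E j) t * g j p)) =
       (fun t => \sum_(j < k) \1_(E j) t * charge_int Cb (lam t) (g j)).
      by apply/funext => t; rewrite charge_int_sum.
    apply: measurable_sum => j; apply: measurable_funM.
      by apply: measurable_funTS; exact: measurable_indic.
    exact: (measurable_funS (measurable_itv _) (@subDsetl _ _ _) (mlam (g j) (cg j))).
  move=> t Dt; have ht := DT t Dt; apply/subr_cvg0.
  have H : nrm L (s n t \- phi t) * K @[n --> \oo] --> 0.
    by rewrite -(mul0r K); apply: cvgM; [exact: nrm0|exact: cvg_cst].
  apply/norm_cvg0P; apply: (squeeze_cvgr _ (cvg_cst 0) H).
  apply: nearW => n; rewrite normr_ge0/=.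
  have cpt := cphi t ht.
  have -> : charge_int Cb (lam t) (s n t) - charge_int Cb (lam t) (phi t) =
      charge_int Cb (lam t) (s n t \- phi t).
    transitivity (charge_int Cb (lam t) (fun p => -1 * phi t p + s n t p)).
      by rewrite charge_int_lin//; ring.
    by congr charge_int; apply/funext => p /=; ring.
  apply: charge_int_bound; [exact: cd| |exact: vK|by apply: nrm_ge0 => //; exact: cd].
  by move=> p hp; apply: le_nrm => //; exact: cd.
Qed.

(** The total variation bound [K] gives the dominating function [K] times the norm of the test
    function, which is integrable in time once the null sets have been removed. *)
Lemma pairing_cvg (lam_ : nat -> R -> vcharge) (lam : R -> vcharge)
    (phi : 'I_3 -> R -> pt R -> R) (K : R) :
  (forall n i g, {within Cb, continuous g} ->
     measurable_fun `]0, T[ (fun t => charge_int Cb (lam_ n t i) g)) ->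
  (forall i g, {within Cb, continuous g} ->
     measurable_fun `]0, T[ (fun t => charge_int Cb (lam t i) g)) ->
  (forall n t i, 0 < t < T -> (charge_variation (hahnP (lam_ n t i)) setT <= K%:E)%E) ->
  (forall t i, 0 < t < T -> (charge_variation (hahnP (lam t i)) setT <= K%:E)%E) ->
  (forall t i g, 0 < t < T -> {within Cb, continuous g} ->
     charge_int Cb (lam_ n t i) g @[n --> \oo] --> charge_int Cb (lam t i) g) ->
  (forall i, L1_C T L (phi i)) ->
  pairing T L (lam_ n) phi @[n --> \oo] --> pairing T L lam phi.
Proof.
move=> mlam_ mlam vK_ vK cvg_lam hphi.
pose N i := projT1 (cid (L1_C_data (hphi i))).
have hN i := projT2 (cid (L1_C_data (hphi i))).
(* The three exceptional sets are padded with [set0] to a sequence, so that the results on countable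
   unions apply. *)
pose F (k : nat) := if insub k is Some i then N i else set0.
have mF k : measurable (F k) by rewrite /F; case: insub => // i; have [] := hN i.
pose N0 := \bigcup_k F k.
have mN0 : measurable N0 by exact: bigcupT_measurable.
have N00 : leb N0 = 0%E.
  apply: (negligibleP leb mN0).1; apply: negligible_bigcup => k.
  apply: (negligibleP leb (mF k)).2; rewrite /F; case: insub => [i|]; last exact: measure0.
  by have [] := hN i.
pose D := `]0, T[ `\` N0.
have mD : measurable (D : set R1) by apply: measurableD => //; exact: measurable_itv.
have DN i : D `<=` `]0, T[ `\` N i.
  by move=> t [ht nN]; split => // Nt; apply: nN; exists (val i) => //; rewrite /F valK.
have DT t : D t -> 0 < t < T by case; rewrite /= in_itv.
have mDN i : measurable (`]0, T[ `\` N i : set R1).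
  by apply: measurableD; [exact: measurable_itv|have [] := hN i].
have cphi i t : 0 < t < T -> {within Cb, continuous (phi i t)} by have [H _ _] := hphi i; exact: H.
rewrite /pairing /Rintegral.
under eq_fun do rewrite (@integral_setD_null _ _ _ leb `]0, T[ N0 _ mN0 N00).
rewrite (@integral_setD_null _ _ _ leb `]0, T[ N0 _ mN0 N00) -/D.
pose c (l : R -> vcharge) t := \sum_(i < 3) charge_int Cb (l t i) (phi i t).
have mc (l : R -> vcharge) : (forall i g, {within Cb, continuous g} ->
     measurable_fun `]0, T[ (fun t => charge_int Cb (l t i) g)) ->
   (forall t i, 0 < t < T -> (charge_variation (hahnP (l t i)) setT <= K%:E)%E) ->
   measurable_fun D (EFin \o c l).
  move=> ml vl; apply/measurable_EFinP; apply: measurable_sum => i.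
  have [_ _ _ H] := hN i.
  have H1 := H (fun t => l t i) K (ml i) (fun t => vl t i).
  exact: (@measurable_funS _ _ R1 _ _ _ _ (mDN i) (@DN i) H1).
pose G t := \sum_(i < 3) K * nrm L (phi i t).
have iG : leb.-integrable D (EFin \o G).
  have -> : EFin \o G = (fun t => \sum_(i < 3) (K%:E * (nrm L (phi i t))%:E))%E.
    by apply/funext => t; rewrite /= /G -sumEFin.
  apply: integrable_sum => // i _; apply: integrableZl => //.
  have [_ _ H _] := hN i.
  exact: (@integrableS _ _ _ leb _ _ _ (mDN i) mD (@DN i) H).
have cG (l : R -> vcharge) t : D t ->
   (forall t i, 0 < t < T -> (charge_variation (hahnP (l t i)) setT <= K%:E)%E) ->
   `|c l t| <= G t.
  move=> Dt vl; have ht := DT t Dt; apply: le_trans (ler_norm_sum _ _ _) _.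
  apply: ler_sum => i _; rewrite mulrC; apply: charge_int_bound; [exact: cphi| |exact: vl|].
    by move=> p hp; apply: le_nrm => //; exact: cphi.
  by apply: nrm_ge0 => //; exact: cphi.
have cc : {ae leb, forall t, D t -> (EFin \o c (lam_ n)) t @[n --> \oo] --> (EFin \o c lam) t}.
  apply: aeW => t Dt; have ht := DT t Dt; apply: cvg_EFin; first exact: nearW.
  apply: (cvg_big add_continuous) => i _; apply: cvg_lam => //; exact: cphi.
have cGE : {ae leb, forall t n, D t -> (`|(EFin \o c (lam_ n)) t| <= (EFin \o G) t)%E}.
  by apply: aeW => t n Dt; rewrite /= lee_fin; exact: (cG (lam_ n) t Dt (vK_ n)).
have mc_ n : measurable_fun (D : set R1) (EFin \o c (lam_ n)) := mc (lam_ n) (mlam_ n) (vK_ n).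
have mc0 : measurable_fun (D : set R1) (EFin \o c lam) := mc lam mlam vK.
have [i0 _ H] := dominated_convergence mD mc_ mc0 cc iG cGE.
apply: fine_cvg; rewrite fineK; first exact: H.
exact: integrable_fin_num.
Qed.

End BochnerTests.

Section Densities.
Context {R : realType}.
Local Notation leb := (@lebesgue_measure R).
Variables (T L : R).
Local Notation Cb := (cell_bar L).
Implicit Types (nu : {charge set (mpt R) -> \bar R}) (g : pt R -> R).

(** The Hahn sets of a sum are unrelated to those of its terms, so that additivity cannot be read
    off the definition. The sums of the Jordan parts split the sum of the charges, and
    [charge_int_splits] concludes. *)
Lemma charge_int_cadd nu nu' g : {within Cb, continuous g} ->
  charge_int Cb (cadd nu nu') g = charge_int Cb nu g + charge_int Cb nu' g.
Proof.
move=> cg; have [B _ gB] := cell_bar_bounded cg.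
have mCb := @measurable_cell_bar R L; have mg := cell_bar_measurable cg.
rewrite (charge_int_splits (splits_cadd (splits_jordan nu) (splits_jordan nu')) mCb mg gB).
have [jp jn] := jordan_finite nu; have [jp' jn'] := jordan_finite nu'.
have add (m m' : {measure set (mpt R) -> \bar R}) : (m setT < +oo)%E -> (m' setT < +oo)%E ->
    \int[measure_add m m']_(p in (Cb : set (mpt R))) g p =
    \int[m]_(p in (Cb : set (mpt R))) g p + \int[m']_(p in (Cb : set (mpt R))) g p.
  move=> mT mT'; have i1 := cell_bar_integrable mT cg; have i2 := cell_bar_integrable mT' cg.
  rewrite /Rintegral -fineD; [|exact: integrable_fin_num|exact: integrable_fin_num].
  by rewrite (integral_measure_add mCb i1 i2).
by rewrite !add// /charge_int; ring.
Qed.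

Lemma variation_cadd nu nu' (K K' : R) :
  (charge_variation (hahnP nu) setT <= K%:E)%E -> (charge_variation (hahnP nu') setT <= K'%:E)%E ->
  (charge_variation (hahnP (cadd nu nu')) setT <= (K + K')%:E)%E.
Proof.
move=> h h'.
apply: le_trans (variation_splits (splits_cadd (splits_jordan nu) (splits_jordan nu'))) _.
rewrite !maddE addeACA EFinD; exact: leeD.
Qed.

Section Density.
Variables (mu : {measure set (mpt R) -> \bar R}) (D : set (pt R)) (w h : pt R -> R) (B : R).
Hypotheses (mD : measurable (D : set (mpt R))) (muD : (mu D < +oo)%E) (DCb : D `<=` Cb)
  (mw : measurable_fun (D : set (mpt R)) w) (wB : forall p, D p -> `|w p| <= B)
  (hw : forall p, D p -> h p = w p).

Let hwE : h \_ D = w \_ D.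
Proof. by apply/eq_restrictP => p /set_mem /hw. Qed.

Let iw : mu.-integrable (D : set (mpt R)) (EFin \o w).
Proof.
apply: measurable_bounded_integrable => //.
by exists B; split; [exact: num_real|move=> x Bx p Dp; exact: le_trans (wB Dp) (ltW Bx)].
Qed.

Let ih : mu.-integrable setT (fun p => ((h \_ D) p)%:E).
Proof.
rewrite hwE; have -> : (fun p => ((w \_ D) p)%:E) = (EFin \o w) \_ D.
  by apply/funext => p; rewrite /patch; case: ifP.
exact: (integrable_mkcond _ mD).1.
Qed.

(** [h] is the density as it stands in the definitions, and [w] an explicit formula that agrees with
    it on [D]; the values of [h] elsewhere are cut off. *)
Lemma density_charge_int g : {within Cb, continuous g} ->
  charge_int Cb (density_charge mu D h) g = \int[mu]_(p in (D : set (mpt R))) (g p * w p).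
Proof.
move=> cg; have [B' _ gB] := cell_bar_bounded cg.
have mCb := @measurable_cell_bar R L; have mg := cell_bar_measurable cg.
have [m1 [m2 [sp _ E]]] := density_splits ih.
rewrite (charge_int_splits sp mCb mg gB) (E _ _ _ mCb mg gB) hwE /Rintegral; congr fine.
rewrite [LHS]integral_mkcond [RHS]integral_mkcond; apply: eq_integral => p _.
rewrite /patch; case: (boolP (p \in D)) => Dp.
  by rewrite mem_set//; apply/DCb/set_mem.
by rewrite mulr0; case: ifP.
Qed.

Lemma density_charge_variation :
  (charge_variation (hahnP (density_charge mu D h)) setT <= \int[mu]_(p in (D : set (mpt R))) `|w p|%:E)%E.
Proof.
have [m1 [m2 [sp V _]]] := density_splits ih.
apply: le_trans (variation_splits sp) _; rewrite V hwE [leRHS]integral_mkcond.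
rewrite le_eqVlt; apply/orP; left; apply/eqP; apply: eq_integral => p _.
by rewrite /patch; case: ifP => // _; rewrite normr0.
Qed.

Lemma density_charge_out A : measurable A -> A `&` Cb = set0 -> density_charge mu D h A = 0%E.
Proof.
move=> mA A0; rewrite /density_charge; case: pselect => // ih'.
transitivity (\int[mu]_(x in A) ((h \_ D) x)%:E)%E; first by [].
apply: integral0_eq => p Ap; rewrite /patch; case: ifPn => // /set_mem Dp.
have : (A `&` Cb) p by split => //; exact: DCb.
by rewrite A0.
Qed.

End Density.

(** For each point the density is continuous in time, so that by domination its integral is
    continuous on the open time interval, hence measurable. *)
Lemma density_measurable_time (mu : {measure set (mpt R) -> \bar R}) (D : set (pt R))
    (w : R -> pt R -> R) (h : R -> pt R -> R) (B : R) g :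
  measurable (D : set (mpt R)) -> (mu D < +oo)%E -> D `<=` Cb ->
  (forall t, 0 < t < T -> measurable_fun (D : set (mpt R)) (w t)) ->
  (forall t p, 0 < t < T -> D p -> `|w t p| <= B) ->
  (forall t p, 0 < t < T -> D p -> h t p = w t p) ->
  (forall t p, 0 < t < T -> D p -> {for t, continuous (w ^~ p)}) ->
  {within Cb, continuous g} ->
  measurable_fun `]0, T[ (fun t => charge_int Cb (density_charge mu D (h t)) g).
Proof.
move=> mD muD DCb mw wB hw cw cg; have [B' B'0 gB] := cell_bar_bounded cg.
have tT t : `]0, T[%classic t -> 0 < t < T by rewrite /= in_itv.
apply: (eq_measurable_fun (fun t => \int[mu]_(p in (D : set (mpt R))) (g p * w t p))).
  move=> t /set_mem/tT ht; apply/esym; apply: (density_charge_int (B := B)) => //; first exact: mw.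
    by move=> p; exact: wB.
  by move=> p; exact: hw.
apply: open_continuous_measurable_fun; first exact: interval_open.
have mgD : measurable_fun (D : set (mpt R)) g.
  by apply: measurable_funS (cell_bar_measurable cg) => //; exact: measurable_cell_bar.
have B0 t p : 0 < t < T -> D p -> `|g p * w t p| <= B' * B.
  by move=> ht Dp; rewrite normrM; apply: ler_pM => //; [exact/gB/DCb|exact: wB].
have bnd (f : pt R -> R) b : measurable_fun (D : set (mpt R)) f -> (forall p, D p -> `|f p| <= b) ->
    mu.-integrable (D : set (mpt R)) (EFin \o f).
  move=> mf fb; apply: measurable_bounded_integrable => //.
  by exists b; split; [exact: num_real|move=> x Bx p Dp; exact: le_trans (fb p Dp) (ltW Bx)].
apply: (@continuity_under_integral _ _ _ mu (fun t p => g p * w t p) D mD 0 T _ _ (fun _ => `|B' * B|)).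
- move=> t /tT ht; apply: (bnd (fun p => g p * w t p) (B' * B)); last by move=> p; exact: B0.
  by apply: measurable_funM => //; exact: mw.
- apply: aeW => p Dp t /set_mem/tT ht.
  apply: cvgM; first exact: cvg_cst.
  exact: cw.
- by apply: (bnd (fun _ => `|B' * B|) `|B' * B|) => // p _; rewrite normr_id.
- move=> t /tT ht; apply: aeW => p Dp; apply: le_trans (ler_norm _); exact: B0.
Qed.

End Densities.

(** * Vorticity and vortex sheet *)

Section Components.
Context {R : realType}.

Lemma ord3_ind (P : 'I_3 -> Prop) : P 0 -> P 1 -> P 2 -> forall i, P i.
Proof.
move=> P0 P1 P2 [[|[|[|//]]] hi].
- by have -> : Ordinal hi = 0 by exact: val_inj.
- by have -> : Ordinal hi = 1 by exact: val_inj.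
- by have -> : Ordinal hi = 2 by exact: val_inj.
Qed.

Definition curl_comp (u1 : R -> R -> R) (u2 : R -> R -> R -> R) (i : 'I_3) (t : R) (p : pt R) : R :=
  [:: - Dz (lift2 u2) (t, p); Dz (lift1 u1) (t, p); Dx (lift2 u2) (t, p)]`_i.

(** This is the primitive in [z] of the first two components of the curl; up to sign, its wall
    values are the vortex sheet. The third component, [d_x u2], leaves no sheet and gets [0]. *)
Definition wall_comp (u1 : R -> R -> R) (u2 : R -> R -> R -> R) (i : 'I_3) (t : R) (p : pt R) : R :=
  [:: - u2 t p.1.1 p.2; u1 t p.2; 0]`_i.

Lemma curlE u1 u2 t p i : curl (plane_parallel u1 u2 t) p 0 i = curl_comp u1 u2 i t p.
Proof.
case: p => [[x y] z].
have d0 j : 'D_(dir3 j) (fun q => plane_parallel u1 u2 t q 0 2) (x, y, z) = 0.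
  have -> : (fun q => plane_parallel u1 u2 t q 0 2) = cst 0.
    by apply/funext => q; rewrite plane_parallelE2.
  exact: derive_cst.
have dz2 : 'D_(dir3 2) (fun q => plane_parallel u1 u2 t q 0 1) (x, y, z) = Dz (lift2 u2) (t, (x, y, z)).
  rewrite /Dx /Dz; apply: (@derive_line_eq R _ _ _ (lift2 u2) (x, y, z) _ (t, (x, y, z))) => s; rewrite plane_parallelE1.
  rewrite dirzE /lift2/=.
  by rewrite /dir3/= !scaler0 !add0r /GRing.scale/= mulr1.
have dx2 : 'D_(dir3 0) (fun q => plane_parallel u1 u2 t q 0 1) (x, y, z) = Dx (lift2 u2) (t, (x, y, z)).
  rewrite /Dx /Dz; apply: (@derive_line_eq R _ _ _ (lift2 u2) (x, y, z) _ (t, (x, y, z))) => s; rewrite plane_parallelE1.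
  rewrite dirxE /lift2/=.
  by rewrite /dir3/= !scaler0 !add0r /GRing.scale/= mulr1.
have dz1 : 'D_(dir3 2) (fun q => plane_parallel u1 u2 t q 0 0) (x, y, z) = Dz (lift1 u1) (t, (x, y, z)).
  rewrite /Dz; apply: (@derive_line_eq R _ _ _ (lift1 u1) (x, y, z) _ (t, (x, y, z))) => s; rewrite plane_parallelE0.
  rewrite dirzE /lift1/=.
  by rewrite /dir3/= /GRing.scale/= mulr1.
have dy1 : 'D_(dir3 1) (fun q => plane_parallel u1 u2 t q 0 0) (x, y, z) = 0.
  rewrite (@derive_line_eq R _ _ _ (cst (u1 t z) : pt R -> R) (x, y, z) _ (x, y, z) (dir3 1)); first exact: derive_cst.
  by move=> s; rewrite plane_parallelE0 /= scaler0 add0r.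
rewrite /curl mxE; move: i; apply: ord3_ind; rewrite /curl_comp /=.
- by rewrite d0 dz2 sub0r.
- by rewrite d0 dz1 subr0.
- by rewrite dy1 dx2 subr0.
Qed.

(** [1 - 2 z] is [1] at [z = 0] and [-1] at [z = 1], that is, minus the third component of the outer
    normal. It unifies the two walls and matches the signs of an integration by parts. *)
Lemma crossE u1 u2 L t p i : walls L p ->
  crossv (plane_parallel u1 u2 t p) (outer_normal p) 0 i = (1 - 2 * p.2) * wall_comp u1 u2 i t p.
Proof.
move=> [_ /= hp].
have n0 : outer_normal p 0 0 = 0 by rewrite /outer_normal; case: ifP => _; rewrite mxE.
have n1 : outer_normal p 0 1 = 0 by rewrite /outer_normal; case: ifP => _; rewrite mxE.
have n2 : outer_normal p 0 2 = - (1 - 2 * p.2).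
  rewrite /outer_normal; case: hp => hp; rewrite hp ?eqxx ?oner_eq0 mxE/=; ring.
rewrite /crossv mxE n0 n1 n2 plane_parallelE0 plane_parallelE1 plane_parallelE2.
move: i; apply: ord3_ind; rewrite /wall_comp /=; ring.
Qed.

Variables (T L : R) (u1 : R -> R -> R) (u2 : R -> R -> R -> R).
Hypotheses (hT : 0 < T) (hL : 0 < L) (C1u1 : C1_cyl T (lift1 u1)) (C1u2 : C1_cyl T (lift2 u2))
  (per : forall t x z, u2 t (x + L) z = u2 t x z).
Local Notation Cb := (cell_bar L).
Local Notation W := (curl_comp u1 u2).
Local Notation H := (wall_comp u1 u2).

Lemma cell_cyl t p : 0 < t < T -> cell L p -> cyl T (t, p).
Proof. by move=> ht [_ _ hz]. Qed.

Lemma slice_cont (F : st R -> R) t : 0 <= t <= T -> {within cyl_bar T, continuous F} ->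
  {within Cb, continuous (fun p => F (t, p))}.
Proof.
move=> ht cF.
apply: (@within_comp (pt R) (st R) R _ _ (fun p : pt R => (t, p)) F cF).
  by move=> p; exact: (cvg_pair (cvg_cst t) (@cvg_id _ (nbhs p))).
by move=> p [_ _ hz]; split.
Qed.

(** The regularity assumptions control derivatives in the open cylinder only, and the two-sided
    [z]-derivative may fail at the walls. Integrals over closed vertical segments use the extension
    instead. *)
Lemma curl_comp_ext i t : 0 < t < T ->
  exists2 G : pt R -> R, {within Cb, continuous G} & forall p, cell L p -> G p = W i t p.
Proof.
move=> ht; have ht' : 0 <= t <= T by case/andP: ht => /ltW -> /ltW ->.
have [G2 c2 E2] := C1_ext (Some 2) C1u2.
have [G1 c1 E1] := C1_ext (Some 2) C1u1.
have [G3 c3 E3] := C1_ext (Some 0) C1u2.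
move: i; apply: ord3_ind.
- exists (fun p => - G2 (t, p)).
    have cs : {within Cb, continuous (fun p => G2 (t, p))} by exact: slice_cont.
    by move=> p; apply: cvgN; exact: (cs p).
  by move=> p hp; rewrite /curl_comp/= (E2 _ (cell_cyl ht hp)).
- exists (fun p => G1 (t, p)); first exact: slice_cont.
  by move=> p hp; rewrite /curl_comp/= (E1 _ (cell_cyl ht hp)).
- exists (fun p => G3 (t, p)); first exact: slice_cont.
  by move=> p hp; rewrite /curl_comp/= (E3 _ (cell_cyl ht hp)).
Qed.

Lemma curl_comp_measurable i t : 0 < t < T -> measurable_fun (cell L : set (mpt R)) (W i t).
Proof.
move=> ht; have [G cG GE] := curl_comp_ext i ht.
by apply: eq_measurable_fun (cell_measurable cG) => p /set_mem; exact: GE.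
Qed.

Lemma curl_comp_cont i t p : 0 < t < T -> cell L p -> {for t, continuous ((W i)^~ p)}.
Proof.
move=> ht hp; have cp := cell_cyl ht hp.
have path (F : st R -> R) : {for (t, p), continuous F} -> {for t, continuous (fun s => F (s, p))}.
  move=> cF; apply: (@cvg_comp _ _ _ (fun s : R => (s, p)) F _ _ _ _ cF).
  exact: (cvg_pair (@cvg_id _ (nbhs t)) (cvg_cst p)).
move: i; apply: ord3_ind; rewrite /curl_comp/=.
- by apply: cvgN; apply: (path (Dz (lift2 u2))); exact: C1_derive_cont C1u2 cp.
- by apply: (path (Dz (lift1 u1))); exact: C1_derive_cont C1u1 cp.
- by apply: (path (Dx (lift2 u2))); exact: C1_derive_cont C1u2 cp.
Qed.

Let per1 t x z : (fun t (_ : R) z => u1 t z) t (x + L) z = (fun t (_ : R) z => u1 t z) t x z.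
Proof. by []. Qed.

Lemma Dz_indep_y t x y z : Dz (lift2 u2) (t, ((x, y), z)) = Dz (lift2 u2) (stpt t x z).
Proof. exact: (indep_y_derive _ (@lift2_indep_y R u2)). Qed.

Lemma Dx_indep_y t x y z : Dx (lift2 u2) (t, ((x, y), z)) = Dx (lift2 u2) (stpt t x z).
Proof. exact: (indep_y_derive _ (@lift2_indep_y R u2)). Qed.

Lemma Dz1_indep_y t x y z : Dz (lift1 u1) (t, ((x, y), z)) = Dz (lift1 u1) (stpt t x z).
Proof. exact: (indep_y_derive _ (@lift2_indep_y R (fun t _ z => u1 t z))). Qed.

(** The bound concerns one flow and is not uniform in the viscosities; it provides integrability.
    The uniform bound of the total variation is [vorticity_variation_seq]. *)
Lemma curl_comp_bound : exists2 B, 0 <= B & forall i t p, 0 < t < T -> cell L p -> `|W i t p| <= B.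
Proof.
have [G2 c2 E2] := C1_ext (Some 2) C1u2.
have [G1 c1 E1] := C1_ext (Some 2) C1u1.
have [G3 c3 E3] := C1_ext (Some 0) C1u2.
have p2 := lift2_periodic_x per; have p1 := lift2_periodic_x per1.
have [B2 B20 h2] := cyl_bounded hL c2 (periodic_x_derive _ p2) E2.
have [B1 B10 h1] := cyl_bounded hL c1 (periodic_x_derive _ p1) E1.
have [B3 B30 h3] := cyl_bounded hL c3 (periodic_x_derive _ p2) E3.
exists (B1 + B2 + B3); first by rewrite !addr_ge0.
move=> + t [[x y] z] ht [_ _ hz]; apply: ord3_ind; rewrite /curl_comp/=.
- rewrite normrN Dz_indep_y; have := h2 t x z ht hz; rewrite /Dz; lra.
- rewrite Dz1_indep_y; have := h1 t x z ht hz; rewrite /Dz; lra.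
- rewrite Dx_indep_y; have := h3 t x z ht hz; rewrite /Dx; lra.
Qed.

Lemma wall_comp_cont i t : 0 <= t <= T -> {within Cb, continuous (H i t)}.
Proof.
move=> ht; move: i; apply: ord3_ind; rewrite /wall_comp/=.
- have cs : {within Cb, continuous (fun p => lift2 u2 (t, p))}.
    by apply: slice_cont => //; exact: C1_cont.
  by move=> p; apply: cvgN; exact: (cs p).
- have cs : {within Cb, continuous (fun p => lift1 u1 (t, p))}.
    by apply: slice_cont => //; exact: C1_cont.
  exact: cs.
- by move=> p; exact: cvg_cst.
Qed.

Lemma wall_comp_derive (i : 'I_3) (t : R) (q : R * R) (z : R) : i != 2 -> 0 < t < T -> 0 < z < 1 ->
  is_derive z (1:R) (fun z : R => H i t (q, z)) (W i t (q, z)).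
Proof.
case: q => x y hi ht hz; move: i hi; apply: ord3_ind => // _; rewrite /wall_comp /curl_comp/=.
- apply: is_deriveN; rewrite Dz_indep_y.
  exact: (is_derive_dz (C1_derivable C1u2 (cylP x ht hz))).
- rewrite Dz1_indep_y.
  exact: (is_derive_dz (C1_derivable C1u1 (cylP x ht hz))).
Qed.

End Components.

Section FlowCharges.
Context {R : realType}.
Local Notation leb := (@lebesgue_measure R).
Variables (T L : R) (u1 : R -> R -> R) (u2 : R -> R -> R -> R).
Hypotheses (hT : 0 < T) (hL : 0 < L) (C1u1 : C1_cyl T (lift1 u1)) (C1u2 : C1_cyl T (lift2 u2))
  (per : forall t x z, u2 t (x + L) z = u2 t x z).
Local Notation Cb := (cell_bar L).
Local Notation W := (curl_comp u1 u2).
Local Notation H := (wall_comp u1 u2).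
Local Notation vort t i := (vorticity L (plane_parallel u1 u2) t i).
Local Notation sheet t i := (vortex_sheet L (plane_parallel u1 u2) t i).

Let mcell := @measurable_cell R L.
Let cell_fin : (leb3 (cell L : set (mpt R)) < +oo)%E.
Proof. by rewrite leb3_cell// ltry. Qed.
Let mwalls := @measurable_walls R L.
Let walls_fin : (surface_measure (walls L : set (mpt R)) < +oo)%E := surface_walls hL.
Let tT_cc t : 0 < t < T -> 0 <= t <= T.
Proof. by move=> /andP[/ltW -> /ltW ->]. Qed.

Lemma vorticity_int i t g : 0 < t < T -> {within Cb, continuous g} ->
  charge_int Cb (vort t i) g = \int[leb3]_(p in cell L) (g p * W i t p).
Proof.
move=> ht cg; have [B _ hB] := curl_comp_bound hL C1u1 C1u2 per.
apply: (density_charge_int (B := B)) => //.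
- exact: cell_sub.
- exact: (curl_comp_measurable (T := T)).
- by move=> p; exact: hB.
- by move=> p _; exact: curlE.
Qed.

Lemma vorticity_variation i t : 0 < t < T ->
  (charge_variation (hahnP (vort t i)) setT <= (\int[leb3]_(p in cell L) `|W i t p|)%:E)%E.
Proof.
move=> ht; have [B _ hB] := curl_comp_bound hL C1u1 C1u2 per.
have mW : measurable_fun (cell L : set (mpt R)) (W i t) by exact: (curl_comp_measurable (T := T)).
apply: le_trans (density_charge_variation (w := W i t) (B := B) _ _ _ _ _) _ => //.
- by move=> p; exact: hB.
- by move=> p _; exact: curlE.
rewrite /Rintegral fineK//; apply: integrable_fin_num => //.
apply: (measurable_bounded_integrable mcell cell_fin); first exact: measurableT_comp.
exists B; split; first exact: num_real.
by move=> x Bx p Dp; rewrite /= normr_id; exact: le_trans (hB i t p ht Dp) (ltW Bx).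
Qed.

Lemma vorticity_variation_bounded : exists K, forall i t, 0 < t < T ->
  (charge_variation (hahnP (vort t i)) setT <= K%:E)%E.
Proof.
have [B _ hB] := curl_comp_bound hL C1u1 C1u2 per.
exists (L * L * B) => i t ht; apply: le_trans (vorticity_variation i ht) _.
rewrite lee_fin; apply: (cell_int_le (g := fun _ => B)) => //.
- exact: (curl_comp_measurable (T := T)).
- exact: cst_continuous.
- by move=> p; exact: hB.
- by rewrite Rintegral_unit_cst.
Qed.

Lemma vorticity_measurable i g : {within Cb, continuous g} ->
  measurable_fun `]0, T[ (fun t => charge_int Cb (vort t i) g).
Proof.
move=> cg; have [B _ hB] := curl_comp_bound hL C1u1 C1u2 per.
apply: (@density_measurable_time R T L leb3 (cell L) (W i)
  (fun t p => curl (plane_parallel u1 u2 t) p 0 i) B g) => //.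
- exact: cell_sub.
- by move=> t ht; exact: (curl_comp_measurable (T := T)).
- by move=> t p ht; exact: hB.
- by move=> t p _ _; exact: curlE.
- by move=> t p ht hp; exact: (curl_comp_cont (T := T) (L := L)).
Qed.

Lemma vorticity_out i t A : measurable A -> A `&` Cb = set0 -> vort t i A = 0%E.
Proof. exact: (@density_charge_out _ _ leb3 (cell L) _ (@cell_sub R L)). Qed.

Let wsh i t p := (1 - 2 * p.2) * H i t p.

Let coef_cont : continuous (fun p : pt R => 1 - 2 * p.2).
Proof.
move=> p; apply: cvgB; first exact: cvg_cst.
by apply: cvgM; [exact: cvg_cst|exact: cvg_snd].
Qed.

Let wsh_cont i t : 0 < t < T -> {within Cb, continuous (wsh i t)}.
Proof.
move=> ht; have cH : {within Cb, continuous (H i t)} by apply: (wall_comp_cont (T := T)) => //; exact: tT_cc.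
have cc : {within Cb, continuous (fun p : pt R => 1 - 2 * p.2)} by exact: continuous_subspaceT.
exact: within_mul.
Qed.

Let wsh_measurable i t : 0 < t < T -> measurable_fun (walls L : set (mpt R)) (wsh i t).
Proof.
move=> ht; apply: measurable_funS (cell_bar_measurable (@wsh_cont i t ht)).
  exact: measurable_cell_bar.
exact: walls_sub.
Qed.

Let wsh_bound : exists2 B, 0 <= B & forall i t p, 0 < t < T -> walls L p -> `|wsh i t p| <= B.
Proof.
have [B1 B10 h1] := cyl_bar_bounded hL (C1_cont C1u1).
have [B2 B20 h2] := cyl_bar_bounded hL (C1_cont C1u2).
exists (B1 + B2); first by rewrite addr_ge0.
move=> i t [[x y] z] /tT_cc ht [[/= hx _ hz] hw]; rewrite /wsh normrM /=.
have -> : `|1 - 2 * z| = 1.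
  by case: hw => ->; rewrite ?mulr0 ?mulr1 ?subr0 ?normr1// opprD addrA subrr sub0r normrN1.
rewrite mul1r; have := h1 t x z ht hx hz; have := h2 t x z ht hx hz.
move: i; apply: ord3_ind; rewrite /wall_comp /lift1 /lift2 /= ?normrN ?normr0; lra.
Qed.

(** The right-hand side is written in the very form of the wall terms in [cell_layer_limit]. *)
Lemma sheet_int i t g : 0 < t < T -> {within Cb, continuous g} ->
  charge_int Cb (sheet t i) g =
  \int[leb2]_(q in sq L) (g (q, 0) * H i t (q, 0) - g (q, 1) * H i t (q, 1)).
Proof.
move=> ht cg; have [B _ hB] := wsh_bound.
transitivity (\int[surface_measure]_(p in (walls L : set (mpt R))) (g p * wsh i t p)).
  apply: (density_charge_int (B := B)) => //.
  - exact: walls_sub.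
  - exact: wsh_measurable.
  - by move=> p; exact: hB.
  - by move=> p hp; exact: (crossE u1 u2 t i hp).
have [B' B'0 gB] := cell_bar_bounded cg.
have mgw : measurable_fun (walls L : set (mpt R)) (fun p => g p * wsh i t p).
  apply: measurable_funM; last exact: wsh_measurable.
  by apply: measurable_funS (cell_bar_measurable cg); [exact: measurable_cell_bar|exact: walls_sub].
have gwB p : walls L p -> `|g p * wsh i t p| <= B' * B.
  by move=> hp; rewrite normrM; apply: ler_pM => //; [exact/gB/walls_sub|exact: hB].
have [_ ->] := surface_fubini hL mgw gwB.
by apply: eq_Rintegral => q _; rewrite /wsh /=; ring.
Qed.

Lemma sheet_variation : exists K, forall i t, 0 < t < T ->
  (charge_variation (hahnP (sheet t i)) setT <= K%:E)%E.
Proof.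
have [B B0 hB] := wsh_bound.
exists (B * fine (surface_measure (walls L : set (mpt R)))) => i t ht.
have mW := wsh_measurable i ht.
apply: le_trans (density_charge_variation (w := wsh i t) (B := B) _ _ _ _ _) _ => //.
- by move=> p; exact: hB.
- by move=> p hp; exact: (crossE u1 u2 t i hp).
have fm : surface_measure (walls L : set (mpt R)) \is a fin_num by rewrite ge0_fin_numE.
rewrite EFinM fineK// -(@integral_cst _ _ _ surface_measure)//.
apply: ge0_le_integral => //.
- by apply/measurable_EFinP; exact: measurableT_comp.
- by move=> p hp; rewrite lee_fin; exact: hB.
Qed.

Lemma sheet_measurable i g : {within Cb, continuous g} ->
  measurable_fun `]0, T[ (fun t => charge_int Cb (sheet t i) g).
Proof.
move=> cg; have [B _ hB] := wsh_bound.
apply: (@density_measurable_time R T L surface_measure (walls L) (wsh i)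
  (fun t p => crossv (plane_parallel u1 u2 t p) (outer_normal p) 0 i) B g) => //.
- exact: walls_sub.
- by move=> t ht; exact: wsh_measurable.
- by move=> t p ht; exact: hB.
- by move=> t p _ hp; exact: (crossE u1 u2 t i hp).
- move=> t p ht hp; apply: cvgM; first exact: cvg_cst.
  have path (F : st R -> R) : {within cyl_bar T, continuous F} ->
      {for t, continuous (fun s => F (stpt s p.1.1 p.2))}.
    move=> cF; have [_ _ hz] := walls_sub hp.
    have AT s : [set s | 0 < s < T] s -> 0 <= s <= T by exact: tT_cc.
    have := @path_cont R T F [set s | 0 < s < T] (fun _ => p.1.1) p.2 AT hz cF
      (fun s _ => cvg_cst p.1.1).
    rewrite continuous_open_subspace; first by apply; rewrite inE.
    have -> : [set s | 0 < s < T] = `]0, T[%classic by apply/seteqP; split => s /=; rewrite in_itv.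
    exact: interval_open.
  move: i; apply: ord3_ind; rewrite /wall_comp/=.
  + by apply: cvgN; exact: (path _ (C1_cont C1u2)).
  + exact: (path _ (C1_cont C1u1)).
  + exact: cvg_cst.
Qed.

Lemma sheet_out i t A : measurable A -> A `&` Cb = set0 -> sheet t i A = 0%E.
Proof. exact: (@density_charge_out _ _ surface_measure (walls L) _ (@walls_sub R L)). Qed.

End FlowCharges.

(** * The weak-star limit of the vorticity *)

Section WeakLimit.
Context {R : realType}.
Local Notation leb := (@lebesgue_measure R).
Variables (T L : R) (a : R -> R) (b : R -> R -> R) (f1 : R -> R -> R) (f2 : R -> R -> R -> R)
  (N : set (R * R)) (u1 : R * R -> R -> R -> R) (u2 : R * R -> R -> R -> R -> R)
  (v1 : R -> R -> R) (v2 : R -> R -> R -> R).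
Hypotheses (hT : 0 < T) (hL : 0 < L).
Hypothesis hf : forall j : 'I_3,
  smooth_cyl T (fun q => plane_parallel f1 f2 q.1 q.2 0 j) /\
  forall t, periodic2 L (fun p => plane_parallel f1 f2 t p 0 j).
Hypothesis hN : forall nu, N nu -> 0 < nu.1 /\ 0 < nu.2.
Hypothesis hvisc : forall nu, N nu ->
  viscous_solution T L a b f1 f2 nu.1 nu.2 (u1 nu) (u2 nu).
Hypothesis heuler : euler_solution T L a b f1 f2 v1 v2.
Local Notation Cb := (cell_bar L).

Let Cu1 nu : N nu -> C1_cyl T (lift1 (u1 nu)).
Proof. by move=> /hvisc h; exact: C12_C1 (visc_reg1 h). Qed.
Let Cu2 nu : N nu -> C1_cyl T (lift2 (u2 nu)).
Proof. by move=> /hvisc h; exact: C12_C1 (visc_reg2 h). Qed.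
Let peru nu : N nu -> forall t x z, u2 nu t (x + L) z = u2 nu t x z.
Proof. by move=> /hvisc[]. Qed.
Let Cv1 : C1_cyl T (lift1 v1) := euler_reg1 heuler.
Let Cv2 : C1_cyl T (lift2 v2) := euler_reg2 heuler.
Let perv := euler_periodic heuler.

Definition limit_charge t :=
  add_vcharge (vorticity L (plane_parallel v1 v2) t) (vortex_sheet L (plane_parallel v1 v2) t).

Lemma vorticity_Linf nu : N nu -> Linf_M T L (vorticity L (plane_parallel (u1 nu) (u2 nu))).
Proof.
move=> Nnu i; split.
- by move=> t A _; exact: vorticity_out.
- by move=> g cg; exact: (vorticity_measurable hL (Cu1 Nnu) (Cu2 Nnu) (peru Nnu)).
have [K hK] := vorticity_variation_bounded hL (Cu1 Nnu) (Cu2 Nnu) (peru Nnu).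
by exists K; apply: aeW => t; exact: hK.
Qed.

Lemma limit_measurable i g : {within Cb, continuous g} ->
  measurable_fun `]0, T[ (fun t => charge_int Cb (limit_charge t i) g).
Proof.
move=> cg.
have -> : (fun t => charge_int Cb (limit_charge t i) g) =
    (fun t => charge_int Cb (vorticity L (plane_parallel v1 v2) t i) g +
              charge_int Cb (vortex_sheet L (plane_parallel v1 v2) t i) g).
  by apply/funext => t; exact: charge_int_cadd.
apply: measurable_funD.
  exact: (vorticity_measurable hL Cv1 Cv2 perv).
exact: (sheet_measurable hL Cv1 Cv2).
Qed.

Lemma limit_variation : exists K, forall i t, 0 < t < T ->
  (charge_variation (hahnP (limit_charge t i)) setT <= K%:E)%E.
Proof.
have [B hB] := vorticity_variation_bounded hL Cv1 Cv2 perv.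
have [K hK] := sheet_variation hL Cv1 Cv2.
by exists (B + K) => i t ht; apply: variation_cadd; [exact: hB|exact: hK].
Qed.

Lemma limit_Linf : Linf_M T L limit_charge.
Proof.
move=> i; split.
- move=> t A _ mA A0; rewrite /limit_charge /add_vcharge.
  transitivity (vorticity L (plane_parallel v1 v2) t i A +
    vortex_sheet L (plane_parallel v1 v2) t i A)%E; first by [].
  by rewrite (vorticity_out _ _ _ _ mA A0) (sheet_out _ _ _ _ mA A0) adde0.
- by move=> g; exact: limit_measurable.
have [K hK] := limit_variation.
by exists K; apply: aeW => t; exact: hK.
Qed.

Section Sequence.
Variables (M : R) (hM : data_bound T f1 f2 v1 v2 M) (nu_ : nat -> R * R).
Hypotheses (Nnu_ : forall n, N (nu_ n)) (nu_le1 : forall n, (nu_ n).2 <= 1).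
Hypothesis nu_1 : (nu_ n).1 @[n --> \oo] --> (0 : R).
Hypothesis nu_2 : (nu_ n).2 @[n --> \oo] --> (0 : R).

Let E := expR (1 * T) * M.
Let C := CA T M + CB T M.
Let E0 : 0 <= E.
Proof. by rewrite mulr_ge0 ?expR_ge0// (db_ge0 hM). Qed.
Let CA0 : 0 <= CA T M := CA_ge0 hM.
Let CB0 : 0 <= CB T M := CB_ge0 hM.
(** One function dominates all three components: the layer profile takes care of the two
    [z]-derivatives, and [E] of [d_x u2]. *)
Let g_ n z := C * (expR 1 * layer (Num.sqrt (nu_ n).2) 1 z) + E.

Let g_cont n : continuous (g_ n).
Proof.
move=> z; apply: cvgD; last exact: cvg_cst.
apply: cvgM; first exact: cvg_cst.
by apply: cvgM; [exact: cvg_cst|exact: layer_cont].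
Qed.

Let s0 n : 0 < Num.sqrt (nu_ n).2.
Proof. by rewrite sqrtr_gt0; case: (hN (Nnu_ n)). Qed.

Let g_int n : \int[leb]_(z in `[0, 1]) g_ n z <= C * (expR 1 * 3) + E.
Proof.
have il : leb.-integrable `[0, 1] (EFin \o layer (Num.sqrt (nu_ n).2) 1).
  by apply: within_unit_integrable; apply: continuous_subspaceT; exact: layer_cont.
have i1 : leb.-integrable `[0, 1] (EFin \o (fun z => expR 1 * layer (Num.sqrt (nu_ n).2) 1 z)).
  by apply: within_unit_integrable => z; apply: cvgM; [exact: cvg_cst|exact: (continuous_subspaceT (@layer_cont R _))].
rewrite /g_ RintegralD//; last 2 first.
- apply: within_unit_integrable => z; apply: cvgM; first exact: cvg_cst.
  by apply: cvgM; [exact: cvg_cst|exact: (continuous_subspaceT (@layer_cont R _))].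
- by apply: within_unit_integrable => z; exact: cvg_cst.
rewrite RintegralZl// RintegralZl// Rintegral_cst//=.
rewrite lebesgue_measure_itv/= lte_fin ltr01 oppr0 adde0 mulr1 lerD2r.
rewrite ler_wpM2l ?addr_ge0// ler_wpM2l ?expR_ge0//; exact: integral_layer.
Qed.

Let W_bound i n t p : 0 < t < T -> cell L p ->
  `|curl_comp (u1 (nu_ n)) (u2 (nu_ n)) i t p| <= g_ n p.2.
Proof.
case: p => [[x y] z] ht [_ _ /= hz].
have l0 : 0 <= expR 1 * layer (Num.sqrt (nu_ n).2) 1 z.
  by rewrite mulr_ge0 ?expR_ge0// (le_trans ler01)// layer_ge1.
have hA : `|Dz (lift1 (u1 (nu_ n))) (stpt t x z)| <= CA T M * (expR 1 * layer (Num.sqrt (nu_ n).2) 1 z).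
  by apply: (u1_dz_bound hT hL hN hvisc heuler hM (Nnu_ n)).
have hB : `|Dz (lift2 (u2 (nu_ n))) (stpt t x z)| <= CB T M * (expR 1 * layer (Num.sqrt (nu_ n).2) 1 z).
  by apply: (u2_dz_bound hT hL hN hvisc heuler hM (Nnu_ n)).
have hX : `|Dx (lift2 (u2 (nu_ n))) (stpt t x z)| <= E.
  by apply: (u2_dx_bound hT hL hN hvisc heuler hM (Nnu_ n)).
have gE : g_ n z = CA T M * (expR 1 * layer (Num.sqrt (nu_ n).2) 1 z) +
    CB T M * (expR 1 * layer (Num.sqrt (nu_ n).2) 1 z) + E by rewrite /g_ /C mulrDl.
have A0 := mulr_ge0 CA0 l0; have B0 := mulr_ge0 CB0 l0.
rewrite gE; move: i; apply: ord3_ind; rewrite /curl_comp/= ?normrN.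
- by rewrite Dz_indep_y (le_trans hB)// -addrA addrCA lerDl addr_ge0.
- by rewrite Dz1_indep_y (le_trans hA)// -addrA lerDl addr_ge0.
- by rewrite Dx_indep_y (le_trans hX)// lerDr addr_ge0.
Qed.

Lemma vorticity_variation_seq n t i : 0 < t < T ->
  (charge_variation (hahnP (vorticity L (plane_parallel (u1 (nu_ n)) (u2 (nu_ n))) t i)) setT <=
    (L * L * (C * (expR 1 * 3) + E))%:E)%E.
Proof.
move=> ht.
apply: le_trans (vorticity_variation hL (Cu1 (Nnu_ n)) (Cu2 (Nnu_ n)) (peru (Nnu_ n)) i ht) _.
rewrite lee_fin; apply: (cell_int_le (g := g_ n)) => //.
- exact: (curl_comp_measurable (T := T) (Cu1 (Nnu_ n)) (Cu2 (Nnu_ n))).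
- by move=> p hp; exact: W_bound.
Qed.

(** The time is fixed here; integration in time is left to [pairing_cvg]. *)
Lemma vorticity_cvg t i g : 0 < t < T -> {within Cb, continuous g} ->
  charge_int Cb (vorticity L (plane_parallel (u1 (nu_ n)) (u2 (nu_ n))) t i) g @[n --> \oo] -->
  charge_int Cb (limit_charge t i) g.
Proof.
move=> ht cg.
have ht' : 0 <= t <= T by case/andP: ht => /ltW -> /ltW ->.
have htT : 0 <= t < T by case/andP: ht => /ltW -> ->.
pose W n := curl_comp (u1 (nu_ n)) (u2 (nu_ n)) i t.
pose Wv := curl_comp v1 v2 i t.
pose H n := wall_comp (u1 (nu_ n)) (u2 (nu_ n)) i t.
pose Hv := wall_comp v1 v2 i t.
have EL n : charge_int Cb (vorticity L (plane_parallel (u1 (nu_ n)) (u2 (nu_ n))) t i) g =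
    \int[leb3]_(p in cell L) (g p * W n p).
  exact: (vorticity_int hL (Cu1 (Nnu_ n)) (Cu2 (Nnu_ n)) (peru (Nnu_ n)) i ht cg).
have ER : charge_int Cb (limit_charge t i) g = \int[leb3]_(p in cell L) (g p * Wv p) +
    \int[leb2]_(q in sq L) (g (q, 0) * Hv (q, 0) - g (q, 1) * Hv (q, 1)).
  transitivity (charge_int Cb (vorticity L (plane_parallel v1 v2) t i) g +
              charge_int Cb (vortex_sheet L (plane_parallel v1 v2) t i) g).
    exact: charge_int_cadd.
  congr (_ + _); first exact: (vorticity_int hL Cv1 Cv2 perv i ht cg).
  exact: (sheet_int hL Cv1 Cv2 i ht cg).
rewrite ER (_ : (fun n => _) = (fun n => \int[leb3]_(p in cell L) (g p * W n p))); last first.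
  by apply/funext => n; exact: EL.
have mW n : measurable_fun (cell L : set (mpt R)) (W n).
  exact: (curl_comp_measurable (T := T) (Cu1 (Nnu_ n)) (Cu2 (Nnu_ n))).
have mWv : measurable_fun (cell L : set (mpt R)) Wv.
  exact: (curl_comp_measurable (T := T) Cv1 Cv2).
(* The third component, [d_x u2], is uniformly bounded and converges pointwise, so that bounded
   convergence settles it without a wall term. *)
have [i2|i2] := eqVneq i 2.
  have H0 p : Hv p = 0 by rewrite /Hv i2.
  rewrite [X in _ + X](_ : _ = 0) ?addr0; last first.
    rewrite (_ : (fun q => _) = (fun _ => 0)); last by apply/funext => q; rewrite !H0 !mulr0 subrr.
    by rewrite Rintegral_cst ?mul0r//; exact: measurable_sq.
  have [B _ gB] := cell_bar_bounded cg.
  apply: (@bounded_cvg_Rintegral _ _ _ leb3 _ _ _ (B * E)).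
  - exact: measurable_cell.
  - by rewrite leb3_cell// ltry.
  - by move=> n; apply: measurable_funM => //; exact: cell_measurable.
  - by apply: measurable_funM => //; exact: cell_measurable.
  - move=> n [[x y] z] hp; rewrite normrM; apply: ler_pM => //; first exact/gB/cell_sub.
    case: hp => _ _ /= hz; rewrite /W i2 /curl_comp/= Dx_indep_y.
    by apply: (u2_dx_bound hT hL hN hvisc heuler hM (Nnu_ n)).
  - apply: aeW => -[[x y] z] [_ _ /= hz]; apply: cvgM; first exact: cvg_cst.
    rewrite /W /Wv i2 /curl_comp/= Dx_indep_y.
    under eq_fun do rewrite Dx_indep_y.
    by apply: (cvg_u2_dx hT hL hN hvisc heuler hM Nnu_ nu_1 nu_2).
(* [cell_layer_limit] asks for continuity up to the walls, so that each curl is replaced by its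
   continuous extension, with the same integral over the open cell. *)
have hG n := curl_comp_ext L (Cu1 (Nnu_ n)) (Cu2 (Nnu_ n)) i ht.
pose G n := s2val (cid2 (hG n)).
have cG n : {within Cb, continuous (G n)} := s2valP (cid2 (hG n)).
have GE n p : cell L p -> G n p = W n p := s2valP' (cid2 (hG n)) p.
have [Gv cGv GvE] := curl_comp_ext L Cv1 Cv2 i ht.
rewrite (_ : (fun n => _) = (fun n => \int[leb3]_(p in cell L) (g p * G n p))); last first.
  by apply/funext => n; apply: eq_Rintegral => p /set_mem hp; rewrite GE.
rewrite (_ : \int[leb3]_(p in cell L) (g p * Wv p) = \int[leb3]_(p in cell L) (g p * Gv p)); last first.
  by apply: eq_Rintegral => p /set_mem hp; rewrite GvE.
apply: (@cell_layer_limit R L (C * (expR 1 * 3) + E) E g Hv Gv H G g_ hL cg).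
- by apply: (wall_comp_cont (T := T)).
- exact: cGv.
- by move=> n; apply: (wall_comp_cont (T := T)) => //; [exact: Cu1|exact: Cu2].
- exact: cG.
- move=> q z hq hz; rewrite GvE; last exact: sq_cell.
  exact: (wall_comp_derive Cv1 Cv2 q i2 ht hz).
- move=> n q z hq hz; rewrite GE; last exact: sq_cell.
  exact: (wall_comp_derive (Cu1 (Nnu_ n)) (Cu2 (Nnu_ n)) q i2 ht hz).
- move=> n [x y] _; have bc := visc_bc (hvisc (Nnu_ n)).
  have [w1 w2] := bc t x false ht'; have [w3 w4] := bc t x true ht'.
  rewrite /H; move: (i); apply: ord3_ind; rewrite /wall_comp/=.
  + by rewrite w2 w4 oppr0.
  + by rewrite w1 w3.
  + by [].
- by move=> n; apply: continuous_subspaceT; exact: g_cont.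
- exact: g_int.
- by move=> n p hp; rewrite GE//; exact: W_bound.
- move=> n [[x y] z] [_ _ /= hz].
  have h1 : `|u1 (nu_ n) t z| <= E by apply: (u1_bound hT hL hN hvisc heuler hM (Nnu_ n)).
  have h2 : `|u2 (nu_ n) t x z| <= E by apply: (u2_bound hT hL hN hvisc heuler hM (Nnu_ n)).
  rewrite /H; move: (i); apply: ord3_ind; rewrite /wall_comp/= ?normrN ?normr0//.
- move=> [[x y] z] [_ _ /= hz].
  have h1 : u1 (nu_ n) t z @[n --> \oo] --> v1 t z.
    by apply: (cvg_u1 hT hL hN hvisc heuler hM Nnu_ nu_1 nu_2).
  have h2 : u2 (nu_ n) t x z @[n --> \oo] --> v2 t x z.
    by apply: (cvg_u2 hT hL hN hvisc heuler hM Nnu_ nu_1 nu_2).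
  rewrite /H /Hv; move: (i); apply: ord3_ind; rewrite /wall_comp/=.
  + exact: cvgN.
  + exact: h1.
  + exact: cvg_cst.
Qed.

End Sequence.
End WeakLimit.

Theorem theorem2p2 (R : realType) (T L : R) (m : nat)
  (a : R -> R) (b : R -> R -> R) (f1 : R -> R -> R) (f2 : R -> R -> R -> R)
  (alpha : R) (N : set (R * R))
  (u1 : R * R -> R -> R -> R) (u2 : R * R -> R -> R -> R -> R)
  (v1 : R -> R -> R) (v2 : R -> R -> R -> R)
  (hT : 0 < T) (hL : 0 < L) (hm : (5 < m)%N)
  (* the data, independent of the viscosities *)
  (hu0 : forall j : 'I_3,
     Hm L m (fun p => plane_parallel (fun=> a) (fun=> b) 0 p 0 j))
  (hf : forall j : 'I_3,
     smooth_cyl T (fun q => plane_parallel f1 f2 q.1 q.2 0 j) /\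
     forall t, periodic2 L (fun p => plane_parallel f1 f2 t p 0 j))
  (* the viscosities nu = (nu1, nu3) under consideration *)
  (halpha : 1 / 2 < alpha < 1)
  (hN : forall nu, N nu ->
     [/\ 0 < nu.1, 0 < nu.2 &
         nu.1 <= nu.2 \/ (nu.2 <= nu.1 /\ nu.1 <= nu.2 `^ (1 / (2 * alpha)))])
  (hcompat : forall nu, N nu -> compatible a b f1 f2 nu.1 nu.2)
  (hvisc : forall nu, N nu ->
     viscous_solution T L a b f1 f2 nu.1 nu.2 (u1 nu) (u2 nu))
  (heuler : euler_solution T L a b f1 f2 v1 v2) :
  weak_star_cvg T L (within N (nbhs ((0 : R), (0 : R))))
    (fun nu => vorticity L (plane_parallel (u1 nu) (u2 nu)))
    (fun t => add_vcharge (vorticity L (plane_parallel v1 v2) t)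
                          (vortex_sheet L (plane_parallel v1 v2) t)).
Proof.
have hN' nu : N nu -> 0 < nu.1 /\ 0 < nu.2 by move=> /hN[].
have hlim := limit_Linf hL heuler.
split.
- rewrite near_withinE; apply: nearW => nu Nnu; exact: (vorticity_Linf hL hvisc Nnu).
- exact: hlim.
move=> phi hphi.
set P := fun nu => pairing _ _ _ _; set Q := pairing _ _ _ _.
(* Dominated convergence is available for sequences, whereas the viscosities tend to [0] along a
   filter. If convergence failed, the balls of radius [1 / (n + 1)] would supply viscosities in [N],
   tending to [0], with pairings at distance more than [e] from the limit. *)
apply/cvgrPdist_le => e e0; apply: contrapT => nearN.
have bad (n : nat) : exists nu : R * R, [/\ N nu, `|nu.1| < n.+1%:R^-1, `|nu.2| < n.+1%:R^-1 & ~ (`|Q - P nu| <= e)].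
  apply: contrapT => none; apply: nearN.
  apply/nbhs_ballP; exists n.+1%:R^-1 => /=; first by rewrite invr_gt0.
  move=> nu [/= b1 b2] Nnu; apply: contrapT => nP; apply: none; exists nu; split => //.
  - by move: b1; rewrite /ball/= sub0r normrN.
  - by move: b2; rewrite /ball/= sub0r normrN.
have [nu_ hnu] := choice bad.
have Nnu_ n : N (nu_ n) by case: (hnu n).
have inv0 : (n.+1%:R^-1 : R) @[n --> \oo] --> (0 : R) by exact: cvg_harmonic.
have cvg0 (f : nat -> R) : (forall n, `|f n| < n.+1%:R^-1) -> f n @[n --> \oo] --> (0 : R).
  move=> fn; apply/norm_cvg0P; apply: (squeeze_cvgr _ (cvg_cst 0) inv0).
  by apply: nearW => n; rewrite normr_ge0/= ltW.
have nu_1 : (nu_ n).1 @[n --> \oo] --> (0 : R) by apply: cvg0 => n; case: (hnu n).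
have nu_2 : (nu_ n).2 @[n --> \oo] --> (0 : R) by apply: cvg0 => n; case: (hnu n).
have nu_le1 n : (nu_ n).2 <= 1.
  have [_ _ h _] := hnu n; apply: le_trans (ler_norm _) _; apply: le_trans (ltW h) _.
  by rewrite invf_le1// ler1n.
(* One viscous solution is enough to produce [M], and the first term of the sequence provides it;
   the bound then serves all [n]. *)
have [M hM] := data_boundP hT hL hf hvisc heuler (Nnu_ 0).
have [K hK] := limit_variation hL heuler.
pose K' := L * L * ((CA T M + CB T M) * (expR 1 * 3) + expR (1 * T) * M).
have cv : P (nu_ n) @[n --> \oo] --> Q.
  apply: (@pairing_cvg R T L hL _ _ phi (Num.max K' K)) => //.
  - by move=> n i g cg; have [_ + _] := vorticity_Linf hL hvisc (Nnu_ n) i; exact.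
  - by move=> i g cg; have [_ + _] := hlim i; exact.
  - move=> n t i ht; apply: (@le_trans _ _ K'%:E); last by rewrite lee_fin le_max lexx.
    exact: (vorticity_variation_seq hT hL hN' hvisc heuler hM Nnu_ nu_le1).
  - move=> t i ht; apply: (@le_trans _ _ K%:E); last by rewrite lee_fin le_max lexx orbT.
    exact: hK.
  - move=> t i g ht cg.
    by apply: (vorticity_cvg hT hL hN' hvisc heuler hM Nnu_ nu_le1 nu_1 nu_2).
have /cvgrPdist_le/(_ e e0)[n0 _ /(_ n0 (leqnn _))] := cv.
by have [_ _ _] := hnu n0.
Qed.
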